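(* Let $U$ be the quantized enveloping algebra over $\mathbb{F}=\mathbb{Q}(q)$ attached to the data $\mathfrak{h}$, $\{h_i\}_{i\in I}$, $\{\alpha_i\}_{i\in I}$, $(\;,\;)$, $\mathfrak{h}_{\mathbb{Z}}$ of a symmetrizable generalized Cartan matrix, let $\tau$ be the Drinfeld pairing, and let $T_i:U\to U$ ($i\in I$) be Lusztig's braid group automorphism (all as defined in the context). Then for every $i\in I$, every $x\in U^+\cap T_i(U^+)$ and every $y\in U^-\cap T_i(U^-)$ we have \[ \tau(T_i^{-1}(x),T_i^{-1}(y))=\tau(x,y). \]
   Context: **Data.** $\mathfrak{h}$ is a finite-dimensional $\mathbb{Q}$-vector space; $\{h_i\}_{i\in I}\subset\mathfrak{h}$ and $\{\alpha_i\}_{i\in I}\subset\mathfrak{h}^*$ are linearly independent subsets such that $(\langle\alpha_j,h_i\rangle)_{i,j\in I}$ is a symmetrizable generalized Cartan matrix. $Q=\sum_{i\in I}\mathbb{Z}\alpha_i$. The Weyl group $W\subset GL(\mathfrak{h})$ is generated by $s_i(h)=h-\langle\alpha_i,h\rangle h_i$ ($i\in I$); it acts on $\mathfrak{h}^*$ by $s_i(\lambda)=\lambda-\langle\lambda,h_i\rangle\alpha_i$. $(\;,\;)$ is a $W$-invariant symmetric $\mathbb{Q}$-valued bilinear form on $\sum_i\mathbb{Q}\alpha_i$ with $\frac{(\alpha_i,\alpha_i)}{2}\in\mathbb{Z}_{>0}$ for all $i$. $\mathfrak{h}_{\mathbb{Z}}$ is a $\mathbb{Z}$-form of $\mathfrak{h}$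 such that $\langle\alpha_i,\mathfrak{h}_{\mathbb{Z}}\rangle\subset\mathbb{Z}$ and $t_i:=\frac{(\alpha_i,\alpha_i)}{2}h_i\in\mathfrak{h}_{\mathbb{Z}}$ for all $i\in I$. For $\gamma=\sum_in_i\alpha_i\in Q$ put $t_\gamma=\sum_in_it_i$. **Quantized enveloping algebra.** $[n]_x=\frac{x^n-x^{-n}}{x-x^{-1}}$, $[n]!_x=[n]_x\cdots[1]_x$, $q_i=q^{(\alpha_i,\alpha_i)/2}$. $U$ is the associative $\mathbb{F}$-algebra generated by $k_h$ ($h\in\mathfrak{h}_{\mathbb{Z}}$), $e_i,f_i$ ($i\in I$) with relations: $k_0=1$, $k_hk_{h'}=k_{h+h'}$; $k_he_ik_{-h}=q^{\langle\alpha_i,h\rangle}e_i$; $k_hf_ik_{-h}=q^{-\langle\alpha_i,h\rangle}f_i$; $e_if_j-f_je_i=\delta_{ij}\frac{k_i-k_i^{-1}}{q_i-q_i^{-1}}$; and for $i\neq j$, $\sum_{r+s=1-\langle\alpha_j,h_i\rangle}(-1)^re_i^{(r)}e_je_i^{(s)}=0$ and $\sum_{r+s=1-\langle\alpha_j,h_i\rangle}(-1)^rf_i^{(r)}f_jf_i^{(s)}=0$. Here $k_i=k_{t_i}$, $e_i^{(r)}=e_i^r/[r]!_{q_i}$, $f_i^{(r)}=f_i^r/[r]!_{q_i}$. For $\gamma\in Q$, $k_\gamma=k_{t_\gamma}$. $U$ is a Hopf algebra with coproduct $\Delta(k_h)=k_h\otimes k_h$, $\Delta(e_i)=e_i\otimes1+k_i\otimes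 e_i$, $\Delta(f_i)=f_i\otimes k_i^{-1}+1\otimes f_i$, counit $\varepsilon(k_h)=1$, $\varepsilon(e_i)=\varepsilon(f_i)=0$, and antipode $S(k_h)=k_h^{-1}$, $S(e_i)=-k_i^{-1}e_i$, $S(f_i)=-f_ik_i$. $U^+$ (resp. $U^-$) is the subalgebra generated by all $e_i$ (resp. all $f_i$). **Drinfeld pairing.** Put $\tilde U^0=\bigoplus_{\gamma\in Q}\mathbb{F}k_\gamma$, $\tilde U^{\geqq0}=\tilde U^0U^+$, $\tilde U^{\leqq0}=\tilde U^0U^-$. $\tau:\tilde U^{\geqq0}\times\tilde U^{\leqq0}\to\mathbb{F}$ is the bilinear form characterized by: $\tau(x,y_1y_2)=(\tau\otimes\tau)(\Delta(x),y_1\otimes y_2)$, $\tau(x_1x_2,y)=(\tau\otimes\tau)(x_2\otimes x_1,\Delta(y))$, $\tau(k_\gamma,k_\delta)=q^{-(\gamma,\delta)}$, $\tau(e_i,f_j)=-\delta_{ij}(q_i-q_i^{-1})^{-1}$, $\tau(e_i,k_\gamma)=\tau(k_\gamma,f_i)=0$ for all $x,x_1,x_2\in\tilde U^{\geqq0}$, $y,y_1,y_2\in\tilde U^{\leqq0}$, $\gamma,\delta\in Q$, $i,j\in I$, where $(\tau\otimes\tau)(a\otimes b,c\otimes d)=\tau(a,c)\tau(b,d)$. **Braid group automorphism.** $T_i:U\to U$ is the algebra automorphism (Lusztig's $T''_{i,1}$) given by $T_i(k_h)=k_{s_ih}$ ($h\in\mathfrak{h}_{\mathbb{Z}}$), $T_i(e_i)=-f_ik_i$,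 $T_i(f_i)=-k_i^{-1}e_i$, and for $j\neq i$, $T_i(e_j)=\sum_{r+s=-\langle\alpha_j,h_i\rangle}(-1)^rq_i^{-r}e_i^{(s)}e_je_i^{(r)}$, $T_i(f_j)=\sum_{r+s=-\langle\alpha_j,h_i\rangle}(-1)^rq_i^{r}f_i^{(r)}f_jf_i^{(s)}$. *)

(* Defs.v *)
From HB Require Import structures.
From mathcomp Require Import all_boot all_order all_algebra.
From mathcomp.classical Require Import boolp classical_sets.
From mathcomp.multinomials Require Import monalg.

Set Implicit Arguments.
Unset Strict Implicit.
Unset Printing Implicit Defensive.

Import Order.TTheory GRing.Theory Num.Theory.

Local Open Scope ring_scope.
Local Open Scope quotient_scope.

(* Tensor product of algebras: a finite formal sum of a (x) b is a list of
   pairs, and two sums are identified modulo bilinearity. *)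

Section TensorRelation.
Variables (K : comNzRingType) (A B : algType K).

Inductive tens_rel : seq (A * B) -> seq (A * B) -> Prop :=
| tens_refl s : tens_rel s s
| tens_sym s t : tens_rel s t -> tens_rel t s
| tens_trans s t u : tens_rel s t -> tens_rel t u -> tens_rel s u
| tens_cat s s' t t' :
    tens_rel s s' -> tens_rel t t' -> tens_rel (s ++ t) (s' ++ t')
| tens_catC s t : tens_rel (s ++ t) (t ++ s)
| tens_Dl a a' b : tens_rel [:: (a + a', b)] [:: (a, b); (a', b)]
| tens_Dr a b b' : tens_rel [:: (a, b + b')] [:: (a, b); (a, b')]
| tens_Z c a b : tens_rel [:: (c *: a, b)] [:: (a, c *: b)]
| tens_0 b : tens_rel [:: (0, b)] [::].

Definition tens_eqb : rel (seq (A * B)) := fun s t => `[< tens_rel s t >].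

Lemma tens_eqb_equiv : equiv_class_of tens_eqb.
Proof.
split=> [s|s t|t s u].
- exact/asboolP/tens_refl.
- by apply/asboolP/asboolP; apply: tens_sym.
- by move=> /asboolP st /asboolP tu; apply/asboolP/(tens_trans st tu).
Qed.

Canonical tens_eqb_equivRel := EquivRelPack tens_eqb_equiv.
Canonical tens_eqb_encModRel := defaultEncModRel tens_eqb.

Definition tensor := {eq_quot tens_eqb}.

HB.instance Definition _ := Choice.on tensor.
HB.instance Definition _ : EqQuotient _ tens_eqb tensor :=
  EqQuotient.on tensor.

Lemma tensorP s t : tens_rel s t <-> \pi_tensor s = \pi_tensor t.
Proof. by split=> [st|/eqmodP/asboolP//]; apply/eqmodP/asboolP. Qed.

Definition pmul (p r : A * B) : A * B := (p.1 * r.1, p.2 * r.2).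
Definition smul (s t : seq (A * B)) := [seq pmul p r | p <- s, r <- t].
Definition sscale (c : K) (s : seq (A * B)) := [seq (c *: p.1, p.2) | p <- s].

Let refl := tens_refl.

Lemma tens_swap s t u v :
  tens_rel ((s ++ t) ++ (u ++ v)) ((s ++ u) ++ (t ++ v)).
Proof.
rewrite -!catA; apply: (tens_cat (refl s)); rewrite !catA.
exact: tens_cat (tens_catC t u) (refl v).
Qed.

Lemma tens_sscale c s t : tens_rel s t -> tens_rel (sscale c s) (sscale c t).
Proof.
elim=> {s t} [s|s t _ ih|s t u _ ih1 _ ih2|s s' t t' _ ih1 _ ih2|s t
  |a a' b|a b b'|c' a b|b]; rewrite /sscale ?map_cat /=.
- exact: refl.
- exact: tens_sym.
- exact: tens_trans ih1 ih2.
- exact: tens_cat.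
- exact: tens_catC.
- by rewrite scalerDr; apply: tens_Dl.
- exact: tens_Dr.
- by rewrite scalerA mulrC -scalerA; apply: tens_Z.
- by rewrite scaler0; apply: tens_0.
Qed.

Lemma tens_pmull p s t :
  tens_rel s t -> tens_rel (map (pmul p) s) (map (pmul p) t).
Proof.
elim=> {s t} [s|s t _ ih|s t u _ ih1 _ ih2|s s' t t' _ ih1 _ ih2|s t
  |a a' b|a b b'|c' a b|b]; rewrite ?map_cat /= /pmul /=.
- exact: refl.
- exact: tens_sym.
- exact: tens_trans ih1 ih2.
- exact: tens_cat.
- exact: tens_catC.
- by rewrite mulrDr; apply: tens_Dl.
- by rewrite mulrDr; apply: tens_Dr.
- by rewrite -!scalerAr; apply: tens_Z.
- by rewrite mulr0; apply: tens_0.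
Qed.

Lemma tens_pmulr p s t :
  tens_rel s t -> tens_rel (map (pmul^~ p) s) (map (pmul^~ p) t).
Proof.
elim=> {s t} [s|s t _ ih|s t u _ ih1 _ ih2|s s' t t' _ ih1 _ ih2|s t
  |a a' b|a b b'|c' a b|b]; rewrite ?map_cat /= /pmul /=.
- exact: refl.
- exact: tens_sym.
- exact: tens_trans ih1 ih2.
- exact: tens_cat.
- exact: tens_catC.
- by rewrite mulrDl; apply: tens_Dl.
- by rewrite mulrDl; apply: tens_Dr.
- by rewrite -!scalerAl; apply: tens_Z.
- by rewrite mul0r; apply: tens_0.
Qed.

Lemma smul_cons p s t : smul (p :: s) t = map (pmul p) t ++ smul s t.
Proof. by []. Qed.

Lemma smuls0 s : smul s [::] = [::].
Proof. by elim: s. Qed.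

Lemma smul_consr s r t :
  tens_rel (smul s (r :: t)) (map (pmul^~ r) s ++ smul s t).
Proof.
elim: s => [|p s ih]; first exact: refl.
rewrite !smul_cons map_cons map_cons /=.
apply: (tens_cat (refl [:: pmul p r])).
apply: tens_trans (tens_cat (refl (map (pmul p) t)) ih) _.
by rewrite !catA; apply: tens_cat (tens_catC _ _) (refl _).
Qed.

Lemma tens_smul s s' t t' :
  tens_rel s s' -> tens_rel t t' -> tens_rel (smul s t) (smul s' t').
Proof.
move=> ss' tt'; apply: (@tens_trans _ (smul s t')).
  elim: s {ss'} => [|p s ih]; first exact: refl.
  by rewrite !smul_cons; apply: tens_cat (tens_pmull p tt') ih.
elim: t' {t tt'} => [|r t ih]; first by rewrite !smuls0; apply: refl.
apply: tens_trans (smul_consr _ _ _) _.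
apply: tens_trans (tens_sym (smul_consr _ _ _)).
exact: tens_cat (tens_pmulr r ss') ih.
Qed.

Lemma smul_catl s t u : smul (s ++ t) u = smul s u ++ smul t u.
Proof. by elim: s => [//|p s ih]; rewrite cat_cons !smul_cons ih catA. Qed.

Lemma smul_catr s t u : tens_rel (smul s (t ++ u)) (smul s t ++ smul s u).
Proof.
elim: s => [|p s ih]; first exact: refl.
rewrite !smul_cons map_cat.
apply: tens_trans (tens_cat (refl _) ih) _; exact: tens_swap.
Qed.

Lemma smulA s t u : smul s (smul t u) = smul (smul s t) u.
Proof.
elim: s => [//|p s ih]; rewrite !smul_cons smul_catl -ih; congr (_ ++ _).
elim: t {ih} => [//|r t iht]; rewrite smul_cons map_cat iht map_cons smul_cons.
by rewrite -map_comp; congr (_ ++ _); apply: eq_map => v;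
  rewrite /pmul /= !mulrA.
Qed.

Lemma smul1s s : smul [:: (1, 1)] s = s.
Proof.
rewrite smul_cons cats0 map_id_in // => -[a b] _.
by rewrite /pmul /= !mul1r.
Qed.

Lemma smuls1 s : smul s [:: (1, 1)] = s.
Proof.
by elim: s => [//|[a b] s ih]; rewrite smul_cons ih /pmul /= !mulr1.
Qed.

Lemma sscale_addN s : tens_rel (sscale (-1) s ++ s) [::].
Proof.
elim: s => [|[a b] s ih]; first exact: refl.
rewrite -[_ :: s]cat1s -[sscale _ _]/([:: (-1 *: a, b)] ++ sscale (-1) s).
apply: tens_trans (tens_swap _ _ _ _) _; rewrite -[[::]]cats0.
apply: tens_cat ih; apply: tens_trans (tens_sym (tens_Dl _ _ _)) _.
by rewrite scaleN1r addNr; apply: tens_0.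
Qed.

Lemma sscaleDl c d s : tens_rel (sscale (c + d) s) (sscale c s ++ sscale d s).
Proof.
elim: s => [|[a b] s ih]; first exact: refl.
rewrite -[sscale _ _]/([:: ((c + d) *: a, b)] ++ sscale (c + d) s) scalerDl.
apply: tens_trans (tens_cat (tens_Dl _ _ _) ih) _.
exact: (tens_swap [:: _] [:: _]).
Qed.

End TensorRelation.

Section TensorAlgebra.
Variables (K : comNzRingType) (A B : algType K).
Local Notation T := (tensor A B).
Implicit Types x y z : T.

Definition tadd := lift_op2 T (@cat (A * B)%type).
Definition topp := lift_op1 T (@sscale K A B (-1)).
Definition tmul := lift_op2 T (@smul K A B).
Definition tscale c := lift_op1 T (@sscale K A B c).

Lemma tens_repr s : tens_rel (repr (\pi_T s)) s.
Proof. by apply/tensorP; rewrite reprK. Qed.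

Lemma taddE s t : tadd (\pi_T s) (\pi_T t) = \pi_T (s ++ t).
Proof. by unlock tadd; apply/tensorP/tens_cat; apply: tens_repr. Qed.
Lemma toppE s : topp (\pi_T s) = \pi_T (sscale (-1) s).
Proof. by unlock topp; apply/tensorP/tens_sscale/tens_repr. Qed.
Lemma tmulE s t : tmul (\pi_T s) (\pi_T t) = \pi_T (smul s t).
Proof. by unlock tmul; apply/tensorP/tens_smul; apply: tens_repr. Qed.
Lemma tscaleE c s : tscale c (\pi_T s) = \pi_T (sscale c s).
Proof. by unlock tscale; apply/tensorP/tens_sscale/tens_repr. Qed.

Lemma taddA : associative tadd.
Proof.
by elim/quotW=> s; elim/quotW=> t; elim/quotW=> u; rewrite !taddE catA.
Qed.
Lemma taddC : commutative tadd.
Proof.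
by elim/quotW=> s; elim/quotW=> t; rewrite !taddE; apply/tensorP/tens_catC.
Qed.
Lemma tadd0 : left_id (\pi_T [::]) tadd.
Proof. by elim/quotW=> s; rewrite taddE. Qed.
Lemma taddN : left_inverse (\pi_T [::]) topp tadd.
Proof.
by elim/quotW=> s; rewrite toppE taddE; apply/tensorP/sscale_addN.
Qed.

HB.instance Definition _ := GRing.isZmodule.Build T taddA taddC tadd0 taddN.

Lemma tmulA : associative tmul.
Proof.
by elim/quotW=> s; elim/quotW=> t; elim/quotW=> u; rewrite !tmulE smulA.
Qed.
Lemma tmul1 : left_id (\pi_T [:: (1, 1)]) tmul.
Proof. by elim/quotW=> s; rewrite tmulE smul1s. Qed.
Lemma tmulr1 : right_id (\pi_T [:: (1, 1)]) tmul.
Proof. by elim/quotW=> s; rewrite tmulE smuls1. Qed.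
Lemma tmulDl : left_distributive tmul tadd.
Proof.
elim/quotW=> s; elim/quotW=> t; elim/quotW=> u.
by rewrite !(taddE, tmulE) smul_catl.
Qed.
Lemma tmulDr : right_distributive tmul tadd.
Proof.
elim/quotW=> s; elim/quotW=> t; elim/quotW=> u.
by rewrite !(taddE, tmulE); apply/tensorP/smul_catr.
Qed.

HB.instance Definition _ :=
  GRing.Zmodule_isPzRing.Build T tmulA tmul1 tmulr1 tmulDl tmulDr.

Lemma tscaleA c d x : tscale c (tscale d x) = tscale (c * d) x.
Proof.
elim/quotW: x => s; rewrite !tscaleE /sscale -map_comp; congr (\pi_T _).
by apply: eq_map => p /=; rewrite scalerA.
Qed.
Lemma tscale1 : left_id 1 tscale.
Proof.
elim/quotW=> s; rewrite tscaleE /sscale map_id_in // => -[a b] _ /=.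
by rewrite scale1r.
Qed.
Lemma tscaleDr : right_distributive tscale +%R.
Proof.
move=> c; elim/quotW=> s; elim/quotW=> t.
by rewrite /GRing.add /= !(taddE, tscaleE) /sscale map_cat.
Qed.
Lemma tscaleDl x : {morph tscale^~ x : c d / c + d}.
Proof.
elim/quotW: x => s c d; rewrite !tscaleE [RHS]taddE.
exact/tensorP/sscaleDl.
Qed.

HB.instance Definition _ :=
  GRing.Zmodule_isLmodule.Build K T tscaleA tscale1 tscaleDr tscaleDl.

Definition tens (a : A) (b : B) : T := \pi_T [:: (a, b)].

End TensorAlgebra.

Notation "a *t b" := (tens a b) (at level 40, left associativity) : ring_scope.

Section Span.
Variables (K : nzRingType).

Inductive lspan (V : lmodType K) (S : set V) : V -> Prop :=
| lspan_gen x : S x -> lspan S x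
| lspan_0 : lspan S 0
| lspan_ZD c x y : lspan S x -> lspan S y -> lspan S (c *: x + y).

Inductive subalg (A : algType K) (S : set A) : A -> Prop :=
| subalg_gen x : S x -> subalg S x
| subalg_1 : subalg S 1
| subalg_ZD c x y : subalg S x -> subalg S y -> subalg S (c *: x + y)
| subalg_M x y : subalg S x -> subalg S y -> subalg S (x * y).

Definition mulspace (A : algType K) (X Y : set A) : set A :=
  lspan [set x * y | x in X & y in Y]%classic.

End Span.

(* a i j stands for <alpha_j, h_i> *)
Definition gen_cartan (I : finType) (a : I -> I -> int) : Prop :=
  [/\ forall i, a i i = 2,
      forall i j, i != j -> a i j <= 0
    & forall i j, a i j = 0 -> a j i = 0].

Definition symmetrizable (I : finType) (a : I -> I -> int) : Prop :=
  exists d : I -> rat, (forall i, d i != 0) /\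
    (forall i j, d i * (a i j)%:~R = d j * (a j i)%:~R).

Section Weyl.
Variables (I : finType) (h : vectType rat).
Variables (alphav : I -> h) (alpha : I -> 'Hom(h, rat^o)).

Definition srefl (i : I) : 'End(h) :=
  linfun (fun x : h => x - (alpha i x : rat) *: alphav i).

Lemma sreflE i x : srefl i x = x - (alpha i x : rat) *: alphav i.
Proof.
rewrite /srefl; set f := (fun _ => _).
have f_lin : linear f.
  move=> c u v; rewrite /f linearP /= scalerBr [X in _ - X]scalerDl.
  by rewrite opprD addrACA scalerA.
pose fL := HB.pack_for {linear h -> h} f (GRing.isLinear.Build _ _ _ _ f f_lin).
by rewrite (lfunE fL).
Qed.

Inductive weyl : 'End(h) -> Prop :=
| weyl_1 : weyl \1%VF
| weyl_refl i : weyl (srefl i)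
| weyl_M w w' : weyl w -> weyl w' -> weyl (w \o w')%VF
| weyl_V w : weyl w -> weyl w^-1%VF.

(* contragredient action: (w lam)(x) = lam (w^-1 x) *)
Definition weyl_act (w : 'End(h)) (lam : 'Hom(h, rat^o)) : 'Hom(h, rat^o) :=
  (lam \o w^-1)%VF.

End Weyl.

Record datum := Datum {
  idx : finType;
  cspace : vectType rat;
  alphav : idx -> cspace;
  alpha : idx -> 'Hom(cspace, rat^o);
  cartan : idx -> idx -> int;
  (* The form lives on the span of the alpha i: its other values are junk. *)
  bform : 'Hom(cspace, rat^o) -> 'Hom(cspace, rat^o) -> rat;
  hlen : idx -> nat;
  lattice : zmodClosed cspace;
  alphav_free : free [seq alphav i | i : idx];
  alpha_free : free [seq alpha i | i : idx];
  cartanE : forall i j, alpha j (alphav i) = (cartan i j)%:~R;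
  cartanP : gen_cartan cartan;
  cartan_sym : symmetrizable cartan;
  formPl : forall c lam mu nu,
    lam \in <<[seq alpha i | i : idx]>>%VS ->
    mu \in <<[seq alpha i | i : idx]>>%VS ->
    nu \in <<[seq alpha i | i : idx]>>%VS ->
    bform (c *: lam + mu) nu = c * bform lam nu + bform mu nu;
  formC : forall lam mu,
    lam \in <<[seq alpha i | i : idx]>>%VS ->
    mu \in <<[seq alpha i | i : idx]>>%VS ->
    bform lam mu = bform mu lam;
  formW : forall w lam mu, weyl alphav alpha w ->
    lam \in <<[seq alpha i | i : idx]>>%VS ->
    mu \in <<[seq alpha i | i : idx]>>%VS ->
    bform (weyl_act w lam) (weyl_act w mu) = bform lam mu;
  hlenE : forall i, bform (alpha i) (alpha i) / 2 = (hlen i)%:R;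
  hlen_gt0 : forall i, (0 < hlen i)%N;
  lattice_Zform : exists b : (\dim {:cspace}).-tuple cspace,
    basis_of fullv b /\ forall x, x \in lattice <-> inIntSpan b x;
  alpha_int : forall i x, x \in lattice -> (alpha i x : rat) \is a Num.int;
  alphav_lattice : forall i, alphav i *+ hlen i \in lattice
}.

Definition lat (D : datum) := {x : cspace D | x \in lattice D}.
HB.instance Definition _ D := SubChoice.on (lat D).
HB.instance Definition _ D := [SubChoice_isSubZmodule of lat D by <:].

Definition qint (K : fieldType) (x : K) (n : nat) : K :=
  (x ^+ n - x ^- n) / (x - x^-1).
Definition qfact (K : fieldType) (x : K) (n : nat) : K :=
  \prod_(m < n) qint x m.+1.
Definition divpow (K : fieldType) (A : lalgType K) (x : K) (r : nat) (a : A) :=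
  (qfact x r)^-1 *: a ^+ r.

Lemma malg_scaleAr (M : monomType) (R : comNzRingType) (c : R)
  (x y : {malg R[M]}) : c *: (x * y) = x * (c *: y).
Proof.
have cC : x * malgC c = malgC c * x.
  rewrite !malgM_def fgmulUg fgmulgU; apply: eq_bigr => m _.
  by rewrite mul1m mulm1 mulrC.
by rewrite -!mul_malgC !mulrA cC.
Qed.

(* The field K and the parameter q are specialized to Q(q) at the end. *)
Section QuantizedEnvelopingAlgebra.
Variables (K : fieldType) (q : K).
Variable D : datum.
Implicit Types (i j : idx D) (u v : lat D).

Definition t_ i : lat D := Sub (alphav i *+ hlen i) (alphav_lattice i).
Definition q_ i : K := q ^+ hlen i.
(* - <alpha_j, h_i> when i != j *)
Definition mcartan i j : nat := `|cartan i j|%N.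

Definition gen := (lat D + (idx D + idx D))%type.
Definition free_alg := {malg K[{fmonom gen}]}.
HB.instance Definition _ := GRing.Lalgebra.on free_alg.

HB.instance Definition _ :=
  GRing.Lalgebra_isAlgebra.Build K free_alg
    (@malg_scaleAr {fmonom gen} K).

Definition gk u : free_alg := << fmu (inl u) >>.
Definition ge i : free_alg := << fmu (inr (inl i)) >>.
Definition gf i : free_alg := << fmu (inr (inr i)) >>.

Definition serre i j (x y : free_alg) : free_alg :=
  \sum_(r < (mcartan i j).+2)
    (-1) ^+ r *:
    (divpow (q_ i) r x * y * divpow (q_ i) ((mcartan i j).+1 - r) x).

Inductive qea_rel : free_alg -> Prop :=
| rel_k0 : qea_rel (gk 0 - 1)
| rel_kM u v : qea_rel (gk u * gk v - gk (u + v))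
| rel_ke i u (n : int) : alpha i (val u) = n%:~R ->
    qea_rel (gk u * ge i * gk (- u) - q ^ n *: ge i)
| rel_kf i u (n : int) : alpha i (val u) = n%:~R ->
    qea_rel (gk u * gf i * gk (- u) - q ^ (- n) *: gf i)
| rel_ef i j :
    qea_rel (ge i * gf j - gf j * ge i
      - ((i == j)%:R / (q_ i - (q_ i)^-1)) *: (gk (t_ i) - gk (- t_ i)))
| rel_e i j : i != j -> qea_rel (serre i j (ge i) (ge j))
| rel_f i j : i != j -> qea_rel (serre i j (gf i) (gf j)).

Inductive qea_ideal : free_alg -> Prop :=
| ideal_rel x : qea_rel x -> qea_ideal x
| ideal_0 : qea_ideal 0
| ideal_B x y : qea_ideal x -> qea_ideal y -> qea_ideal (x - y)
| ideal_M a x b : qea_ideal x -> qea_ideal (a * x * b).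

(* An algType must be nonzero: the counit shows that the ideal is proper. *)
Definition is_k (g : gen) : bool := if g is inl _ then true else false.
Definition counit_mon (m : {fmonom gen}) : K := (all is_k m)%:R.

Lemma counit_mon_mmorphism : mmorphism counit_mon.
Proof.
split=> [x y|]; rewrite /counit_mon; last by rewrite fm1.
by rewrite fmM all_cat -natrM mulnb.
Qed.
HB.instance Definition _ :=
  monalg.isMultiplicative.Build {fmonom gen} K counit_mon counit_mon_mmorphism.

Definition free_counit : {rmorphism free_alg -> K} := mmap idfun counit_mon.

Lemma free_counitZ c x : free_counit (c *: x) = c * free_counit x.
Proof. exact: mmapZ. Qed.
Lemma counit_k u : free_counit (gk u) = 1.
Proof. by rewrite [LHS]mmapU /= mul1r /counit_mon fmuE. Qed.
Lemma counit_e i : free_counit (ge i) = 0.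
Proof. by rewrite [LHS]mmapU /= mul1r /counit_mon fmuE. Qed.
Lemma counit_f i : free_counit (gf i) = 0.
Proof. by rewrite [LHS]mmapU /= mul1r /counit_mon fmuE. Qed.

Lemma free_counit_rel (A : lalgType K) (eps : {rmorphism A -> K}) :
  (forall c x, eps (c *: x) = c * eps x) ->
  [/\ forall x, eps x = 1 -> eps (x - 1) = 0,
      forall x y z, eps x = 1 -> eps y = 1 -> eps z = 1 ->
        eps (x * y - z) = 0,
      forall c x y z, eps y = 0 -> eps (x * y * z - c *: y) = 0,
      forall c x y z t, eps x = 0 -> eps y = 0 -> eps z = 1 -> eps t = 1 ->
        eps (x * y - y * x - c *: (z - t)) = 0
    & forall n (c : 'I_n -> K) (x z : 'I_n -> A) y, eps y = 0 ->
        eps (\sum_(r < n) c r *: (x r * y * z r)) = 0].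
Proof.
move=> eZ; split=> [x x1|x y z x1 y1 z1|c x y z y0|c x y z t x0 y0 z1 t1|
  n c x z y y0].
- by rewrite rmorphB rmorph1 x1 subrr.
- by rewrite rmorphB rmorphM x1 y1 z1 mulr1 subrr.
- by rewrite rmorphB !rmorphM eZ y0 !(mulr0, mul0r) subrr.
- by rewrite !rmorphB !rmorphM eZ rmorphB x0 y0 z1 t1 !(mulr0, mul0r, subrr).
- rewrite rmorph_sum big1 // => r _.
  by rewrite eZ !rmorphM y0 mulr0 mul0r mulr0.
Qed.

Lemma free_counit_ideal x : qea_ideal x -> free_counit x = 0.
Proof.
have [e1 eM eK eEF eS] := free_counit_rel free_counitZ.
elim=> {x} [x|| x y _ ex _ ey|a x b _ ex].
- case=> [|u v|i u n _|i u n _|i j|i j _|i j _].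
  + exact: e1 (counit_k _).
  + exact: eM (counit_k _) (counit_k _) (counit_k _).
  + exact: eK (counit_e _).
  + exact: eK (counit_f _).
  + exact: eEF (counit_e _) (counit_f _) (counit_k _) (counit_k _).
  + exact: eS (counit_e _).
  + exact: eS (counit_f _).
- exact: rmorph0.
- by rewrite rmorphB ex ey subrr.
- by rewrite !rmorphM ex mulr0 mul0r.
Qed.

Definition idealb : free_alg -> bool := fun x => `[< qea_ideal x >].
Lemma idealb_zmod : zmod_closed idealb.
Proof.
split=> [|x y /asboolP xI /asboolP yI]; apply/asboolP; first exact: ideal_0.
exact: ideal_B.
Qed.
HB.instance Definition _ :=
  GRing.isZmodClosed.Build free_alg idealb idealb_zmod.

Definition ideal_zmod : zmodClosed free_alg :=
  GRing.ZmodClosed.clone _ idealb _.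

Definition Uq := Quotient.quot ideal_zmod.
HB.instance Definition _ := GRing.Zmodule.on Uq.
HB.instance Definition _ : EqQuotient _ (Quotient.equiv ideal_zmod) Uq :=
  EqQuotient.on Uq.

Lemma UqP (x y : free_alg) : qea_ideal (x - y) <-> \pi_Uq x = \pi_Uq y.
Proof.
have := Quotient.idealrBE ideal_zmod x y; rewrite unfold_in => E.
by split=> [/asboolP|/eqP]; [rewrite E => /eqP | rewrite -E => /asboolP].
Qed.

Definition umul := lift_op2 Uq (@GRing.mul free_alg).
Definition uscale (c : K) := lift_op1 Uq (fun x : free_alg => c *: x).

Lemma umulE (x y : free_alg) : umul (\pi_Uq x) (\pi_Uq y) = \pi_Uq (x * y).
Proof.
unlock umul; apply/UqP; set x' := repr _; set y' := repr _.
have xI : qea_ideal (x' - x) by apply/UqP; rewrite reprK.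
have yI : qea_ideal (y - y') by apply/UqP; rewrite reprK.
have -> : x' * y' - x * y = 1 * (x' - x) * y' - x * (y - y') * 1.
  by rewrite mul1r mulr1 mulrBl mulrBr opprB addrA subrK.
by apply: ideal_B; apply: ideal_M.
Qed.

Lemma uscaleE c (x : free_alg) : uscale c (\pi_Uq x) = \pi_Uq (c *: x).
Proof.
unlock uscale; apply/UqP; have xI : qea_ideal (repr (\pi_Uq x) - x).
  by apply/UqP; rewrite reprK.
rewrite -scalerBr -[_ - x]mul1r -[_ * _]mulr1 scalerAl scalerAl.
exact: ideal_M.
Qed.

Lemma uaddE (x y : free_alg) : \pi_Uq x + \pi_Uq y = \pi_Uq (x + y).
Proof. by rewrite !piE. Qed.

Lemma umulA : associative umul.
Proof.
by elim/quotW=> x; elim/quotW=> y; elim/quotW=> z; rewrite !umulE mulrA.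
Qed.
Lemma umul1 : left_id (\pi_Uq 1) umul.
Proof. by elim/quotW=> x; rewrite umulE mul1r. Qed.
Lemma umulr1 : right_id (\pi_Uq 1) umul.
Proof. by elim/quotW=> x; rewrite umulE mulr1. Qed.
Lemma umulDl : left_distributive umul +%R.
Proof.
elim/quotW=> x; elim/quotW=> y; elim/quotW=> z.
by rewrite uaddE !umulE uaddE mulrDl.
Qed.
Lemma umulDr : right_distributive umul +%R.
Proof.
elim/quotW=> x; elim/quotW=> y; elim/quotW=> z.
by rewrite uaddE !umulE uaddE mulrDr.
Qed.
Lemma uone_neq0 : \pi_Uq 1 != 0.
Proof.
apply/eqP; have -> : 0 = \pi_Uq (0 : free_alg) by rewrite piE.
move=> /UqP; rewrite subr0 => /free_counit_ideal/eqP.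
by rewrite rmorph1 oner_eq0.
Qed.

HB.instance Definition _ := GRing.Zmodule_isNzRing.Build Uq
  umulA umul1 umulr1 umulDl umulDr uone_neq0.

Lemma uscaleA c d x : uscale c (uscale d x) = uscale (c * d) x.
Proof. by elim/quotW: x => x; rewrite !uscaleE scalerA. Qed.
Lemma uscale1 : left_id 1 uscale.
Proof. by elim/quotW=> x; rewrite uscaleE scale1r. Qed.
Lemma uscaleDr : right_distributive uscale +%R.
Proof.
move=> c; elim/quotW=> x; elim/quotW=> y.
by rewrite uaddE !uscaleE uaddE scalerDr.
Qed.
Lemma uscaleDl x : {morph uscale^~ x : c d / c + d}.
Proof. by elim/quotW: x => x c d; rewrite !uscaleE uaddE scalerDl. Qed.

HB.instance Definition _ :=
  GRing.Zmodule_isLmodule.Build K Uq uscaleA uscale1 uscaleDr uscaleDl.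

Lemma uscaleAl c (x y : Uq) : c *: (x * y) = c *: x * y.
Proof.
elim/quotW: x => x; elim/quotW: y => y.
by rewrite [_ * _]umulE [LHS]uscaleE [c *: _]uscaleE [RHS]umulE scalerAl.
Qed.
HB.instance Definition _ := GRing.Lmodule_isLalgebra.Build K Uq uscaleAl.

Lemma uscaleAr c (x y : Uq) : c *: (x * y) = x * (c *: y).
Proof.
elim/quotW: x => x; elim/quotW: y => y.
by rewrite [_ * _]umulE [LHS]uscaleE [c *: _]uscaleE [RHS]umulE scalerAr.
Qed.
HB.instance Definition _ := GRing.Lalgebra_isAlgebra.Build K Uq uscaleAr.

Definition k_ u : Uq := \pi_Uq (gk u).
Definition e_ i : Uq := \pi_Uq (ge i).
Definition f_ i : Uq := \pi_Uq (gf i).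

(* An element sum_i n_i alpha_i of Q is given by its coefficients n. *)
Definition alphaQ (n : idx D -> int) : 'Hom(cspace D, rat^o) :=
  \sum_i alpha i *~ n i.
Definition tQ (n : idx D -> int) : lat D := \sum_i t_ i *~ n i.
Definition kQ (n : idx D -> int) : Uq := k_ (tQ n).

Definition Uplus : set Uq := subalg (range e_).
Definition Uminus : set Uq := subalg (range f_).
Definition tU0 : set Uq := lspan (range kQ).
Definition tUge0 : set Uq := mulspace tU0 Uplus.
Definition tUle0 : set Uq := mulspace tU0 Uminus.

Record is_coproduct (Delta : {rmorphism Uq -> tensor Uq Uq}) : Prop := {
  coprodZ : scalable Delta;
  coprod_k : forall u, Delta (k_ u) = k_ u *t k_ u;
  coprod_e : forall i, Delta (e_ i) = e_ i *t 1 + k_ (t_ i) *t e_ i;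
  coprod_f : forall i, Delta (f_ i) = f_ i *t k_ (- t_ i) + 1 *t f_ i
}.

(* [tau] is only meaningful on tUge0 x tUle0. The form tau (x) tau is evaluated
   on Delta x through any expression of Delta x as an element of
   tUge0 (x) tUge0, and likewise for Delta y. *)
Record is_drinfeld_pairing
    (Delta : Uq -> tensor Uq Uq) (tau : Uq -> Uq -> K) : Prop := {
  tauPl : forall c x x' y, tUge0 x -> tUge0 x' -> tUle0 y ->
    tau (c *: x + x') y = c * tau x y + tau x' y;
  tauPr : forall c x y y', tUge0 x -> tUle0 y -> tUle0 y' ->
    tau x (c *: y + y') = c * tau x y + tau x y';
  tau_mulr : forall x y1 y2 (s : seq (Uq * Uq)),
    tUge0 x -> tUle0 y1 -> tUle0 y2 ->
    (forall p, p \in s -> tUge0 p.1 /\ tUge0 p.2) ->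
    Delta x = \sum_(p <- s) p.1 *t p.2 ->
    tau x (y1 * y2) = \sum_(p <- s) tau p.1 y1 * tau p.2 y2;
  tau_mull : forall x1 x2 y (s : seq (Uq * Uq)),
    tUge0 x1 -> tUge0 x2 -> tUle0 y ->
    (forall p, p \in s -> tUle0 p.1 /\ tUle0 p.2) ->
    Delta y = \sum_(p <- s) p.1 *t p.2 ->
    tau (x1 * x2) y = \sum_(p <- s) tau x2 p.1 * tau x1 p.2;
  tau_kk : forall (m n : idx D -> int) (z : int),
    bform (alphaQ m) (alphaQ n) = z%:~R -> tau (kQ m) (kQ n) = q ^ (- z);
  tau_ef : forall i j, tau (e_ i) (f_ j) = - ((i == j)%:R / (q_ i - (q_ i)^-1));
  tau_ek : forall i n, tau (e_ i) (kQ n) = 0;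
  tau_kf : forall i n, tau (kQ n) (f_ i) = 0
}.

Record is_braid_op (i : idx D) (T : Uq -> Uq) : Prop := {
  (* s_i x must lie in h_Z for k_(s_i x) to make sense *)
  braid_k : forall u v, val v = srefl (@alphav D) (@alpha D) i (val u) ->
    T (k_ u) = k_ v;
  braid_ei : T (e_ i) = - (f_ i * k_ (t_ i));
  braid_fi : T (f_ i) = - (k_ (- t_ i) * e_ i);
  braid_ej : forall j, j != i ->
    T (e_ j) = \sum_(r < (mcartan i j).+1)
      ((-1) ^+ r * q_ i ^- r) *:
      (divpow (q_ i) (mcartan i j - r) (e_ i) * e_ j * divpow (q_ i) r (e_ i));
  braid_fj : forall j, j != i ->
    T (f_ j) = \sum_(r < (mcartan i j).+1)
      ((-1) ^+ r * q_ i ^+ r) *: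
      (divpow (q_ i) r (f_ i) * f_ j * divpow (q_ i) (mcartan i j - r) (f_ i))
}.

End QuantizedEnvelopingAlgebra.

Arguments Uplus {K} q D _.
Arguments Uminus {K} q D _.

Definition Qq : fieldType := {fraction {poly rat}}.
Definition q : Qq := tofrac 'X.

(* Main.v *)
(* Modulo the radical of tau, U^+ and U^- are spaces of functions on words:
   x in U^+ goes to w |-> tau(x, f_w). Left and right multiplication by e_j become
   quantum shuffle operators, and the skew derivations dual to multiplication by f_j
   remove the first or the last letter. Together with weight operators they make the
   image of U^+ a right U-module on which f_j acts by a combination of the two
   removals.

   Fix i, and let B be the smallest subspace of U^+ containing 1 and stable under
   y |-> y e_j (j <> i) and y |-> y e_i - e_i (k_i y k_i^-1). Then U^+ is the sum of
   the e_i^n B, and T(B) lies in U^+. The first letter of the function of an element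
   of B is never i, nor is the last letter of the function of an element of T(B).
   If x = sum_n e_i^n b_n and T(x) are both in U^+, acting by T(x) on the vectors
   e_i^m of the module, which T(e_i) lowers, shows that T(x) = T(b_0) and T(b_n) = 0
   for n > 0, modulo the radical. The same holds for U^-, so everything reduces to
   tau(T(b), T(c)) = tau(b, c) for b in B and c in its analogue in U^-, which is an
   induction over the generation of b: the derivations dual to right multiplication
   by e_j and to y |-> y e_i - e_i (k_i y k_i^-1) preserve that analogue, and T
   intertwines them with those dual to its images of these two operations. *)

Require Import Defs.
From HB Require Import structures.
From mathcomp Require Import all_boot all_order all_algebra.
From mathcomp.classical Require Import boolp classical_sets functions.
From mathcomp.multinomials Require Import monalg.
From mathcomp Require Import ring zify.

Set Implicit Arguments.
Unset Strict Implicit.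
Unset Printing Implicit Defensive.

Import GRing.Theory.

Local Open Scope ring_scope.

(** The map T does not preserve U^+: since T(e_i) = -f_i k_i, the summands T(e_i)^n T(b_n) of T(x)
    leave the domain of tau, so T(x) cannot be studied through the word functions of its summands.
    The action of U on functions gives each summand a meaning. In it the torus acts on the function
    supported at the empty word by q^(-alpha_i) rather than trivially: with this shift f_i sends the
    function of e_i^(m+1) to -[m+1][m+2] times that of e_i^m, which is nonzero for every m, whereas
    the trivial character would give -[m][m+1] and lose m = 0. The resulting system for the T(b_n)
    is triangular.

    U^+ and U^- obey the same relations after exchanging e with f and inverting k, so one argument
    serves both. Only T breaks the symmetry, through scalars [zeta]: they are 1 on U^+, while on U^-
    they are q_i^-2 at i and (-1)^n q_i^n at j, where n = -<alpha_j, h_i>. The latter turns the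
    constants that appear when T(e_j) is paired with T(f_j) into [n]!^2, which cancels the two
    factors 1/[n]! in their definitions. *)

(** * Linear identities in a module, by reflection *)

Section LinearExpressions.
Variables (K : comNzRingType) (V : lmodType K).

Inductive lexp :=
| LAtom of nat | LAdd of lexp & lexp | LOpp of lexp | LScale of K & lexp | LZero.

Fixpoint leval (env : seq V) (x : lexp) : V :=
  match x with
  | LAtom n => nth 0 env n
  | LAdd x y => leval env x + leval env y
  | LOpp x => - leval env x
  | LScale c x => c *: leval env x
  | LZero => 0
  end.

(** [Nat.eqb] replaces the generic [==] so that [cbn] evaluates the comparison of atoms, leaving
    only identities in [K] for [ring]. *)
Fixpoint lcoef (n : nat) (x : lexp) : K :=
  match x with
  | LAtom m => if Nat.eqb m n then 1 else 0
  | LAdd x y => lcoef n x + lcoef n y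
  | LOpp x => - lcoef n x
  | LScale c x => c * lcoef n x
  | LZero => 0
  end.

Lemma leval_coef env x :
  leval env x = \sum_(n < size env) lcoef n x *: nth 0 env n.
Proof.
elim: x => [m|x ihx y ihy|x ih|c x ih|] /=.
- have [lt_m|le_m] := ltnP m (size env).
    rewrite (bigD1 (Ordinal lt_m)) //= PeanoNat.Nat.eqb_refl scale1r big1 ?addr0 // => n.
    rewrite -val_eqE /= => nm; case: PeanoNat.Nat.eqb_spec => [E|_].
      by rewrite -E eqxx in nm.
    by rewrite scale0r.
  rewrite nth_default // big1 // => n _; case: PeanoNat.Nat.eqb_spec => [E|_].
    by have := ltn_ord n; rewrite -E ltnNge le_m.
  by rewrite scale0r.
- by rewrite ihx ihy -big_split; apply: eq_bigr => n _; rewrite scalerDl.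
- by rewrite ih -sumrN; apply: eq_bigr => n _; rewrite scaleNr.
- by rewrite ih scaler_sumr; apply: eq_bigr => n _; rewrite scalerA.
- by rewrite big1 // => n _; rewrite scale0r.
Qed.

Fixpoint lcoefs_eq (n : nat) (x y : lexp) : Prop :=
  if n is n'.+1 then lcoef n' x = lcoef n' y /\ lcoefs_eq n' x y else True.

Lemma leval_eq env x y : lcoefs_eq (size env) x y -> leval env x = leval env y.
Proof.
move=> xy; rewrite !leval_coef; apply: eq_bigr => -[n /= lt_n] _.
suff -> : lcoef n x = lcoef n y by [].
elim: (size env) lt_n xy => // m ih; rewrite ltnS leq_eqVlt => /predU1P[->|lt_n] [//].
by move=> _ /(ih lt_n).
Qed.

End LinearExpressions.

(** Atoms are compared up to unification, so that two elaborations of the same vector share one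
    index. *)
Ltac lmem x l :=
  match l with
  | nil => constr:(false)
  | cons ?y _ => let _ := match goal with _ => unify x y end in constr:(true)
  | cons _ ?l' => lmem x l'
  end.
Ltac lindex x l :=
  match l with
  | cons ?y _ => let _ := match goal with _ => unify x y end in constr:(O)
  | cons _ ?l' => let n := lindex x l' in constr:(S n)
  end.
Ltac latoms t l :=
  lazymatch t with
  | (?a + ?b)%R => let l := latoms a l in latoms b l
  | (- ?a)%R => latoms a l
  | (_ *: ?a)%R => latoms a l
  | (0)%R => l
  | _ => let m := lmem t l in
         match m with true => l | false => constr:(cons t l) end
  end.
Ltac lreify K t l :=
  lazymatch t with
  | (?a + ?b)%R => let x := lreify K a l in let y := lreify K b l in
                   constr:(@LAdd K x y)
  | (- ?a)%R => let x := lreify K a l in constr:(@LOpp K x)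
  | (?c *: ?a)%R => let x := lreify K a l in constr:(@LScale K c x)
  | (0)%R => constr:(@LZero K)
  | _ => let n := lindex t l in constr:(@LAtom K n)
  end.
Ltac lmod_pre K :=
  lazymatch goal with
  | |- @eq ?V ?x ?y =>
    let l := latoms x (@nil V) in
    let l := latoms y l in
    let a := lreify K x l in
    let b := lreify K y l in
    refine (@leval_eq K _ l a b _); cbn [lcoefs_eq size lcoef Nat.eqb]
  end.
Ltac lmod K := lmod_pre K; repeat split; try ring.

(** * Shuffle operators on functions of words *)

Section RightEndomorphisms.
Variables (K : fieldType) (I : Type).
Local Notation V := (seq I -> K^o).

(** Linearity is stored as a boolean, whose proofs are irrelevant; two elements with the same
    underlying function are therefore equal. *)
Record rend := Rend { rend_fun : V -> V; rend_linP : `[< linear rend_fun >] }.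

HB.instance Definition _ := [isSub for rend_fun].
HB.instance Definition _ := gen_eqMixin rend.
HB.instance Definition _ := gen_choiceMixin rend.

Implicit Types (f g h : rend) (v : V).

Lemma rend_lin f : linear (rend_fun f).
Proof. exact/asboolP/(rend_linP f). Qed.

Lemma rend_ext f g : (forall v, rend_fun f v = rend_fun g v) -> f = g.
Proof. by move=> fg; apply/val_inj/funext. Qed.

Lemma rend_funD f v w : rend_fun f (v + w) = rend_fun f v + rend_fun f w.
Proof. by have := rend_lin f 1 v w; rewrite !scale1r. Qed.

Lemma rend_fun0 f : rend_fun f 0 = 0.
Proof. by apply: (addrI (rend_fun f 0)); rewrite -rend_funD !addr0. Qed.

Lemma rend_funZ f c v : rend_fun f (c *: v) = c *: rend_fun f v.
Proof. by have := rend_lin f c v 0; rewrite rend_fun0 !addr0. Qed.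

Lemma rend_zero_lin : `[< linear ((fun=> 0) : V -> V) >].
Proof. by apply/asboolP => c u v; rewrite scaler0 addr0. Qed.
Lemma rend_add_lin f g : `[< linear (fun v => rend_fun f v + rend_fun g v) >].
Proof. by apply/asboolP => c u v; rewrite !rend_lin scalerDr addrACA. Qed.
Lemma rend_scale_lin (c : K) f : `[< linear (fun v => c *: rend_fun f v) >].
Proof.
apply/asboolP => d u v.
by rewrite rend_lin scalerDr [in LHS]scalerA [in RHS]scalerA mulrC.
Qed.
Lemma rend_mul_lin f g : `[< linear (fun v => rend_fun g (rend_fun f v)) >].
Proof. by apply/asboolP => c u v; rewrite !rend_lin. Qed.
Lemma rend_one_lin : `[< linear (fun v => v) >].
Proof. exact/asboolP. Qed.

Definition rend_zero := Rend rend_zero_lin.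
Definition rend_add f g := Rend (rend_add_lin f g).
Definition rend_scale c f := Rend (rend_scale_lin c f).
(* Diagrammatic order: V becomes a right module. *)
Definition rend_mul f g := Rend (rend_mul_lin f g).
Definition rend_one := Rend rend_one_lin.

Lemma rend_addA : associative rend_add.
Proof. by move=> f g h; apply: rend_ext => v /=; rewrite addrA. Qed.
Lemma rend_addC : commutative rend_add.
Proof. by move=> f g; apply: rend_ext => v /=; rewrite addrC. Qed.
Lemma rend_add0 : left_id rend_zero rend_add.
Proof. by move=> f; apply: rend_ext => v /=; rewrite add0r. Qed.
Lemma rend_addN : left_inverse rend_zero (rend_scale (-1)) rend_add.
Proof. by move=> f; apply: rend_ext => v /=; rewrite scaleN1r addNr. Qed.

HB.instance Definition _ :=
  GRing.isZmodule.Build rend rend_addA rend_addC rend_add0 rend_addN.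

Lemma rend_mulA : associative rend_mul.
Proof. by move=> f g h; apply: rend_ext. Qed.
Lemma rend_mul1 : left_id rend_one rend_mul.
Proof. by move=> f; apply: rend_ext. Qed.
Lemma rend_mulr1 : right_id rend_one rend_mul.
Proof. by move=> f; apply: rend_ext. Qed.
Lemma rend_mulDl : left_distributive rend_mul +%R.
Proof. by move=> f g h; apply: rend_ext => v /=; rewrite rend_funD. Qed.
Lemma rend_mulDr : right_distributive rend_mul +%R.
Proof. by move=> f g h; apply: rend_ext. Qed.
Lemma rend_one_neq0 : rend_one != 0.
Proof.
apply/eqP => /(congr1 (fun f => rend_fun f (fun=> 1) [::])) /= /eqP.
by rewrite oner_eq0.
Qed.

HB.instance Definition _ := GRing.Zmodule_isNzRing.Build rend
  rend_mulA rend_mul1 rend_mulr1 rend_mulDl rend_mulDr rend_one_neq0.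

Lemma rend_scaleA c d f : rend_scale c (rend_scale d f) = rend_scale (c * d) f.
Proof. by apply: rend_ext => v /=; rewrite scalerA. Qed.
Lemma rend_scale1 : left_id 1 rend_scale.
Proof. by move=> f; apply: rend_ext => v /=; rewrite scale1r. Qed.
Lemma rend_scaleDr : right_distributive rend_scale +%R.
Proof. by move=> c f g; apply: rend_ext => v /=; rewrite scalerDr. Qed.
Lemma rend_scaleDl f : {morph rend_scale^~ f : c d / c + d}.
Proof. by move=> c d; apply: rend_ext => v /=; rewrite scalerDl. Qed.

HB.instance Definition _ := GRing.Zmodule_isLmodule.Build K rend
  rend_scaleA rend_scale1 rend_scaleDr rend_scaleDl.

Lemma rend_scaleAl (c : K) f g : c *: (f * g) = c *: f * g.
Proof. by apply: rend_ext => v /=; rewrite rend_funZ. Qed.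
HB.instance Definition _ := GRing.Lmodule_isLalgebra.Build K rend rend_scaleAl.
Lemma rend_scaleAr (c : K) f g : c *: (f * g) = f * (c *: g).
Proof. exact: rend_ext. Qed.
HB.instance Definition _ := GRing.Lalgebra_isAlgebra.Build K rend rend_scaleAr.

End RightEndomorphisms.

Section Shuffle.
Variables (K : fieldType) (I : finType).
Variables (b t : I -> I -> K).
Local Notation V := (seq I -> K^o).
Implicit Types (v : V) (w : seq I) (g : I -> K).

Definition Lop j v : V := fun w => v (j :: w).
Definition Rop j v : V := fun w => v (rcons w j).
Definition Kop g v : V := fun w => (\prod_(l <- w) g l) * v w.
Definition Vop v : V := fun w => v (rev w).
(** Quantum shuffle product of the letter [j] with [v]: one letter [l] is deleted from [w] with
    weight [t j l], and each letter [m] standing before it contributes [b j m]. *)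
Fixpoint shuffle_letter j w v : K :=
  if w is l :: w' then b j l * shuffle_letter j w' (Lop l v) + t j l * v w'
  else 0.
Definition Xop j v : V := fun w => shuffle_letter j w v.
(** Shuffling from the other end is defined by reversal of words, which transfers the rules for
    [Lop] and [Rop] from [Xop]. *)
Definition Xop' j v : V := Vop (Xop j (Vop v)).
Definition vac : V := fun w => (w == [::])%:R.

Arguments Lop : simpl never.
Arguments Rop : simpl never.
Arguments Kop : simpl never.
Arguments Vop : simpl never.
Arguments Xop : simpl never.
Arguments Xop' : simpl never.

Lemma word_ext (u v : V) :
  u [::] = v [::] -> (forall l, Lop l u = Lop l v) -> u = v.
Proof.
move=> uv0 uvL; apply/funext => -[//|l w].
by have := congr1 (fun z : V => z w) (uvL l).
Qed.

Lemma linE (c : K) (u v : V) w : (c *: u + v) w = c * u w + v w :> K.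
Proof. by []. Qed.
Lemma wZE (c : K) (v : V) w : (c *: v) w = c * v w :> K. Proof. by []. Qed.
Lemma wDE (u v : V) w : (u + v) w = u w + v w :> K. Proof. by []. Qed.

Lemma Lop_lin j : linear (Lop j). Proof. by []. Qed.
Lemma Rop_lin j : linear (Rop j). Proof. by []. Qed.
Lemma Vop_lin : linear Vop. Proof. by []. Qed.
Lemma Kop_lin g : linear (Kop g).
Proof.
move=> c u v; apply/funext => w; by rewrite [RHS]linE /Kop linE; ring.
Qed.
Lemma Xop_lin j : linear (Xop j).
Proof.
move=> c u v; apply/funext => w; rewrite linE /Xop.
elim: w u v => [|l w ih] u v /=; first by rewrite mulr0 addr0.
by rewrite Lop_lin ih linE; ring.
Qed.
Lemma Xop'_lin j : linear (Xop' j).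
Proof. by move=> c u v; rewrite /Xop' Vop_lin Xop_lin Vop_lin. Qed.

HB.instance Definition _ j := GRing.isLinear.Build K V V *:%R (Lop j) (Lop_lin j).
HB.instance Definition _ j := GRing.isLinear.Build K V V *:%R (Rop j) (Rop_lin j).
HB.instance Definition _ := GRing.isLinear.Build K V V *:%R Vop Vop_lin.
HB.instance Definition _ g := GRing.isLinear.Build K V V *:%R (Kop g) (Kop_lin g).
HB.instance Definition _ j := GRing.isLinear.Build K V V *:%R (Xop j) (Xop_lin j).
HB.instance Definition _ j :=
  GRing.isLinear.Build K V V *:%R (Xop' j) (Xop'_lin j).

Lemma LopD j u v : Lop j (u + v) = Lop j u + Lop j v.
Proof. exact: linearD. Qed.
Lemma LopN j v : Lop j (- v) = - Lop j v.
Proof. exact: linearN. Qed.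
Lemma LopZ j c v : Lop j (c *: v) = c *: Lop j v.
Proof. exact: linearZ. Qed.
Lemma RopD j u v : Rop j (u + v) = Rop j u + Rop j v.
Proof. exact: linearD. Qed.
Lemma RopN j v : Rop j (- v) = - Rop j v.
Proof. exact: linearN. Qed.
Lemma RopZ j c v : Rop j (c *: v) = c *: Rop j v.
Proof. exact: linearZ. Qed.
Lemma KopD g u v : Kop g (u + v) = Kop g u + Kop g v.
Proof. exact: linearD. Qed.
Lemma KopN g v : Kop g (- v) = - Kop g v.
Proof. exact: linearN. Qed.
Lemma KopZ g c v : Kop g (c *: v) = c *: Kop g v.
Proof. exact: linearZ. Qed.
Lemma XopD j u v : Xop j (u + v) = Xop j u + Xop j v.
Proof. exact: linearD. Qed.
Lemma XopN j v : Xop j (- v) = - Xop j v.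
Proof. exact: linearN. Qed.
Lemma XopZ j c v : Xop j (c *: v) = c *: Xop j v.
Proof. exact: linearZ. Qed.
Lemma Xop'D j u v : Xop' j (u + v) = Xop' j u + Xop' j v.
Proof. exact: linearD. Qed.
Lemma Xop'N j v : Xop' j (- v) = - Xop' j v.
Proof. exact: linearN. Qed.
Lemma Xop'Z j c v : Xop' j (c *: v) = c *: Xop' j v.
Proof. exact: linearZ. Qed.
Definition opLR := (LopD, LopN, LopZ, RopD, RopN, RopZ).
Definition opE := (KopD, KopN, KopZ, XopD, XopN, XopZ, Xop'D, Xop'N, Xop'Z).

Lemma VopK : involutive Vop.
Proof. by move=> v; apply/funext => w; rewrite /Vop revK. Qed.
Lemma Lop_Vop j v : Lop j (Vop v) = Vop (Rop j v).
Proof. by apply/funext => w; rewrite /Lop /Vop /Rop rev_cons. Qed.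
Lemma Rop_Vop j v : Rop j (Vop v) = Vop (Lop j v).
Proof. by apply/funext => w; rewrite /Lop /Vop /Rop rev_rcons. Qed.
Lemma Kop_Vop g v : Kop g (Vop v) = Vop (Kop g v).
Proof.
apply/funext => w; rewrite /Kop /Vop; congr (_ * _).
by apply: perm_big; rewrite perm_sym perm_rev.
Qed.

Lemma Lop_Rop j l v : Lop j (Rop l v) = Rop l (Lop j v).
Proof. by []. Qed.
Lemma Lop_Kop j g v : Lop j (Kop g v) = g j *: Kop g (Lop j v).
Proof.
apply/funext => w; rewrite /Lop /Kop big_cons -[RHS]/(_ * (_ * _)).
by rewrite mulrA.
Qed.
Lemma Rop_Kop j g v : Rop j (Kop g v) = g j *: Kop g (Rop j v).
Proof.
apply: (can_inj VopK).
by rewrite -Lop_Vop -Kop_Vop Lop_Kop -[Vop (_ *: _)]/(_ *: Vop _) -Kop_Vop Lop_Vop.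
Qed.
Lemma Kop_Kop g h v : Kop g (Kop h v) = Kop (fun l => g l * h l) v.
Proof. by apply/funext => w; rewrite /Kop big_split mulrA. Qed.
Lemma Kop_one g v : g =1 (fun=> 1) -> Kop g v = v.
Proof.
by move=> g1; apply/funext => w; rewrite /Kop big1 ?mul1r // => l _; rewrite g1.
Qed.
Lemma Kop_vac g : Kop g vac = vac.
Proof.
apply/funext => -[|l w]; rewrite /Kop /vac ?mulr0 //.
by rewrite big_nil mul1r.
Qed.
Lemma Lop_vac j : Lop j vac = 0. Proof. by []. Qed.
Lemma Rop_vac j : Rop j vac = 0.
Proof. by apply/funext; case. Qed.

Lemma Lop_Xop l j v : Lop l (Xop j v) = b j l *: Xop j (Lop l v) + t j l *: v.
Proof. by []. Qed.
Hypothesis bC : forall j l, b j l = b l j.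
Hypothesis t_diag : forall j l, t j l != 0 -> j = l.

Lemma Kop_Xop g j v : Kop g (Xop j v) = g j *: Xop j (Kop g v).
Proof.
apply/funext => w; elim: w v => [|l w ih] v; first by rewrite wZE /Kop /= !mulr0.
rewrite -[LHS]/(Lop l (Kop g (Xop j v)) w) -[RHS]/(Lop l (g j *: Xop j (Kop g v)) w).
rewrite Lop_Kop Lop_Xop linearD !linearZ /= Lop_Xop Lop_Kop linearZ /=.
rewrite !(wDE, wZE) ih !(wDE, wZE).
have [->|/t_diag ->] := eqVneq (t j l) 0; ring.
Qed.

(** The second term is the case where the inserted letter ends up last: it has then passed every
    letter of the word, hence the twist [Kop (b j)]. *)
Lemma Rop_Xop l j v : Rop l (Xop j v) = Xop j (Rop l v) + t j l *: Kop (b j) v.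
Proof.
apply/funext => w; elim: w v => [|m w ih] v.
  rewrite wDE wZE /Rop /Kop /Xop /= mulr0 big_nil; ring.
rewrite -[LHS]/(Lop m (Rop l (Xop j v)) w).
rewrite -[RHS]/(Lop m (Xop j (Rop l v) + t j l *: Kop (b j) v) w).
rewrite Lop_Rop Lop_Xop !linearD !linearZ /= Lop_Xop Lop_Kop Lop_Rop.
rewrite !(wDE, wZE) ih !(wDE, wZE); ring.
Qed.

Lemma Lop_Xop' l j v :
  Lop l (Xop' j v) = Xop' j (Lop l v) + t j l *: Kop (b j) v.
Proof.
by rewrite /Xop' Lop_Vop Rop_Xop Rop_Vop linearD linearZ /= Kop_Vop VopK.
Qed.

Lemma Rop_Xop' l j v :
  Rop l (Xop' j v) = b j l *: Xop' j (Rop l v) + t j l *: v.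
Proof.
by rewrite /Xop' Rop_Vop Lop_Xop linearD !linearZ /= Lop_Vop VopK.
Qed.

Lemma Kop_Xop' g j v : Kop g (Xop' j v) = g j *: Xop' j (Kop g v).
Proof. by rewrite /Xop' Kop_Vop Kop_Xop linearZ /= Kop_Vop. Qed.

(** An instance of associativity of the shuffle product. In the induction on the word the correction
    terms match because [b] is symmetric and [t] diagonal. *)
Lemma Xop_Xop' j l v : Xop j (Xop' l v) = Xop' l (Xop j v).
Proof.
apply/funext => w; elim: w v => [|m w ih] v; first by [].
rewrite -[LHS]/(Lop m (Xop j (Xop' l v)) w).
rewrite -[RHS]/(Lop m (Xop' l (Xop j v)) w).
rewrite Lop_Xop Lop_Xop' [in RHS]Lop_Xop' Lop_Xop !linearD !linearZ /= Kop_Xop.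
rewrite !(wDE, wZE) ih (bC l j).
by have [->|/t_diag ->] := eqVneq (t l m) 0; ring.
Qed.

Lemma Xop_vac j : Xop j vac = Xop' j vac.
Proof.
apply: word_ext => // l.
by rewrite Lop_Xop Lop_Xop' Lop_vac !linear0 Kop_vac.
Qed.

End Shuffle.

(** * Commutation relations and root strings *)

Section QuantumIntegers.
Variables (K : fieldType) (x : K).
Hypotheses (x0 : x != 0) (xn1 : forall n, (0 < n)%N -> x ^+ n != 1).

Lemma qint_den_neq0 : x - x^-1 != 0.
Proof.
have := @xn1 2 isT; apply: contra_neq => /eqP; rewrite subr_eq0 => /eqP E.
by rewrite expr2 {2}E mulfV.
Qed.

Lemma qint_neq0 n : (0 < n)%N -> qint x n != 0.
Proof.
move=> n0; rewrite /qint mulf_neq0 ?invr_eq0 ?qint_den_neq0 //.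
have := @xn1 (n + n); rewrite addn_gt0 n0 => /(_ isT).
apply: contra_neq => /eqP; rewrite subr_eq0 => /eqP E.
by rewrite exprD {2}E mulfV // expf_neq0.
Qed.

Lemma qfact_neq0 n : qfact x n != 0.
Proof. by apply/prodf_neq0 => m _; apply: qint_neq0. Qed.

Lemma qfactS n : qfact x n.+1 = qfact x n * qint x n.+1.
Proof. by rewrite /qfact big_ord_recr. Qed.

Lemma qfact0 : qfact x 0 = 1.
Proof. by rewrite /qfact big_ord0. Qed.

Lemma qint0 : qint x 0 = 0.
Proof. by rewrite /qint expr0 invr1 subrr mul0r. Qed.

(** This is the quantum Pascal rule in the form needed by [estringE]. *)
Lemma qintD m n : x ^- m * qint x n + x ^+ n * qint x m = qint x (m + n).
Proof.
have xd := qint_den_neq0; rewrite /qint !exprD.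
have um := expf_neq0 m x0; have un := expf_neq0 n x0.
field; rewrite um un x0 /= andbT.
by move: xd; apply: contra_neq => E; rewrite -[x - _](mulfK x0) mulrBl mulVf // -expr2 E mul0r.
Qed.

(** The right side is the quantum integer [d - m], where d - m may be negative. It is the increment
    of the coefficients found in [Fop_estring]. *)
Lemma qint_swap m d :
  qint x m.+1 * qint x d - qint x m * qint x d.+1 =
  - ((x ^+ m / x ^+ d - x ^+ d / x ^+ m) / (x - x^-1)).
Proof.
have xd := qint_den_neq0; rewrite /qint !exprS.
have um := expf_neq0 m x0; have un := expf_neq0 d x0.
field; rewrite um un x0 /= ?andbT.
by move: xd; apply: contra_neq => E; rewrite -[x - _](mulfK x0) mulrBl mulVf // -expr2 E mul0r.
Qed.

Lemma divpowS (A : algType K) r (a : A) :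
  a * divpow x r a = qint x r.+1 *: divpow x r.+1 a.
Proof.
rewrite /divpow -scalerAr -exprS scalerA qfactS invfM.
by rewrite mulrCA mulfV ?mulr1 // qint_neq0.
Qed.
Lemma divpowSr (A : algType K) r (a : A) :
  divpow x r a * a = qint x r.+1 *: divpow x r.+1 a.
Proof. by rewrite -divpowS /divpow -scalerAr -scalerAl -exprS -exprSr. Qed.
Lemma divpow0 (A : algType K) (a : A) : divpow x 0 a = 1.
Proof. by rewrite /divpow /qfact big_ord0 invr1 scale1r expr0. Qed.

End QuantumIntegers.

(* Both halves of U satisfy these relations, the negative one with e and f
   exchanged and k inverted. *)
Record qrels (K : fieldType) (I : eqType) (b : I -> I -> K) (D : I -> K)
    (A : algType K) (e f k kv : I -> A) : Prop := {
  qr_kkv : forall j, k j * kv j = 1;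
  qr_kvk : forall j, kv j * k j = 1;
  qr_ke : forall j l, k j * e l = b j l *: (e l * k j);
  qr_kf : forall j l, k j * f l = (b j l)^-1 *: (f l * k j);
  qr_ef : forall j l,
    e l * f j - f j * e l = ((l == j)%:R / D j) *: (k j - kv j)
}.

(** * Twisted commutators for one simple root *)

Section Sl2.
Variables (K : fieldType) (A : algType K) (e f k kv : A) (s D : K).
Hypotheses (s0 : s != 0) (kkv : k * kv = 1) (kvk : kv * k = 1).
Hypotheses (ke : k * e = s *: (e * k)) (kf : k * f = s^-1 *: (f * k)).
Hypothesis ef : e * f - f * e = D^-1 *: (k - kv).

Definition cop (k kv x : A) := k * x * kv.
(** [Eop] generates root strings. [Eop'] is the operation of the overview, and [T] carries it to a
    multiple of [Fop]. [Dop] realizes the removal of a last letter [i] inside the algebra, see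
    [phi_D]. *)
Definition Eop x := e * x - cop k kv x * e.
Definition Eop' x := x * e - e * cop k kv x.
Definition Fop x := (f * x - x * f) * k.
Definition Dop x := (f * x - x * f) * kv.

Lemma cop_lin (g h : A) : linear (cop g h).
Proof. by move=> c x y; rewrite /cop mulrDr mulrDl -scalerAr -scalerAl. Qed.
HB.instance Definition _ g h :=
  GRing.isLinear.Build K A A *:%R (cop g h) (cop_lin g h).
Lemma Eop_lin : linear Eop.
Proof.
move=> c x y; rewrite /Eop linearP mulrDr mulrDl -scalerAr -scalerAl; lmod K.
Qed.
Lemma Eop'_lin : linear Eop'.
Proof.
move=> c x y; rewrite /Eop' linearP mulrDr mulrDl -scalerAr -scalerAl; lmod K.
Qed.
Lemma Fop_lin : linear Fop.
Proof.
move=> c x y; rewrite /Fop !(mulrDr, mulrDl, mulNr) -!(scalerAr, scalerAl); lmod K.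
Qed.
Lemma Dop_lin : linear Dop.
Proof.
move=> c x y; rewrite /Dop !(mulrDr, mulrDl, mulNr) -!(scalerAr, scalerAl); lmod K.
Qed.
HB.instance Definition _ := GRing.isLinear.Build K A A *:%R Eop Eop_lin.
HB.instance Definition _ := GRing.isLinear.Build K A A *:%R Eop' Eop'_lin.
HB.instance Definition _ := GRing.isLinear.Build K A A *:%R Fop Fop_lin.
HB.instance Definition _ := GRing.isLinear.Build K A A *:%R Dop Dop_lin.

Local Notation c := (cop k kv).
Local Notation cv := (cop kv k).

Lemma copK x : cv (c x) = x.
Proof. by rewrite /cop !mulrA kvk mul1r -mulrA kvk mulr1. Qed.
Lemma copVK x : c (cv x) = x.
Proof. by rewrite /cop !mulrA kkv mul1r -mulrA kkv mulr1. Qed.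
Lemma copM x y : c (x * y) = c x * c y.
Proof. by rewrite /cop !mulrA -[_ * kv * k]mulrA kvk mulr1. Qed.
Lemma cop1 : c 1 = 1. Proof. by rewrite /cop mulr1. Qed.
Lemma cop_e : c e = s *: e.
Proof. by rewrite /cop ke -scalerAl -mulrA kkv mulr1. Qed.
Lemma cop_f : c f = s^-1 *: f.
Proof. by rewrite /cop kf -scalerAl -mulrA kkv mulr1. Qed.
Lemma copV_e : cv e = s^-1 *: e.
Proof. by rewrite -[e in RHS]copK cop_e linearZ scalerA mulVf // scale1r. Qed.
Lemma copV_f : cv f = s *: f.
Proof. by rewrite -[f in RHS]copK cop_f linearZ scalerA mulfV // scale1r. Qed.
Lemma cop_k : c k = k. Proof. by rewrite /cop -mulrA kkv mulr1. Qed.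
Lemma cop_kv : c kv = kv. Proof. by rewrite /cop kkv mul1r. Qed.
Lemma mulk x : k * x = c x * k.
Proof. by rewrite /cop -mulrA kvk mulr1. Qed.
Lemma mulkv x : kv * x = cv x * kv.
Proof. by rewrite /cop -mulrA kkv mulr1. Qed.
Lemma cop_E x : c (Eop x) = s *: Eop (c x).
Proof. by rewrite /Eop linearB /= !copM cop_e -scalerAl -scalerAr scalerBr. Qed.
Lemma cop_E' x : c (Eop' x) = s *: Eop' (c x).
Proof. by rewrite /Eop' linearB /= !copM cop_e -scalerAl -scalerAr scalerBr. Qed.
Lemma cop_F x : c (Fop x) = s^-1 *: Fop (c x).
Proof.
rewrite /Fop copM linearB /= !copM cop_f -scalerAl -scalerAr cop_k -scalerBr.
by rewrite scalerAl.
Qed.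
Lemma copV_F x : cv (Fop x) = s *: Fop (cv x).
Proof.
by rewrite -{1}[x]copVK -[Fop _](scalerKV s0) -cop_F linearZ /= copK.
Qed.

Lemma Fop_mul x y : Fop (x * y) = x * Fop y + Fop x * cv y.
Proof.
rewrite /Fop -[_ * k * cv y]mulrA.
have -> : k * cv y = y * k by rewrite /cop !mulrA kkv mul1r.
by rewrite !(mulrBr, mulrBl) !mulrA; lmod K.
Qed.

(** An sl2 relation between raising and lowering operators: on an eigenvector of the conjugation [c]
    the correction is a scalar, so [Fop] can be computed along a root string. *)
Lemma Fop_Eop x : Fop (Eop x) = Eop (Fop x) - D^-1 *: (c x - cv x).
Proof.
have cF : c (Fop x) * e = (f * c x - c x * f) * (e * k).
  rewrite cop_F -scalerAl /Fop -mulrA ke -scalerAr scalerA mulVf // scale1r.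
  by rewrite mulrA.
have -> : D^-1 *: (c x - cv x) = (e * f - f * e) * x * k - c x * (e * f - f * e) * k.
  rewrite ef -!scalerAl -scalerAr -scalerAl -scalerBr; congr (_ *: _).
  rewrite !(mulrBl, mulrBr) -[c x * kv * k]mulrA kvk mulr1 -mulk; lmod K.
rewrite /Eop cF /Fop !(mulrBr, mulrBl) !mulrA; lmod K.
Qed.

(** The correction involves only [x] and a conjugate of [x]; this is why [Dop] preserves a space
    stable under [Eop'] and conjugation, see [Bs_D]. *)
Lemma Dop_Eop' x : Dop (Eop' x) = s *: Eop' (Dop x) + D^-1 *: (c (c x) - x).
Proof.
have kve : e * kv = s *: (kv * e).
  by rewrite mulkv copV_e -scalerAl scalerA mulfV // scale1r.
have kvf : f * kv = s^-1 *: (kv * f).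
  by rewrite mulkv copV_f -scalerAl scalerA mulVf // scale1r.
have cD : c (Dop x) = s^-1 *: ((f * c x - c x * f) * kv).
  rewrite /Dop copM linearB /= !copM cop_f -scalerAl -scalerAr cop_kv.
  by rewrite -scalerBr scalerAl.
have De : Dop x * e = s^-1 *: ((f * x - x * f) * (e * kv)).
  by rewrite kve -scalerAr scalerA mulVf // scale1r /Dop mulrA.
have -> : D^-1 *: (c (c x) - x) =
    ((e * f - f * e) * c x - x * (e * f - f * e)) * kv.
  rewrite ef -!scalerAl -scalerAr -scalerBr -scalerAl; congr (_ *: _).
  rewrite !(mulrBl, mulrBr) -[x * k * kv]mulrA kkv mulr1.
  rewrite [kv * c x]mulkv copK -!/(c (c x)).
  lmod K.
rewrite /Eop' cD -scalerAr De scalerBr !scalerA mulfV // !scale1r.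
by rewrite /Dop !(mulrBr, mulrBl) !mulrA; lmod K.
Qed.

End Sl2.

Section QrelsTheory.
Variables (K : fieldType) (I : eqType) (b : I -> I -> K) (D : I -> K).
Hypothesis b0 : forall j l, b j l != 0.
Variables (A : algType K) (e f k kv : I -> A).
Hypothesis R : qrels b D e f k kv.

Lemma qr_kve j l : kv j * e l = (b j l)^-1 *: (e l * kv j).
Proof.
rewrite -[e l * kv j]mul1r -(qr_kvk R j) mulrA -[kv j * k j * _]mulrA (qr_ke R).
by rewrite -!(scalerAr, scalerAl) scalerA mulVf // scale1r -!mulrA (qr_kkv R) mulr1.
Qed.

Lemma qr_kvf j l : kv j * f l = b j l *: (f l * kv j).
Proof.
rewrite -[f l * kv j]mul1r -(qr_kvk R j) mulrA -[kv j * k j * _]mulrA (qr_kf R).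
by rewrite -!(scalerAr, scalerAl) scalerA mulfV // scale1r -!mulrA (qr_kkv R) mulr1.
Qed.

Lemma qrels_swap : qrels b D f e kv k.
Proof.
split=> [j|j|j l|j l|j l]; first exact: qr_kvk R j.
- exact: qr_kkv R j.
- exact: qr_kvf.
- exact: qr_kve.
rewrite -opprB (qr_ef R) eq_sym -scalerN opprB.
by case: eqP => [->|_] //; rewrite !mul0r !scale0r.
Qed.

Lemma qr_comm j l : l != j -> e l * f j = f j * e l.
Proof.
move=> /negPf lj; apply/eqP; rewrite -subr_eq0 (qr_ef R) lj mul0r scale0r.
exact: eqxx.
Qed.

Lemma qr_ef1 j : e j * f j - f j * e j = (D j)^-1 *: (k j - kv j).
Proof. by rewrite (qr_ef R) eqxx mul1r. Qed.

Lemma cop_ej j l : cop (k j) (kv j) (e l) = b j l *: e l.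
Proof. by rewrite /cop (qr_ke R) -scalerAl -mulrA (qr_kkv R) mulr1. Qed.
Lemma cop_fj j l : cop (k j) (kv j) (f l) = (b j l)^-1 *: f l.
Proof. by rewrite /cop (qr_kf R) -scalerAl -mulrA (qr_kkv R) mulr1. Qed.
Lemma copV_ej j l : cop (kv j) (k j) (e l) = (b j l)^-1 *: e l.
Proof. by rewrite /cop qr_kve -scalerAl -mulrA (qr_kvk R) mulr1. Qed.

End QrelsTheory.

(** * Root strings and Serre elements *)

Section RootStrings.
#[local] Opaque qint qfact divpow.
Variables (K : fieldType) (I : eqType) (b : I -> I -> K) (D : I -> K).
Hypothesis b0 : forall j l, b j l != 0.
Hypothesis bC : forall j l, b j l = b l j.
Variables (A : algType K) (e f k kv : I -> A).
Hypothesis R : qrels b D e f k kv.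
Variables (i j : I) (x : K) (n : nat).
Hypotheses (x0 : x != 0) (xn1 : forall m, (0 < m)%N -> x ^+ m != 1).
Hypotheses (ij : j != i) (bii : b i i = x ^+ 2) (bij : b i j = x ^- n).
Hypothesis Di : D i = x - x^-1.

Local Notation E := (Eop (e i) (k i) (kv i)).
Local Notation F := (Fop (f i) (k i)).
Local Notation c := (cop (k i) (kv i)).
Local Notation cv := (cop (kv i) (k i)).

(** For m = n this is T(e_j) up to a scalar, and for m = n + 1 the Serre element up to a scalar. *)
Definition estring m := iter m E (e j).

Arguments estring : simpl never.
Lemma estring0 : estring 0 = e j. Proof. by []. Qed.
Lemma estringS m : estring m.+1 = E (estring m). Proof. by []. Qed.

Let ke : k i * e i = x ^+ 2 *: (e i * k i).
Proof. by rewrite (qr_ke R) bii. Qed.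
Let kf : k i * f i = (x ^+ 2)^-1 *: (f i * k i).
Proof. by rewrite (qr_kf R) bii. Qed.
Let kkv := qr_kkv R i.
Let kvk := qr_kvk R i.
Let xx0 : x ^+ 2 != 0. Proof. by rewrite expf_neq0. Qed.

Lemma cop_estring m : c (estring m) = (x ^+ (m + m) / x ^+ n) *: estring m.
Proof.
elim: m => [|m ih] /=.
  by rewrite mul1r -bij (cop_ej R).
rewrite (cop_E kkv kvk ke) ih linearZ scalerA; congr (_ *: _).
by rewrite addSn addnS !exprS; ring.
Qed.

Lemma copV_estring m : cv (estring m) = (x ^+ n / x ^+ (m + m)) *: estring m.
Proof.
rewrite -[estring m in RHS](copK kvk) cop_estring linearZ scalerA.
rewrite -[LHS]scale1r; congr (_ *: _).
have u := expf_neq0 (m + m) x0; have v := expf_neq0 n x0.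
by field; rewrite u v.
Qed.

Lemma Fop_estring0 : F (e j) = 0.
Proof. by rewrite /Fop (qr_comm R ij) subrr mul0r. Qed.

(** Covers strings of any length, for which the truncated [n - m] of [Fop_estring] would give a
    wrong coefficient. *)
Lemma Fop_estringS m : exists p, F (estring m.+1) = p *: estring m.
Proof.
have FE := Fop_Eop xx0 kkv kvk ke kf (qr_ef1 R i).
elim: m => [|m [p ih]].
  exists (- ((D i)^-1 * (x ^+ 0 / x ^+ n - x ^+ n / x ^+ 0))).
  rewrite estringS FE estring0 Fop_estring0 linear0 sub0r -estring0.
  by rewrite cop_estring copV_estring addn0 -scalerBl scalerA scaleNr.
eexists; rewrite [X in F X]estringS FE ih linearZ /= -estringS cop_estring copV_estring -scalerBl scalerA.
by rewrite -scalerBl.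
Qed.

(** The coefficients are those of the sl2-module of dimension n + 1 with lowest vector e_j. At m = n
    the coefficient is 0, so the Serre element commutes with f_i. *)
Lemma Fop_estring m : (m <= n)%N ->
  F (estring m.+1) = (qint x m.+1 * qint x (n - m)) *: estring m.
Proof.
have FE := Fop_Eop xx0 kkv kvk ke kf (qr_ef1 R i).
elim: m => [_|m ih mn].
  rewrite estringS FE estring0 Fop_estring0 linear0 sub0r -estring0.
  rewrite cop_estring copV_estring -scalerBl scalerA -scaleNr; congr (_ *: _).
  have := qint_swap x0 xn1 0 n; rewrite qint0 mul0r subr0 subn0 => ->.
  by rewrite Di expr0; ring.
rewrite [X in F X]estringS FE ih ?(ltnW mn) // linearZ /= -estringS cop_estring copV_estring -scalerBl scalerA.
rewrite -scalerBl; congr (_ *: _).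
have := qint_swap x0 xn1 m.+1 (n - m.+1).
rewrite subnSK // => E1; rewrite -[LHS]/(_ - _ * _).
have xn : x ^+ n = x ^+ m.+1 * x ^+ (n - m.+1) by rewrite -exprD subnKC.
have u := expf_neq0 m.+1 x0; have v := expf_neq0 (n - m.+1) x0.
have -> : x ^+ (m.+1 + m.+1) / x ^+ n = x ^+ m.+1 / x ^+ (n - m.+1).
  by rewrite exprD xn; field; rewrite u v.
have -> : x ^+ n / x ^+ (m.+1 + m.+1) = x ^+ (n - m.+1) / x ^+ m.+1.
  by rewrite exprD xn; field; rewrite ?u ?v ?x0.
move/eqP: E1; rewrite subr_eq => /eqP ->; rewrite Di; ring.
Qed.

(** Each step up the string multiplies the commutator by one factor. The factor of index n is 0,
    which makes the Serre element commute with f_j. *)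
Lemma commutator_estring m :
  estring m.+1 * f j - f j * estring m.+1 =
  ((D j)^-1 * \prod_(t < m.+1) (1 - x ^+ (t + t) / x ^+ (n + n))) *:
    (e i ^+ m.+1 * k j).
Proof.
have step p : estring p.+1 * f j - f j * estring p.+1 =
    e i * (estring p * f j - f j * estring p) -
    (x ^+ (p + p) / x ^+ n) *: ((estring p * f j - f j * estring p) * e i).
  have ef : e i * f j = f j * e i by rewrite (qr_comm R) // eq_sym.
  rewrite estringS /Eop cop_estring.
  rewrite !(mulrBl, mulrBr) -!(scalerAl, scalerAr) !mulrA -[_ * e i * f j]mulrA ef.
  by rewrite !mulrA; lmod K.
have kje : k j * e i = x ^- n *: (e i * k j) by rewrite (qr_ke R) bC bij.
have kvje : kv j * e i = x ^+ n *: (e i * kv j).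
  by rewrite (qr_kve b0 R) bC bij invrK.
elim: m => [|m ih].
  rewrite big_ord1 step estring0 (qr_ef1 R) addn0 mul1r.
  rewrite -!(scalerAl, scalerAr) mulrBl mulrBr kje kvje expr1.
  have v := expf_neq0 n x0; rewrite exprD.
  move: (D j)^-1 => d; lmod K; first by field; rewrite v.
  by field; rewrite v.
rewrite step ih [in RHS]big_ord_recr /= -!(scalerAl, scalerAr).
have -> : e i ^+ m.+1 * k j * e i = x ^- n *: (e i ^+ m.+2 * k j).
  by rewrite -mulrA kje -scalerAr mulrA -exprSr.
rewrite [e i * _]mulrA -exprS !exprD.
have v := expf_neq0 n x0.
set P := \prod_(_ < _) _; move: P (D j)^-1 => P d; lmod K. by field; rewrite v.
Qed.

(** Applied later with the two families exchanged, to the Serre element in the removal operators,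
    which thus commutes with all insertions of letters. *)
Lemma estring_comm_f l : estring n.+1 * f l = f l * estring n.+1.
Proof.
have [->|li] := eqVneq l i.
  have := Fop_estring (leqnn n); rewrite subnn qint0 mulr0 scale0r /Fop.
  move/(congr1 (fun y => y * kv i)); rewrite -mulrA kkv mulr1 mul0r => /eqP.
  by rewrite subr_eq0 => /eqP.
have [->|lj] := eqVneq l j.
  apply/eqP; rewrite -subr_eq0 commutator_estring big_ord_recr /=.
  by rewrite divff ?expf_neq0 // subrr !mulr0 scale0r.
have ei : e i * f l = f l * e i by rewrite (qr_comm R) // eq_sym.
have ej : e j * f l = f l * e j by rewrite (qr_comm R) // eq_sym.
elim: n.+1 => [//|m ih]; rewrite estringS /Eop cop_estring.
have A1 : e i * estring m * f l = f l * (e i * estring m).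
  by rewrite -mulrA ih mulrA ei mulrA.
have A2 : estring m * e i * f l = f l * (estring m * e i).
  by rewrite -mulrA ei mulrA ih mulrA.
by rewrite mulrBl mulrBr -!(scalerAl, scalerAr) A1 A2.
Qed.

(** At m = n the weights are those in the definition of T(e_j); at m = n + 1 the power of [x]
    disappears and the Serre polynomial remains, up to sign. *)
Definition estring_sum m : A := \sum_(r < m.+1)
  ((-1) ^+ r * x ^- (r * (n.+1 - m))) *:
    (divpow x (m - r) (e i) * e j * divpow x r (e i)).

Lemma estringE m : (m <= n.+1)%N -> estring m = qfact x m *: estring_sum m.
Proof.
elim: m => [_|m ih mn].
  rewrite /estring_sum big_ord1 qfact0 scale1r !divpow0 mulr1 mul1r.
  by rewrite mul0n expr0 invr1 mulr1 scale1r.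
have {}ih := ih (ltnW mn).
rewrite estringS /Eop cop_estring ih.
rewrite -scalerAr scalerA -scalerAl mulrC -scalerA -scalerBr qfactS -scalerA.
congr (_ *: _); pose M r := divpow x (m.+1 - r) (e i) * e j * divpow x r (e i).
have -> : e i * estring_sum m = \sum_(r < m.+2)
    ((-1) ^+ r * x ^- (r * (n.+1 - m)) * qint x (m.+1 - r)) *: M r.
  rewrite [RHS]big_ord_recr /= subnn qint0 mulr0 scale0r addr0 mulr_sumr.
  apply: eq_bigr => r _; have rm : (r <= m)%N by rewrite -ltnS.
  rewrite -scalerAr [e i * _]mulrA [e i * (_ * _)]mulrA divpowS // /M (subSn rm).
  move: (divpow x _.+1 (e i)) (divpow x r (e i)) => u w.
  by rewrite -!scalerAl scalerA.
have -> : estring_sum m * e i = \sum_(r < m.+2)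
    (if (r : nat) is r'.+1 then
       (-1) ^+ r' * x ^- (r' * (n.+1 - m)) * qint x r else 0) *: M r.
  rewrite [RHS]big_ord_recl /= scale0r add0r mulr_suml.
  apply: eq_bigr => r _; rewrite -scalerAl -[_ * divpow x r (e i) * e i]mulrA divpowSr // /M subSS.
  rewrite /bump /= add1n.
  move: (divpow x _ (e i)) (divpow x _.+1 (e i)) => u w.
  by rewrite -!scalerAr scalerA.
rewrite scaler_sumr -sumrB scaler_sumr; apply: eq_bigr => r _.
rewrite -/(M r) !scalerA -scalerBl; congr (_ *: _); case: r => -[|r] /= rm.
  by rewrite mulr0 subr0 !mul0n subn0; ring.
rewrite !ltnS in rm mn; have hm := subnKC rm; have hn := subnKC mn.
rewrite !subSS subSn // -hn addKn; move: (n - m)%N => d.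
(* Left and right multiplication by [e i] contribute the two summands of the quantum Pascal rule. *)
have -> : qint x m.+1 = x ^- r.+1 * qint x (m - r) + x ^+ (m - r) * qint x r.+1.
  by rewrite qintD // addSn hm.
have xm : x ^+ m = x ^+ r * x ^+ (m - r) by rewrite -exprD hm.
rewrite !mulSn !mulnS !exprD !exprS xm.
move: (m - r)%N (qint x _) (qint x _) => p y z.
have := expf_neq0 r x0; have := expf_neq0 d x0; have := expf_neq0 p x0.
have := expf_neq0 (r * d) x0.
move: (x ^+ r) (x ^+ d) (x ^+ p) (x ^+ (r * d)) => u1 u2 u3 u4 h4 h3 h2 h1.
by field; rewrite ?h1 ?h2 ?h3 ?h4 ?x0.
Qed.

End RootStrings.

(** * Weights *)

Section DatumArithmetic.
Variable D : datum.
Implicit Types (i j l : idx D) (u v : lat D).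

Definition alphaZ j u : int := Num.floor (alpha j (val u) : rat).

Lemma alphaZE j u : (alphaZ j u)%:~R = alpha j (val u) :> rat.
Proof. by apply/eqP; rewrite -Num.Theory.intrEfloor; apply: alpha_int; apply: valP. Qed.

Lemma alphaZ_eq j u (n : int) : alpha j (val u) = n%:~R -> n = alphaZ j u.
Proof. by rewrite -alphaZE => /intr_inj. Qed.

Lemma alphaZD j u v : alphaZ j (u + v) = alphaZ j u + alphaZ j v.
Proof.
by apply: (@intr_inj rat); rewrite intrD !alphaZE; exact: (linearD (alpha j)).
Qed.
Lemma alphaZN j u : alphaZ j (- u) = - alphaZ j u.
Proof. by apply: (@intr_inj rat); rewrite intrN !alphaZE; exact: (linearN (alpha j)). Qed.
Lemma alphaZ0 j : alphaZ j 0 = 0.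
Proof. by apply: (@intr_inj rat); rewrite alphaZE; exact: (linear0 (alpha j)). Qed.
Lemma alphaZ_t j l : alphaZ l (t_ j) = (hlen j)%:Z * cartan j l.
Proof.
apply: (@intr_inj rat); rewrite alphaZE [LHS](linearMn (alpha l)) /= cartanE intrM -mulr_natl.
by rewrite -pmulrn.
Qed.

Lemma alpha_span j : alpha j \in <<[seq alpha i | i : idx D]>>%VS.
Proof. by apply: memv_span; apply: map_f; rewrite mem_enum. Qed.

(** The value (alpha_j, alpha_l), in a form that shows it to be an integer; see [bform_alpha]. *)
Definition bilZ j l : int := (hlen j)%:Z * cartan j l.

Lemma sreflK j :
  involutive (srefl (@alphav D) (@alpha D) j).
Proof.
move=> x; rewrite sreflE.
have -> : alpha j (srefl (@alphav D) (@alpha D) j x) = - alpha j x.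
  rewrite sreflE [LHS](linearB (alpha j)) /= [X in _ - X](linearZ_LR (alpha j)) /=.
  rewrite cartanE; have [-> _ _] := cartanP D.
  by set a : rat := alpha j x; rewrite -[LHS]/(a - a * 2%:~R) -[RHS]/(- a); ring.
by rewrite sreflE scaleNr opprK subrK.
Qed.

Lemma srefl_inv j :
  (srefl (@alphav D) (@alpha D) j)^-1%VF = srefl (@alphav D) (@alpha D) j.
Proof.
have ss := sreflK j; set s := srefl _ _ _ in ss *.
have ker : lker s == 0%VS by apply/lker0P; apply: can_inj ss.
by apply/lfunP => x; rewrite -{1}[x]ss lker0_lfunK.
Qed.

Lemma weyl_act_srefl j l :
  weyl_act (srefl (@alphav D) (@alpha D) j) (alpha l) =
  - (cartan j l)%:~R *: alpha j + alpha l.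
Proof.
apply/lfunP => x; rewrite /weyl_act srefl_inv comp_lfunE sreflE linearB linearZ.
rewrite /= cartanE !lfunE /= !lfunE /=.
set a : rat := alpha j x; set c : rat := alpha l x.
rewrite -[LHS]/(c - a * (cartan j l)%:~R) -[RHS]/(- (cartan j l)%:~R * a + c).
by ring.
Qed.

Lemma bform0l nu : nu \in <<[seq alpha i | i : idx D]>>%VS -> bform 0 nu = 0.
Proof.
move=> nuS; have := formPl 1 (mem0v _) (mem0v _) nuS.
by rewrite scale1r addr0 mul1r => /(congr1 (fun y => y - bform 0 nu)); rewrite addrK subrr.
Qed.
Lemma bformZl c lam nu : lam \in <<[seq alpha i | i : idx D]>>%VS ->
  nu \in <<[seq alpha i | i : idx D]>>%VS -> bform (c *: lam) nu = c * bform lam nu.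
Proof.
by move=> lS nS; have := formPl c lS (mem0v _) nS; rewrite addr0 bform0l // addr0.
Qed.

(** With a = <alpha_l, h_j>, invariance under s_j reads (-alpha_j, alpha_l - a alpha_j) = (alpha_j,
    alpha_l), whence (alpha_j, alpha_l) = a (alpha_j, alpha_j)/2. *)
Lemma bform_alpha j l : bform (alpha j) (alpha l) = (bilZ j l)%:~R.
Proof.
have aj := alpha_span j; have al := alpha_span l.
have := formW (weyl_refl (@alphav D) (@alpha D) j) aj al.
rewrite !weyl_act_srefl; have [-> _ _] := cartanP D.
have -> : (- 2%:~R : rat) *: alpha j + alpha j = (-1 : rat) *: alpha j.
  by rewrite -[X in _ + X]scale1r -scalerDl; congr (_ *: _); ring.
rewrite bformZl ?memvD ?memvZ // Defs.formC ?memvD ?memvZ // formPl // -?[bform (alpha l) _]Defs.formC //.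
have := hlenE j => hj.
have {}hj : bform (alpha j) (alpha j) = (hlen j)%:R * 2 :> rat.
  by rewrite -hj divfK.
rewrite hj /bilZ intrM -pmulrn; move: (bform _ _) => B E.
apply: (@mulIf rat 2) => //; have -> : B * 2 = B + B by ring.
by rewrite -{1}E; ring.
Qed.

Lemma bilZC j l : bilZ j l = bilZ l j.
Proof.
by apply: (@intr_inj rat); rewrite -!bform_alpha Defs.formC ?alpha_span.
Qed.

Lemma cartan_ii j : cartan j j = 2 :> int.
Proof. by have [] := cartanP D. Qed.
Lemma cartan_neq j l : l != j -> cartan j l = - (mcartan j l)%:Z.
Proof.
by rewrite eq_sym; have [_ H _] := cartanP D => /H; rewrite /mcartan; lia.
Qed.

Section Powers.
Variables (K : fieldType) (q : K).
Hypotheses (q0 : q != 0) (qn1 : forall m, (0 < m)%N -> q ^+ m != 1).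

Definition bq j l : K := q ^ bilZ j l.
Definition dq j : K := q_ q j - (q_ q j)^-1.

Lemma bq_neq0 j l : bq j l != 0. Proof. exact: expfz_neq0. Qed.
Lemma bqC j l : bq j l = bq l j. Proof. by rewrite /bq bilZC. Qed.
Lemma q_neq0 j : q_ q j != 0. Proof. exact: expf_neq0. Qed.
Lemma q_exp_neq1 j m : (0 < m)%N -> q_ q j ^+ m != 1.
Proof. by move=> m0; rewrite -exprM qn1 // muln_gt0 hlen_gt0. Qed.
Lemma bq_ii j : bq j j = q_ q j ^+ 2.
Proof. by rewrite /bq /bilZ cartan_ii /q_ -exprM exprnP PoszM. Qed.
Lemma bq_ij j l : l != j -> bq j l = q_ q j ^- mcartan j l.
Proof.
by move=> lj; rewrite /bq /bilZ cartan_neq // mulrN -PoszM -exprnN /q_ exprM.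
Qed.
Lemma dq_neq0 j : dq j != 0.
Proof. by apply: qint_den_neq0; [apply: q_neq0 | apply: q_exp_neq1]. Qed.

End Powers.

End DatumArithmetic.

(** * The operators on word functions satisfy the relations of U other than Serre's *)

Section ShuffleModule.
Variables (K : fieldType) (q : K).
Hypotheses (q0 : q != 0) (qn1 : forall m, (0 < m)%N -> q ^+ m != 1).
Variables (D : datum) (i0 : idx D).
Implicit Types (i j l : idx D) (u : lat D).
Local Notation I := (idx D).
Local Notation V := (seq I -> K^o).
Local Notation b := (bq q).
Local Notation rend := (rend K I).

(** The value of tau on e_j and f_l; likewise [bq q j l] is its value on k_j and k_l^-1. *)
Definition tq j l : K := - ((j == l)%:R / dq q j).

Lemma tq_diag j l : tq j l != 0 -> j = l.
Proof. by rewrite /tq; case: (eqVneq j l) => // _; rewrite mul0r oppr0 eqxx. Qed.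
Lemma tqC j l : tq j l = tq l j.
Proof. by rewrite /tq eq_sym; case: eqP => [->//|_]; rewrite !mul0r. Qed.

Local Notation X := (Xop b tq).
Local Notation X' := (Xop' b tq).
Local Notation bC := (bqC q).

(** The character of the torus on [vac]. It shifts all weights of the module by -alpha_i0, and
    produces the factor [qint x m.+2] of [Yop_theta]. *)
Definition chi u : K := q ^ (- alphaZ i0 u).
Definition wt u l : K := q ^ (- alphaZ l u).
Definition Aop u (v : V) : V := chi u *: Kop (wt u) v.
(** The action of f_j. As f_j kills [vac], it acts on the function of y through y f_j - f_j y, a
    combination of a term with k_j^-1 in front and the first letter removed, and of a term with k_j
    behind and the last letter removed. In a right module the front factor meets [vac] and gives the
    scalar [chi (t_ j)]^-1, while the factor behind acts on the whole function. *)
Definition Yop j (v : V) : V :=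
  (chi (t_ j))^-1 *: Lop j v - chi (t_ j) *: Kop (wt (t_ j)) (Rop j v).

Arguments Aop : simpl never.
Arguments Yop : simpl never.

Lemma chi_neq0 u : chi u != 0. Proof. exact: expfz_neq0. Qed.
Lemma wt_neq0 u l : wt u l != 0. Proof. exact: expfz_neq0. Qed.
Lemma wt_t j l : wt (t_ j) l = (b j l)^-1.
Proof. by rewrite /wt alphaZ_t invr_expz. Qed.
Lemma chiD u v : chi (u + v) = chi u * chi v.
Proof. by rewrite /chi alphaZD opprD expfzDr. Qed.
Lemma chiN u : chi (- u) = (chi u)^-1.
Proof. by rewrite /chi alphaZN invr_expz. Qed.
Lemma wtN u l : wt (- u) l = (wt u l)^-1.
Proof. by rewrite /wt alphaZN invr_expz. Qed.

Lemma Aop_lin u : linear (Aop u).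
Proof.
by move=> c x y; rewrite /Aop linearP scalerDr !scalerA mulrC.
Qed.
HB.instance Definition _ u := GRing.isLinear.Build K V V *:%R (Aop u) (Aop_lin u).
Lemma AopZ u c v : Aop u (c *: v) = c *: Aop u v.
Proof. exact: linearZ. Qed.
Lemma Yop_lin j : linear (Yop j).
Proof. by move=> c x y; rewrite /Yop !linearP /=; lmod K. Qed.
HB.instance Definition _ j := GRing.isLinear.Build K V V *:%R (Yop j) (Yop_lin j).

Lemma Aop0 v : Aop 0 v = v.
Proof.
rewrite /Aop /chi alphaZ0 oppr0 expr0z scale1r Kop_one // => l.
by rewrite /wt alphaZ0 oppr0 expr0z.
Qed.
Lemma Aop_Aop u u' v : Aop u (Aop u' v) = Aop (u' + u) v.
Proof.
rewrite /Aop KopZ Kop_Kop scalerA -chiD [u + u']addrC; congr (_ *: Kop _ v).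
by apply/funext => l; rewrite /wt alphaZD opprD expfzDr // mulrC.
Qed.
Lemma Aop_X' u j v : Aop u (X' j v) = wt u j *: X' j (Aop u v).
Proof.
rewrite /Aop (Kop_Xop' _ (@tq_diag)).
by rewrite Xop'Z !scalerA mulrC.
Qed.
Lemma Aop_Y u j v : Aop u (Yop j v) = (wt u j)^-1 *: Yop j (Aop u v).
Proof.
rewrite /Aop /Yop !opLR Lop_Kop Rop_Kop !opE !Kop_Kop.
have -> : (fun l => wt (t_ j) l * wt u l) = (fun l => wt u l * wt (t_ j) l).
  by apply/funext => l; rewrite mulrC.
by have w0 := wt_neq0 u j; have c0 := chi_neq0 (t_ j); lmod K; field; rewrite ?w0 ?c0.
Qed.

Lemma Yop_X' j l v : Yop j (X' l v) - X' l (Yop j v) =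
  ((l == j)%:R / dq q j) *: (Aop (t_ j) v - Aop (- t_ j) v).
Proof.
have c0 := chi_neq0 (t_ j); have bl := bq_neq0 q0 l j.
rewrite /Yop Lop_Xop' Rop_Xop' /Aop chiN.
rewrite !opE (Kop_Xop' _ (@tq_diag)) wt_t bC.
have -> : wt (- t_ j) = b j by apply/funext => m; rewrite wtN wt_t invrK.
have d0 := dq_neq0 q0 qn1 j.
have [lj|lj] := eqVneq l j.
  subst l; have -> : tq j j = - (dq q j)^-1 by rewrite /tq eqxx mul1r.
  by rewrite mul1r; lmod K; field; rewrite ?c0 ?bl ?d0.
have -> : tq l j = 0 by rewrite /tq (negPf lj) mul0r oppr0.
by rewrite mul0r; lmod K; field; rewrite ?chi_neq0 ?bq_neq0.
Qed.

Definition mk_rend (f : V -> V) (fl : linear f) : rend := Rend (introT (asboolP _) fl).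
Definition rX j := mk_rend (Xop'_lin b tq j).
Definition rY j := mk_rend (Yop_lin j).
Definition rA u := mk_rend (Aop_lin u).

Lemma qrels_shuffle :
  qrels b (dq q) rX rY (fun j => rA (t_ j)) (fun j => rA (- t_ j)).
Proof.
have AA u v : Aop (- u) (Aop u v) = v by rewrite Aop_Aop subrr Aop0.
split=> [j|j|j l|j l|j l]; apply: rend_ext => v //=.
- by have := AA (- t_ j) v; rewrite opprK.
- by rewrite Aop_X' wt_t scalerA mulfV ?bq_neq0 // scale1r.
- by rewrite Aop_Y wt_t invrK scalerA mulVf ?bq_neq0 // scale1r.
- by rewrite !scaleN1r Yop_X'.
Qed.

End ShuffleModule.

(** * Serre polynomials and evaluation of the free algebra *)

Section SerrePolynomial.
Variables (K : fieldType) (A : algType K) (x : K).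

Definition serre_poly n (a c : A) : A := \sum_(r < n.+2)
  (-1) ^+ r *: (divpow x r a * c * divpow x (n.+1 - r) a).

Lemma estring_sum_serre (I : eqType) (e : I -> A) i j n :
  estring_sum e i j x n n.+1 = (-1) ^+ n.+1 *: serre_poly n (e i) (e j).
Proof.
rewrite /estring_sum /serre_poly scaler_sumr (reindex_inj rev_ord_inj) /=.
apply: eq_bigr => r _; rewrite subSS subnn muln0 invr1 mulr1.
have rn : (r <= n.+1)%N by rewrite -ltnS.
by rewrite subKn // scalerA -exprD -signr_odd oddB // -oddD signr_odd.
Qed.

End SerrePolynomial.

Section AlgebraMorphisms.
Variables (K : fieldType) (A B : algType K) (g : A -> B).
Hypothesis g_lin : forall c x y, g (c *: x + y) = c *: g x + g y.
Hypotheses (g_mul : forall x y, g (x * y) = g x * g y) (g_one : g 1 = 1).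

Lemma amor0 : g 0 = 0.
Proof.
by have := g_lin (-1) 0 0; rewrite scaler0 addr0 scaleN1r addNr.
Qed.
Lemma amorZ c x : g (c *: x) = c *: g x.
Proof. by have := g_lin c x 0; rewrite amor0 !addr0. Qed.
Lemma amorD x y : g (x + y) = g x + g y.
Proof. by have := g_lin 1 x y; rewrite !scale1r. Qed.
Lemma amorB x y : g (x - y) = g x - g y.
Proof. by rewrite -scaleN1r amorD amorZ scaleN1r. Qed.
Lemma amorX x n : g (x ^+ n) = g x ^+ n.
Proof. by elim: n => [//|n ih]; rewrite !exprS g_mul ih. Qed.
Lemma amor_mulB x y z : g (x * y - z) = g x * g y - g z.
Proof. by rewrite amorB g_mul. Qed.
Lemma amor_mul3B x y z c t :
  g (x * y * z - c *: t) = g x * g y * g z - c *: g t.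
Proof. by rewrite amorB amorZ !g_mul. Qed.
Lemma amor_commB x y z t c :
  g (x * y - y * x - c *: (z - t)) =
  g x * g y - g y * g x - c *: (g z - g t).
Proof. by rewrite amorB amorZ !amorB !g_mul. Qed.
Lemma amor_serre u n a c :
  g (serre_poly u n a c) = serre_poly u n (g a) (g c).
Proof.
rewrite /serre_poly (big_morph _ amorD amor0); apply: eq_bigr => r _.
by rewrite amorZ !g_mul /divpow !amorZ !amorX.
Qed.

End AlgebraMorphisms.

Section FreeEvaluation.
Variables (K : fieldType) (q : K) (D : datum) (A : algType K) (G : gen D -> A).

Definition geval_mon (m : {fmonom gen D}) : A := \prod_(g <- (m : seq (gen D))) G g.
Lemma geval_mon_mmorphism : mmorphism geval_mon.
Proof.
split=> [x y|]; rewrite /geval_mon; last by rewrite fm1 big_nil.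
by rewrite fmM big_cat.
Qed.
HB.instance Definition _ :=
  monalg.isMultiplicative.Build {fmonom gen D} A geval_mon geval_mon_mmorphism.

Definition geval : free_alg K D -> A := mmap (@GRing.in_alg K A) geval_mon.

Lemma gevalM x y : geval (x * y) = geval x * geval y.
Proof.
have H (g : free_alg K D) m m' : GRing.comm (@GRing.in_alg K A g@_m) (geval_mon m').
  by rewrite /GRing.comm /= mulr_algl mulr_algr.
exact: (commr_mmap_is_multiplicative H).1.
Qed.
Lemma geval1 : geval 1 = 1.
Proof. by rewrite /geval mmap1. Qed.
Lemma geval_lin c x y : geval (c *: x + y) = c *: geval x + geval y.
Proof. by rewrite /geval mmapD mmapZ /= mulr_algl. Qed.
Lemma geval_mulB x y z : geval (x * y - z) = geval x * geval y - geval z.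
Proof. exact: (amor_mulB geval_lin gevalM). Qed.
Lemma geval_mul3B x y z c t :
  geval (x * y * z - c *: t) = geval x * geval y * geval z - c *: geval t.
Proof. exact: (amor_mul3B geval_lin gevalM). Qed.
Lemma geval_commB x y z t c :
  geval (x * y - y * x - c *: (z - t)) =
  geval x * geval y - geval y * geval x - c *: (geval z - geval t).
Proof. exact: (amor_commB geval_lin gevalM). Qed.
Lemma gevalB x y : geval (x - y) = geval x - geval y.
Proof. exact: (amorB geval_lin). Qed.
Lemma geval0 : geval 0 = 0.
Proof. exact: (amor0 geval_lin). Qed.
Lemma geval_gen g : geval << fmu g >> = G g.
Proof. by rewrite [LHS]mmapU /= scale1r mul1r /geval_mon fmuE big_seq1. Qed.
Lemma geval_serre i j x y :
  geval (serre q i j x y) = serre_poly (q_ q i) (mcartan i j) (geval x) (geval y).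
Proof. exact: (amor_serre geval_lin gevalM geval1). Qed.

End FreeEvaluation.

(** * The module attached to a half of U *)

Section SubalgebraInduction.
Variables (K : fieldType) (A : algType K) (S : set A).

Lemma subalgD x y : subalg S x -> subalg S y -> subalg S (x + y).
Proof. by move=> xS yS; rewrite -[x]scale1r; apply: subalg_ZD. Qed.
Lemma subalg0 : subalg S 0.
Proof.
have := subalg_ZD (-1) (subalg_1 S) (subalg_1 S).
by rewrite scaleN1r addNr.
Qed.
Lemma subalgZ c x : subalg S x -> subalg S (c *: x).
Proof. by move=> xS; rewrite -[c *: x]addr0; apply: subalg_ZD => //; apply: subalg0. Qed.
Lemma subalgN x : subalg S x -> subalg S (- x).
Proof. by rewrite -scaleN1r; apply: subalgZ. Qed.
Lemma subalgB x y : subalg S x -> subalg S y -> subalg S (x - y).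
Proof. by move=> xS yS; apply: subalgD => //; apply: subalgN. Qed.
Lemma subalgX x n : subalg S x -> subalg S (x ^+ n).
Proof.
by move=> xS; elim: n => [|n ih]; rewrite ?exprS; [apply: subalg_1|apply: subalg_M].
Qed.
Lemma subalg_sum n (F : 'I_n -> A) :
  (forall r, subalg S (F r)) -> subalg S (\sum_r F r).
Proof. by move=> FS; apply: big_ind => //; [apply: subalg0 | apply: subalgD]. Qed.

(** The induction runs on [P (z * x)] for all [z] of the subalgebra satisfying [P], so that a
    product is handled by using the two hypotheses in succession. *)
Lemma subalg_ind_r (P : A -> Prop) :
  P 1 -> (forall c x y, P x -> P y -> P (c *: x + y)) ->
  (forall x s, subalg S x -> P x -> S s -> P (x * s)) ->
  forall x, subalg S x -> P x.
Proof.
move=> P1 PD PM x xS; rewrite -[x]mul1r.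
elim: xS 1 (subalg_1 S) P1 => {x} [s sS|| c x y xS ihx yS ihy|x y xS ihx yS ihy] z zS Pz.
- exact: PM.
- by rewrite mulr1.
- by rewrite mulrDr -scalerAr; apply: PD; [apply: ihx | apply: ihy].
- by rewrite mulrA; apply: ihy; [apply: subalg_M | apply: ihx].
Qed.

Lemma subalg_ind_l (P : A -> Prop) :
  P 1 -> (forall c x y, P x -> P y -> P (c *: x + y)) ->
  (forall x s, subalg S x -> P x -> S s -> P (s * x)) ->
  forall x, subalg S x -> P x.
Proof.
move=> P1 PD PM x xS; rewrite -[x]mulr1.
elim: xS 1 (subalg_1 S) P1 => {x} [s sS|| c x y xS ihx yS ihy|x y xS ihx yS ihy] z zS Pz.
- exact: PM.
- by rewrite mul1r.
- by rewrite mulrDl -scalerAl; apply: PD; [apply: ihx | apply: ihy].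
- by rewrite -mulrA; apply: ihx; [apply: subalg_M | apply: ihy].
Qed.

End SubalgebraInduction.

Section HalfModule.
Local Open Scope quotient_scope.
Variables (K : fieldType) (q : K).
Hypotheses (q0 : q != 0) (qn1 : forall m, (0 < m)%N -> q ^+ m != 1).
Variables (D : datum) (i0 : idx D).
Implicit Types (i j l : idx D) (u : lat D).
Local Notation I := (idx D).
Local Notation V := (seq I -> K^o).
Local Notation b := (bq q).
Local Notation rend := (rend K I).
Local Notation U := (Uq q D).
Local Notation X' := (Xop' b (tq q (D:=D))).
Local Notation Y := (Yop q i0).
Local Notation A := (Aop q i0).
Local Notation vac := (vac K (I := I)).

Lemma Uq_piM (x y : free_alg K D) : \pi_U (x * y) = \pi_U x * \pi_U y.
Proof. by rewrite [RHS]umulE. Qed.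
Lemma Uq_piZ c (x : free_alg K D) : \pi_U (c *: x) = c *: \pi_U x.
Proof. by rewrite [RHS]uscaleE. Qed.
Lemma Uq_piD (x y : free_alg K D) : \pi_U (x + y) = \pi_U x + \pi_U y.
Proof. by rewrite uaddE. Qed.
Lemma Uq_pi_lin c (x y : free_alg K D) :
  \pi_U (c *: x + y) = c *: \pi_U x + \pi_U y.
Proof. by rewrite Uq_piD Uq_piZ. Qed.
Lemma Uq_pi0 : \pi_U 0 = 0.
Proof. exact: (amor0 (g := pi U) Uq_pi_lin). Qed.
Lemma Uq_pi1 : \pi_U 1 = 1. Proof. by []. Qed.
Lemma Uq_pi_serre i j (x y : free_alg K D) :
  \pi_U (serre q i j x y) = serre_poly (q_ q i) (mcartan i j) (\pi_U x) (\pi_U y).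
Proof. exact: (amor_serre (g := pi U) Uq_pi_lin Uq_piM Uq_pi1). Qed.

Lemma Uq_pi_rel (x : free_alg K D) : qea_rel q x -> \pi_U x = 0.
Proof. by move=> xR; rewrite -Uq_pi0; apply/UqP; rewrite subr0; apply: ideal_rel. Qed.

(** The boolean selects a half: [true] for U^+, [false] for U^- with e and f exchanged and the torus
    inverted. *)
Definition eU (s : bool) j : U := if s then e_ q j else f_ q j.
Definition fU (s : bool) j : U := if s then f_ q j else e_ q j.
Definition kU (s : bool) u : U := k_ q (if s then u else - u).
Definition Uh s : set U := subalg (range (eU s)).

Lemma serre_eU s i j : i != j ->
  serre_poly (q_ q i) (mcartan i j) (eU s i) (eU s j) = 0.
Proof.
by case: s => ij; rewrite -Uq_pi_serre Uq_pi_rel //; [apply: rel_e | apply: rel_f].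
Qed.

Definition Gh (s : bool) (g : gen D) : rend :=
  match g with
  | inl u => rA q i0 (if s then u else - u)
  | inr (inl j) => if s then rX q j else rY q i0 j
  | inr (inr j) => if s then rY q i0 j else rX q j
  end.

(** Nothing is required outside [Uh s], since tau has arbitrary values outside its domain. *)
Record half_form (s : bool) (phi : U -> V) : Prop := {
  hf_lin : forall c x y, Uh s x -> Uh s y -> phi (c *: x + y) = c *: phi x + phi y;
  hf_1 : phi 1 = vac;
  hf_e : forall x j, Uh s x -> phi (x * eU s j) = X' j (phi x)
}.

Section Module.
Variables (s : bool) (phi : U -> V).
Hypothesis H : half_form s phi.

(** The relations of U are checked on this subspace only: the Serre relations among removals are
    derived from its being generated from [vac] by the [X' j]. *)
Definition Img (v : V) : Prop := exists2 x, Uh s x & v = phi x.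

Lemma Uh_e j : Uh s (eU s j).
Proof. by apply: subalg_gen; exists j. Qed.

Lemma Img_phi x : Uh s x -> Img (phi x). Proof. by exists x. Qed.

Lemma Img_ind (P : V -> Prop) :
  P vac -> (forall c v w, P v -> P w -> P (c *: v + w)) ->
  (forall v j, Img v -> P v -> P (X' j v)) -> forall v, Img v -> P v.
Proof.
move=> Pvac PD PX _ [x xU ->]; suff: Uh s x /\ P (phi x) by case.
apply: (@subalg_ind_r K U (range (eU s)) (fun y => Uh s y /\ P (phi y)) _ _ _ x xU) => [|c y z [yU Py] [zU Pz]|y _ _ [yU Py] [j _ <-]].
- by split; [apply: subalg_1 | rewrite (hf_1 H)].
- by split; [apply: subalg_ZD | rewrite (hf_lin H) //; apply: PD].
- split; first by apply: subalg_M => //; apply: Uh_e.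
  by rewrite (hf_e H) //; apply: PX => //; apply: Img_phi.
Qed.

Lemma Img_lin c v w : Img v -> Img w -> Img (c *: v + w).
Proof.
move=> [x xU ->] [y yU ->]; exists (c *: x + y); first exact: subalg_ZD.
by rewrite (hf_lin H).
Qed.
Lemma Img_vac : Img vac.
Proof. by exists 1; [apply: subalg_1 | rewrite (hf_1 H)]. Qed.
Lemma Img0 : Img 0.
Proof.
have := Img_lin (-1) Img_vac Img_vac.
by rewrite scaleN1r addNr.
Qed.
Lemma ImgD v w : Img v -> Img w -> Img (v + w).
Proof. by move=> vI; rewrite -[v]scale1r; apply: Img_lin. Qed.
Lemma ImgZ c v : Img v -> Img (c *: v).
Proof. by move=> vI; rewrite -[_ *: _]addr0; apply: Img_lin => //; apply: Img0. Qed.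
Lemma ImgB v w : Img v -> Img w -> Img (v - w).
Proof. by move=> vI wI; rewrite -scaleN1r; apply: ImgD => //; apply: ImgZ. Qed.
Lemma Img_X' j v : Img v -> Img (X' j v).
Proof.
move=> [x xU ->]; exists (x * eU s j); last by rewrite (hf_e H).
by apply: subalg_M => //; apply: Uh_e.
Qed.
Lemma Img_A u v : Img v -> Img (A u v).
Proof.
elim/Img_ind => [|c {}v w vI wI|{}v j _ vI].
- by rewrite /Aop Kop_vac; apply: ImgZ; apply: Img_vac.
- by rewrite linearP; apply: Img_lin.
- by rewrite Aop_X'; apply: ImgZ; apply: Img_X'.
Qed.
Lemma Yop_vac j : Y j vac = 0.
Proof. by rewrite /Yop Lop_vac Rop_vac !linear0 ?scaler0 ?subrr ?addr0. Qed.
Lemma Img_Y j v : Img v -> Img (Y j v).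
Proof.
elim/Img_ind => [|c {}v w vI wI|{}v l vJ vI].
- by rewrite Yop_vac; apply: Img0.
- by rewrite linearP; apply: Img_lin.
- have /eqP := Yop_X' q0 qn1 i0 j l v; rewrite subr_eq => /eqP ->.
  apply: ImgD; last exact: Img_X'.
  by apply/ImgZ/ImgB; apply: Img_A.
Qed.

Lemma Img_Gh g v : Img v -> Img (rend_fun (Gh s g) v).
Proof.
by case: g => [u|[j|j]] vI /=; first exact: Img_A; case: (s) => /=;
  do ?[exact: Img_X' | exact: Img_Y].
Qed.

Lemma Img_geval a v : Img v -> Img (rend_fun (geval (Gh s) a) v).
Proof.
move=> vI; rewrite /geval mmapE; apply: (big_ind (fun r : rend => Img (rend_fun r v))).
- exact: Img0.
- by move=> f g fI gI; apply: ImgD.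
- move=> m _; rewrite [X in rend_fun X](_ : _ = a@_m *: geval_mon (Gh s) m); last first.
    by rewrite /= mulr_algl.
  apply: ImgZ; rewrite /geval_mon.
  elim: (m : seq (gen D)) v vI => [|g w ih] v vI; first by rewrite big_nil.
  by rewrite big_cons; apply: ih; apply: Img_Gh.
Qed.

Lemma serre_X'_Img i j v : i != j -> Img v ->
  rend_fun (serre_poly (q_ q i) (mcartan i j) (rX q i) (rX q j)) v = 0.
Proof.
move=> ij [x xU ->].
(* [R a y] says that [a] is right multiplication by [y] seen through [phi]. It is compatible with
   the algebra operations, so the Serre polynomial in the [rX] corresponds to the one in U, which is
   0. *)
pose R (a : rend) (y : U) :=
  Uh s y /\ forall z, Uh s z -> rend_fun a (phi z) = phi (z * y).
have phi0 : phi 0 = 0.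
  have := hf_lin H (-1) xU xU; rewrite !scaleN1r !addNr. 
  by [].
have RX l : R (rX q l) (eU s l).
  by split; [apply: Uh_e | move=> z zU /=; rewrite (hf_e H)].
have R1 : R 1 1 by split; [apply: subalg_1 | move=> z zU; rewrite mulr1].
have RM a y c z : R a y -> R c z -> R (a * c) (y * z).
  move=> [yU ay] [zU cz]; split; first exact: subalg_M.
  by move=> t tU /=; rewrite ay // cz ?mulrA //; apply: subalg_M.
have RZ c a y : R a y -> R (c *: a) (c *: y).
  move=> [yU ay]; split; first exact: subalgZ.
  move=> t tU /=; rewrite ay // -scalerAr -[_ *: (_ * _)]addr0 (hf_lin H) ?phi0 ?addr0 //.
    exact: subalg_M.
  exact: subalg0.
have RD a y c z : R a y -> R c z -> R (a + c) (y + z).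
  move=> [yU ay] [zU cz]; split; first exact: subalgD.
  move=> t tU /=; rewrite ay // cz // mulrDr -[t * y]scale1r (hf_lin H) ?scale1r //; exact: subalg_M.
have RP a y n : R a y -> R (a ^+ n) (y ^+ n).
  by move=> ay; elim: n => [//|n ih]; rewrite !exprS; apply: RM.
have [_ ->] : R (serre_poly (q_ q i) (mcartan i j) (rX q i) (rX q j)) 0.
  rewrite -(serre_eU s ij) /serre_poly; apply: (big_ind2 R).
  - split; first exact: subalg0.
    by move=> z zU; rewrite mulr0 phi0.
  - by move=> *; apply: RD.
  - move=> r _; apply/RZ/RM; last exact/RZ/RP/RX.
    by apply: RM; [apply/RZ/RP/RX | apply: RX].
- by rewrite mulr0 phi0.
- by [].
Qed.

(** Up to a scalar this is a root string in the removals. It kills [vac] and commutes with every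
    [X' l], hence kills all that they generate from [vac]. *)
Lemma serre_Y_Img i j v : i != j -> Img v ->
  rend_fun (serre_poly (q_ q i) (mcartan i j) (rY q i0 i) (rY q i0 j)) v = 0.
Proof.
move=> ij; have ji : j != i by rewrite eq_sym.
set S := serre_poly _ _ _ _.
have b0 := bq_neq0 q0 (D := D); have bC := bqC q (D := D).
have Q := qrels_swap b0 (qrels_shuffle q0 qn1 i0).
have qi0 := q_neq0 q0 i.
have qin1 m : (0 < m)%N -> q_ q i ^+ m != 1 by exact: q_exp_neq1.
pose E := estring (rY q i0) (fun j => rA q i0 (- t_ j)) (fun j => rA q i0 (t_ j)) i j.
have [c ->] : exists c, S = c *: E (mcartan i j).+1.
  exists ((-1) ^+ (mcartan i j).+1 / qfact (q_ q i) (mcartan i j).+1).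
  rewrite /E (estringE Q qi0 qin1 (bq_ii q i) (bq_ij q ji) (leqnn _)).
  rewrite estring_sum_serre !scalerA mulrVK ?unitfE ?qfact_neq0 //.
  by rewrite -expr2 sqrr_sign scale1r.
move=> vI; rewrite [LHS](_ : _ = c *: rend_fun (E (mcartan i j).+1) v) //.
suff -> : rend_fun (E (mcartan i j).+1) v = 0 by rewrite scaler0.
have EX l : E (mcartan i j).+1 * rX q l = rX q l * E (mcartan i j).+1.
  exact: (estring_comm_f b0 bC Q qi0 qin1 ji (bq_ii q i) (bq_ij q ji)).
elim/Img_ind: vI => [|d {}v w vI wI|{}v l _ vI].
- elim: (_.+1) => [|m ih]; first exact: Yop_vac.
  rewrite /E estringS /Eop (cop_estring Q (bq_ii q i) (bq_ij q ji)).
  rewrite -scalerAl -scaleN1r scalerA.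
  set c1 : K := -1 * _; rewrite -[LHS]/(rend_fun (E m) (Y i vac) + c1 *: Y i (rend_fun (E m) vac)).
  by rewrite ih Yop_vac rend_fun0 linear0 scaler0 addr0.
- by rewrite rend_lin vI wI scaler0 addr0.
- have e : rend_fun (E (mcartan i j).+1) (X' l v) =
      X' l (rend_fun (E (mcartan i j).+1) v).
    exact: esym (congr1 (fun r : rend => rend_fun r v) (EX l)).
  by rewrite e vI linear0.
Qed.

Lemma geval_rel_Img r v : qea_rel q r -> Img v ->
  rend_fun (geval (Gh s) r) v = 0.
Proof.
have Q := qrels_shuffle q0 qn1 i0.
have Qs := qrels_swap (bq_neq0 q0 (D := D)) Q.
have subE (f g : rend) : rend_fun (f - g) v = rend_fun f v - rend_fun g v.
  by rewrite -[LHS]/(rend_fun f v + -1 *: rend_fun g v) scaleN1r.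
case=> [|u w|j u n un|j u n un|i j|i j ij|i j ij] vI.
- rewrite gevalB geval1 (geval_gen (Gh s) (inl 0)) subE /=.
  by case: (s); rewrite ?oppr0 Aop0 subrr.
- rewrite geval_mulB; have gg := geval_gen (Gh s); rewrite (gg (inl u)) (gg (inl w)) (gg (inl (u + w))) subE.
  by case: (s); rewrite [X in X - _](Aop_Aop q0) /= ?opprD subrr.
- rewrite geval_mul3B 3!geval_gen subE (alphaZ_eq un).
  case: (s).
    rewrite [X in X - _](Aop_X' _ _ _ _ (A u v)) Aop_Aop // subrr Aop0.
    by rewrite wtN /wt invr_expz opprK subrr.
  rewrite [X in X - _](Aop_Y q0 _ _ _ (A (- u) v)) Aop_Aop // opprK addNr Aop0.
  by rewrite /wt invr_expz opprK subrr.
- rewrite geval_mul3B 3!geval_gen subE (alphaZ_eq un).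
  case: (s).
    rewrite [X in X - _](Aop_Y q0 _ _ _ (A u v)) Aop_Aop // subrr Aop0.
    by rewrite wtN invrK /wt subrr.
  rewrite [X in X - _](Aop_X' _ _ _ _ (A (- u) v)) Aop_Aop // opprK addNr Aop0.
  by rewrite /wt subrr.
- rewrite geval_commB 4!geval_gen.
  suff -> : Gh s (inr (inl i)) * Gh s (inr (inr j)) -
     Gh s (inr (inr j)) * Gh s (inr (inl i)) =
     ((i == j)%:R / (q_ q i - (q_ q i)^-1)) *:
     (Gh s (inl (t_ i)) - Gh s (inl (- t_ i))) by rewrite subrr.
  have [->|ij] := eqVneq i j; case: (s) => /=.
  + by have := qr_ef Q j j; rewrite eqxx.
  + by have := qr_ef Qs j j; rewrite eqxx opprK.
  + by have := qr_ef Q j i; rewrite (negPf ij) !mul0r !scale0r.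
  + by have := qr_ef Qs j i; rewrite (negPf ij) !mul0r !scale0r.
- rewrite geval_serre !geval_gen; case: (s); first exact: serre_X'_Img.
  exact: serre_Y_Img.
- rewrite geval_serre !geval_gen; case: (s); last exact: serre_X'_Img.
  exact: serre_Y_Img.
Qed.

Lemma geval_ideal_Img r v : qea_ideal q r -> Img v ->
  rend_fun (geval (Gh s) r) v = 0.
Proof.
move=> rI; elim: rI v => {r} [r rR|| x y _ ihx _ ihy|a x c _ ih] v vI.
- exact: geval_rel_Img.
- by rewrite geval0.
- rewrite gevalB -[LHS]/(rend_fun _ v + -1 *: rend_fun _ v).
  by rewrite ihx // ihy // scaler0 addr0.
- rewrite !gevalM -[LHS]/(rend_fun _ (rend_fun _ (rend_fun _ v))).
  by rewrite ih ?rend_fun0 //; apply: Img_geval.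
Qed.

(* Right action of U; it is only meaningful on Img. *)
Definition act (y : U) (v : V) : V := rend_fun (geval (Gh s) (repr y)) v.

Lemma act_pi a v : Img v -> act (\pi_U a) v = rend_fun (geval (Gh s) a) v.
Proof.
move=> vI; rewrite /act; apply/eqP; rewrite -subr_eq0 -scaleN1r; apply/eqP.
have /UqP/geval_ideal_Img/(_ vI) : \pi_U (repr (\pi_U a)) = \pi_U a by rewrite reprK.
by rewrite gevalB.
Qed.

Lemma act_Img y v : Img v -> Img (act y v).
Proof. exact: Img_geval. Qed.
Lemma act_lin c y z v : Img v -> act (c *: y + z) v = c *: act y v + act z v.
Proof.
elim/quotW: y => y; elim/quotW: z => z vI.
by rewrite -Uq_piZ -Uq_piD !act_pi // geval_lin.
Qed.
Lemma act_mul y z v : Img v -> act (y * z) v = act z (act y v).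
Proof.
elim/quotW: y => y; elim/quotW: z => z vI.
by rewrite -Uq_piM !act_pi ?gevalM //; apply: Img_geval.
Qed.
Lemma act_1 v : Img v -> act 1 v = v.
Proof. by move=> vI; rewrite -Uq_pi1 act_pi // geval1. Qed.
Lemma act_linr c y v w : act y (c *: v + w) = c *: act y v + act y w.
Proof. exact: rend_lin. Qed.
Lemma act_e j v : Img v -> act (eU s j) v = X' j v.
Proof.
have -> : eU s j = \pi_U (if s then ge K j else gf K j) by rewrite /eU; case: s.
by move=> /act_pi ->; case: s; rewrite geval_gen.
Qed.
Lemma act_f j v : Img v -> act (fU s j) v = Y j v.
Proof.
have -> : fU s j = \pi_U (if s then gf K j else ge K j) by rewrite /fU; case: s.
by move=> /act_pi ->; case: s; rewrite geval_gen.
Qed.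
Lemma act_k u v : Img v -> act (kU s u) v = A u v.
Proof.
move=> /act_pi ->; rewrite geval_gen /=.
by case: s => //=; rewrite opprK.
Qed.
Lemma act_phi x : Uh s x -> act x vac = phi x.
Proof.
move=> xU; apply: (@subalg_ind_r K U (range (eU s)) (fun x => act x vac = phi x /\ Uh s x)
  _ _ _ x xU).1 => {x xU} [|c x y [ex xU] [ey yU]|x _ xU [ex _] [j _ <-]].
- by split; [rewrite (hf_1 H) act_1 //; apply: Img_vac | apply: subalg_1].
- split; last exact: subalg_ZD.
  by rewrite act_lin ?ex ?ey ?(hf_lin H) //; apply: Img_vac.
- split; last by apply: subalg_M => //; apply: Uh_e.
  rewrite act_mul ?ex ?act_e ?(hf_e H) //; do ?exact: Img_vac.
  exact: Img_phi.
Qed.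

End Module.
End HalfModule.

Section URelations.
Local Open Scope quotient_scope.
Variables (K : fieldType) (q : K) (q0 : q != 0) (D : datum).
Implicit Types (i j l : idx D) (u : lat D).
Local Notation U := (Uq q D).

Lemma Uq_piB (a c : free_alg K D) : \pi_U (a - c) = \pi_U a - \pi_U c.
Proof. exact: (amorB (g := pi U) (@Uq_pi_lin K q D)). Qed.
Lemma Uq_pi_commB (x y z t : free_alg K D) c :
  \pi_U (x * y - y * x - c *: (z - t)) =
  \pi_U x * \pi_U y - \pi_U y * \pi_U x - c *: (\pi_U z - \pi_U t).
Proof. exact: (amor_commB (g := pi U) (@Uq_pi_lin K q D) (@Uq_piM K q D)). Qed.

Lemma k_M u v : k_ q u * k_ q v = k_ q (u + v).
Proof.
have /eqP := Uq_pi_rel (rel_kM q u v).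
by rewrite Uq_piB subr_eq0 Uq_piM => /eqP.
Qed.
Lemma k_0 : k_ q (0 : lat D) = 1.
Proof.
have /eqP := Uq_pi_rel (rel_k0 q D).
by rewrite Uq_piB subr_eq0 => /eqP.
Qed.
Lemma k_e u j : k_ q u * e_ q j = q ^ alphaZ j u *: (e_ q j * k_ q u).
Proof.
have /eqP := Uq_pi_rel (rel_ke q (esym (alphaZE j u))).
rewrite Uq_piB subr_eq0 Uq_piZ !Uq_piM => /eqP /(congr1 (fun y => y * k_ q u)).
by rewrite -(mulrA _ (k_ q (- u))) k_M [- u + u]addNr k_0 mulr1 -scalerAl.
Qed.
Lemma k_f u j : k_ q u * f_ q j = q ^ (- alphaZ j u) *: (f_ q j * k_ q u).
Proof.
have /eqP := Uq_pi_rel (rel_kf q (esym (alphaZE j u))).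
rewrite Uq_piB subr_eq0 Uq_piZ !Uq_piM => /eqP /(congr1 (fun y => y * k_ q u)).
by rewrite -(mulrA _ (k_ q (- u))) k_M [- u + u]addNr k_0 mulr1 -scalerAl.
Qed.
Lemma ef_comm i j : e_ q i * f_ q j - f_ q j * e_ q i =
  ((i == j)%:R / dq q i) *: (k_ q (t_ i) - k_ q (- t_ i)).
Proof.
have := Uq_pi_rel (rel_ef q i j); rewrite Uq_pi_commB => /eqP.
by rewrite subr_eq0 => /eqP.
Qed.

Lemma qrels_U s : qrels (bq q) (dq q) (@eU K q D s) (fU q s)
  (fun j => kU q s (t_ j)) (fun j => kU q s (- t_ j)).
Proof.
have R : qrels (bq q) (dq q) (e_ q (D := D)) (f_ q (D := D))
    (fun j => k_ q (t_ j)) (fun j => k_ q (- t_ j)).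
  split=> [j|j|j l|j l|j l].
  - by rewrite k_M subrr k_0.
  - by rewrite k_M addNr k_0.
  - by rewrite k_e alphaZ_t.
  - by rewrite k_f alphaZ_t /bq invr_expz.
  - rewrite ef_comm; have [->|_] := eqVneq l j; first by [].
    by rewrite !mul0r !scale0r.
rewrite /eU /fU /kU; case: s => //.
have := qrels_swap (bq_neq0 q0 (D := D)) R.
rewrite [X in qrels _ _ _ _ _ X -> _](_ : _ = (fun j : idx D => k_ q (- - t_ j))) //.
by apply/funext => j; rewrite opprK.
Qed.

End URelations.

(** * The braid operator on one half *)

Section HalfTransport.
Variables (K : fieldType) (q : K).
Hypotheses (q0 : q != 0) (qn1 : forall m, (0 < m)%N -> q ^+ m != 1).
Variables (D : datum) (i : idx D).
Variables (U : algType K) (e f k kv : idx D -> U).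
Hypothesis R : qrels (bq q) (dq q) e f k kv.
Local Notation V := (seq (idx D) -> K^o).
Local Notation Uh := (subalg (range e)).
Local Notation c := (cop (k i) (kv i)).
Local Notation cv := (cop (kv i) (k i)).
Local Notation E := (Eop (e i) (k i) (kv i)).
Local Notation E' := (Eop' (e i) (k i) (kv i)).
Local Notation F := (Fop (f i) (k i)).
Local Notation Dp := (Dop (f i) (kv i)).
Local Notation estr := (estring e k kv i).
Local Notation x := (q_ q i).
Local Notation b := (bq q).
Local Notation n_ j := (mcartan i j).

Let x0 := q_neq0 q0 i.
Let xn1 m : (0 < m)%N -> x ^+ m != 1. Proof. exact: q_exp_neq1. Qed.
Let b0 := bq_neq0 q0 (D := D).
Let bC := bqC q (D := D).
Let kkv := qr_kkv R i.
Let kvk := qr_kvk R i.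
Let xx0 : x ^+ 2 != 0. Proof. by rewrite expf_neq0. Qed.
Let ke : k i * e i = x ^+ 2 *: (e i * k i).
Proof. by rewrite (qr_ke R) bq_ii. Qed.
Let kf : k i * f i = (x ^+ 2)^-1 *: (f i * k i).
Proof. by rewrite (qr_kf R) bq_ii. Qed.
Let ef := qr_ef1 R i.

(* Up to the radical of the pairing, the intersection of the half generated by
   the e j with its inverse image under T. *)
Inductive Bs : U -> Prop :=
| Bs_1 : Bs 1
| Bs_lin a y z : Bs y -> Bs z -> Bs (a *: y + z)
| Bs_e y j : j != i -> Bs y -> Bs (y * e j)
| Bs_E y : Bs y -> Bs (E' y).

Lemma Uh_gen j : Uh (e j).
Proof. by apply: subalg_gen; exists j. Qed.

Lemma Uh_c y : Uh y -> Uh (c y).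
Proof.
elim/(@subalg_ind_r K U (range e)) => [|a {}y z yU zU|{}y _ _ yU [j _ <-]].
- by rewrite (cop1 kkv); apply: subalg_1.
- by rewrite linearP; apply: subalg_ZD.
- rewrite (copM kvk) (cop_ej R) -scalerAr; apply/subalgZ/subalg_M => //.
  exact: Uh_gen.
Qed.
Lemma Uh_cv y : Uh y -> Uh (cv y).
Proof.
elim/(@subalg_ind_r K U (range e)) => [|a {}y z yU zU|{}y _ _ yU [j _ <-]].
- by rewrite (cop1 kvk); apply: subalg_1.
- by rewrite linearP; apply: subalg_ZD.
- rewrite (copM kkv) (copV_ej b0 R) -scalerAr; apply/subalgZ/subalg_M => //.
  exact: Uh_gen.
Qed.

Lemma Bs0 : Bs 0.
Proof. by have := Bs_lin (-1) Bs_1 Bs_1; rewrite scaleN1r addNr. Qed.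
Lemma BsD y z : Bs y -> Bs z -> Bs (y + z).
Proof. by move=> yB; rewrite -[y]scale1r; apply: Bs_lin. Qed.
Lemma BsZ a y : Bs y -> Bs (a *: y).
Proof. by move=> yB; rewrite -[_ *: _]addr0; apply: Bs_lin => //; apply: Bs0. Qed.
Lemma BsB y z : Bs y -> Bs z -> Bs (y - z).
Proof. by move=> yB zB; rewrite -scaleN1r; apply/BsD/BsZ. Qed.

Lemma Bs_c y : Bs y -> Bs (c y).
Proof.
elim=> {y} [|a y z _ yB _ zB|y j ji _ yB|y _ yB].
- by rewrite (cop1 kkv); apply: Bs_1.
- by rewrite linearP; apply: Bs_lin.
- by rewrite (copM kvk) (cop_ej R) -scalerAr; apply/BsZ/Bs_e.
- by rewrite (cop_E' kkv kvk ke); apply/BsZ/Bs_E.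
Qed.

Lemma Bs_Uh y : Bs y -> Uh y.
Proof.
elim=> {y} [|a y z _ yU _ zU|y j ji _ yU|y _ yU].
- exact: subalg_1.
- exact: subalg_ZD.
- by apply: subalg_M => //; apply: Uh_gen.
- by apply: subalgB; apply: subalg_M => //; do ?[exact: Uh_gen | exact: Uh_c].
Qed.

Lemma Dop_mul_e y j : j != i -> Dp (y * e j) = b i j *: (Dp y * e j).
Proof.
move=> ji; rewrite /Dop.
have -> : y * e j * f i = y * f i * e j by rewrite -mulrA (qr_comm R ji) mulrA.
have ekv : e j * kv i = b i j *: (kv i * e j).
  by rewrite (qr_kve b0 R) scalerA mulfV // scale1r.
by rewrite mulrA -mulrBl -[LHS]mulrA ekv -scalerAr mulrA.
Qed.

Lemma Bs_D y : Bs y -> Bs (Dp y).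
Proof.
elim=> {y} [|a y z _ yB _ zB|y j ji _ yB|y yB' yB].
- by rewrite /Dop mulr1 mul1r subrr mul0r; apply: Bs0.
- by rewrite linearP; apply: Bs_lin.
- by rewrite Dop_mul_e //; apply/BsZ/Bs_e.
- rewrite (Dop_Eop' xx0 kkv kvk ke kf ef); apply: BsD; first exact/BsZ/Bs_E.
  by apply/BsZ/BsB => //; do 2!apply: Bs_c.
Qed.

(** Sums of e_i^n b_n in Horner form. *)
Inductive Bs_poly : U -> Prop :=
| Bs_poly0 : Bs_poly 0
| Bs_polyS y z : Bs y -> Bs_poly z -> Bs_poly (y + e i * z).

Lemma Bs_poly_lin a y z : Bs_poly y -> Bs_poly z -> Bs_poly (a *: y + z).
Proof.
move=> yP; elim: yP z => {y} [|y y' yB y'P ih] z; first by rewrite scaler0 add0r.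
case=> {z} [|z z' zB z'P].
  rewrite addr0 scalerDr scalerAr -[a *: y' in X in Bs_poly X]addr0.
  by apply: Bs_polyS; [apply: BsZ | apply: ih; apply: Bs_poly0].
rewrite scalerDr addrACA scalerAr -mulrDr; apply: Bs_polyS; last exact: ih.
exact: Bs_lin.
Qed.

Lemma Bs_poly_Bs y : Bs y -> Bs_poly y.
Proof. by move=> yB; rewrite -[y]addr0 -(mulr0 (e i)); apply/Bs_polyS/Bs_poly0. Qed.

Lemma Uh_Bs_poly y : Uh y -> Bs_poly y.
Proof.
elim/(@subalg_ind_r K U (range e)) => [|a {}y z yP zP|{}y _ _ yP [j _ <-]].
- exact/Bs_poly_Bs/Bs_1.
- exact: Bs_poly_lin.
have [->|ji] := eqVneq j i; elim: yP => {y} [|y z yB zP ih]; rewrite ?mul0r.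
- exact: Bs_poly0.
(* The factor [e i] is moved to the left by y e_i = E'(y) + e_i c(y), and both E'(y) and c(y) are
   again in [Bs]. *)
- have -> : (y + e i * z) * e i = E' y + e i * (1 *: c y + z * e i).
    by rewrite scale1r mulrDl mulrDr mulrA /Eop' addrA subrK.
  by apply: Bs_polyS; [apply: Bs_E | apply/Bs_poly_lin/ih/Bs_poly_Bs/Bs_c].
- exact: Bs_poly0.
- by rewrite mulrDl -mulrA; apply/Bs_polyS/ih/Bs_e.
Qed.

Lemma Uh_sum_Bs y : Uh y -> exists N (g : nat -> U),
  (forall n, Bs (g n)) /\ y = \sum_(n < N.+1) e i ^+ n * g n.
Proof.
move/Uh_Bs_poly; elim=> {y} [|y z yB _ [N [g [gB ->]]]].
  exists 0%N, (fun=> 0); split; first by move=> _; apply: Bs0.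
  by rewrite big_ord1 mulr0.
exists N.+1, (fun n => if n is m.+1 then g m else y); split; first by case.
rewrite [RHS]big_ord_recl expr0 mul1r mulr_sumr; congr (_ + _).
by apply: eq_bigr => n _; rewrite /= /bump /= add1n exprS mulrA.
Qed.

Lemma estring_Uh j m : Uh (estr j m).
Proof.
elim: m => [|m ih]; first exact: Uh_gen.
rewrite estringS; apply: subalgB; apply: subalg_M => //; first exact: Uh_gen.
  exact: Uh_c.
exact: Uh_gen.
Qed.

(** * Images under T, with scalars [zeta] that distinguish the two halves *)

Section Braid.
Variables (T : {lrmorphism U -> U}) (zeta : idx D -> K).
Hypothesis zeta_i0 : zeta i != 0.
Hypotheses (T_k : T (k i) = kv i) (T_kv : T (kv i) = k i).
Hypothesis T_ei : T (e i) = - (zeta i *: (f i * k i)).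
Hypothesis T_ej : forall j, j != i ->
  T (e j) = (zeta j / qfact x (n_ j)) *: estr j (n_ j).

Let TM y z : T (y * z) = T y * T z := rmorphM T y z.
Let TB y z : T (y - z) = T y - T z := rmorphB T y z.
Let TP a y z : T (a *: y + z) = a *: T y + T z := linearP T a y z.

Lemma T_c y : T (c y) = cv (T y).
Proof. by rewrite /cop !TM T_k T_kv. Qed.
Lemma T_E' y : T (E' y) = zeta i *: F (T y).
Proof.
have kc z : k i * cv z = z * k i by rewrite /cop !mulrA kkv mul1r.
rewrite /Eop' TB (TM y) (TM (e i)) T_c T_ei !(mulrN, mulNr) -scalerAr -scalerAl opprK.
by rewrite -[f i * k i * _]mulrA kc !mulrA /Fop mulrBl; lmod K.
Qed.

(** Membership of T(y) in [Uh] is too weak for an induction over [Bs]: T(E' y) is a multiple of F(T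
    y), and F does not preserve [Uh]. All iterates are therefore controlled at once. *)
Definition Fstable y := forall m, Uh (iter m F y).

Lemma F_iter_lin m : linear (iter m F).
Proof. by elim: m => [//|m ih] a y z; rewrite !iterS ih linearP. Qed.

Lemma F_iter0 m : iter m F 0 = 0.
Proof.
have := F_iter_lin m (-1) 1 1; rewrite scaleN1r addNr => ->.
by rewrite scaleN1r addNr.
Qed.
Lemma Fstable0 : Fstable 0.
Proof. by move=> m; rewrite F_iter0; apply: subalg0. Qed.

Lemma Fstable_lin a y z : Fstable y -> Fstable z -> Fstable (a *: y + z).
Proof. by move=> yS zS m; rewrite F_iter_lin; apply: subalg_ZD. Qed.
Lemma Fstable_F y : Fstable y -> Fstable (F y).
Proof. by move=> yS m; rewrite -iterSr. Qed.
Lemma Fstable_cv y : Fstable y -> Fstable (cv y).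
Proof.
move=> yS m; suff [a ->] : exists a, iter m F (cv y) = a *: cv (iter m F y).
  exact/subalgZ/Uh_cv.
elim: m => [|m [a ih]]; first by exists 1; rewrite scale1r.
exists (a / (x ^+ 2)); rewrite !iterS ih linearZ.
rewrite (copV_F xx0 kkv kvk kf) scalerA /=.
by rewrite divfK.
Qed.
(** [Fop] is a derivation twisted by [cv], so the induction on the number of applications has to let
    both factors vary. *)
Lemma Fstable_mul y z : Fstable y -> Fstable z -> Fstable (y * z).
Proof.
move=> yS zS m; elim: m y z yS zS => [|m ih] y z yS zS.
  by apply: subalg_M; [apply: (yS 0%N) | apply: (zS 0%N)].
rewrite iterSr (Fop_mul _ kkv) -[y * F z]scale1r F_iter_lin.
apply: subalg_ZD; apply: ih => //; do ?exact: Fstable_F.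
exact: Fstable_cv.
Qed.
Lemma Fstable_estring j m : j != i -> Fstable (estr j m).
Proof.
move=> ji p; elim: p m => [|p ih] m; first exact: estring_Uh.
rewrite iterSr; case: m => [|m].
  by rewrite (Fop_estring0 R ji); apply: Fstable0.
have [a ->] := Fop_estringS R x0 ji (bq_ii q i) (bq_ij q ji) m.
rewrite -[a *: _]addr0 F_iter_lin; apply: subalg_ZD; first exact: ih.
exact: Fstable0.
Qed.

Lemma T_Bs_Fstable y : Bs y -> Fstable (T y).
Proof.
elim=> {y} [|a y z _ yS _ zS|y j ji _ yS|y _ yS].
- rewrite rmorph1 => -[|m]; first exact: subalg_1.
  rewrite iterSr /Fop mulr1 mul1r subrr mul0r.
  exact: Fstable0.
- by rewrite TP; apply: Fstable_lin.
- rewrite TM T_ej // -scalerAr -[_ *: _]addr0; apply: Fstable_lin.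
    by apply: Fstable_mul => //; apply: Fstable_estring.
  exact: Fstable0.
- rewrite T_E' -[_ *: _]addr0; apply: Fstable_lin; first exact: Fstable_F.
  exact: Fstable0.
Qed.

Lemma T_Bs_Uh y : Bs y -> Uh (T y).
Proof. by move=> yB; apply: (T_Bs_Fstable yB 0%N). Qed.

Local Notation X := (Xop b (tq q (D:=D))).
Local Notation X' := (Xop' b (tq q (D:=D))).
Local Notation vac := (vac K (I := idx D)).

(** The properties of a half and of its action on functions used from here on, stated for arbitrary
    families [e], [f], [k], [kv] so that the halves can be exchanged. *)
Record half_module (Img : V -> Prop) (phi : U -> V) (act : U -> V -> V) : Prop := {
  hm_lin : forall a y z, Uh y -> Uh z -> phi (a *: y + z) = a *: phi y + phi z;
  hm_1 : phi 1 = vac;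
  hm_e : forall y j, Uh y -> phi (y * e j) = X' j (phi y);
  hm_Img : forall y, Uh y -> Img (phi y);
  hm_act_Img : forall y v, Img v -> Img (act y v);
  hm_act_lin : forall a y z v, Img v ->
    act (a *: y + z) v = a *: act y v + act z v;
  hm_act_linr : forall a y v w, act y (a *: v + w) = a *: act y v + act y w;
  hm_act_mul : forall y z v, Img v -> act (y * z) v = act z (act y v);
  hm_act_f : forall j v, Img v -> act (f j) v = Yop q i j v;
  hm_act_k : forall j v, Img v -> act (k j) v = Aop q i (t_ j) v;
  hm_act_kv : forall j v, Img v -> act (kv j) v = Aop q i (- t_ j) v;
  hm_act_phi : forall y z, Uh y -> Uh z -> act z (phi y) = phi (y * z)
}.

(** * Word functions of elements of [Bs] and of their images *)

Section Form.
Variables (Img : V -> Prop) (phi : U -> V) (act : U -> V -> V).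
Hypothesis H : half_module Img phi act.

Lemma phi0 : phi 0 = 0.
Proof.
have := hm_lin H (-1) (subalg_1 _) (subalg_1 _).
by rewrite !scaleN1r !addNr.
Qed.
Lemma phiZ a y : Uh y -> phi (a *: y) = a *: phi y.
Proof.
move=> yU; have := hm_lin H a yU (subalg0 _).
by rewrite phi0 !addr0.
Qed.
Lemma phiB y z : Uh y -> Uh z -> phi (y - z) = phi y - phi z.
Proof.
by move=> yU zU; rewrite addrC -scaleN1r (hm_lin H) // scaleN1r addrC.
Qed.

(** The operator [X j] commutes with every [X' l] and agrees with [X' j] on [vac], so the rule for
    right multiplication determines the one on the left. *)
Lemma phi_left j y : Uh y -> phi (e j * y) = X j (phi y).
Proof.
move=> yU; suff [] : phi (e j * y) = X j (phi y) /\ Uh y by [].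
apply: (@subalg_ind_r K U (range e)
  (fun y => phi (e j * y) = X j (phi y) /\ Uh y) _ _ _ y yU) =>
  {y yU} [|a y z [ey yU] [ez zU]|y _ _ [ey yU] [l _ <-]]; split.
- by rewrite mulr1 -[e j]mul1r (hm_e H) ?(hm_1 H) ?Xop_vac //; apply: subalg_1.
- exact: subalg_1.
- rewrite mulrDr -scalerAr !(hm_lin H) ?ey ?ez ?linearP //.
  + by apply: subalg_M => //; apply: Uh_gen.
  + by apply: subalg_M => //; apply: Uh_gen.
- exact: subalg_ZD.
- rewrite mulrA !(hm_e H) // ?ey; last by apply: subalg_M => //; apply: Uh_gen.
  by rewrite (Xop_Xop' bC (@tq_diag _ _ _)).
- by apply: subalg_M => //; apply: Uh_gen.
Qed.

Lemma phi_c y : Uh y -> phi (c y) = Kop (b i) (phi y).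
Proof.
move=> yU; suff [] : phi (c y) = Kop (b i) (phi y) /\ Uh y by [].
apply: (@subalg_ind_r K U (range e)
  (fun y => phi (c y) = Kop (b i) (phi y) /\ Uh y) _ _ _ y yU) =>
  {y yU} [|a y z [ey yU] [ez zU]|y _ _ [ey yU] [l _ <-]]; split.
- by rewrite (cop1 kkv) (hm_1 H) Kop_vac.
- exact: subalg_1.
- by rewrite !linearP /= !(hm_lin H) ?ey ?ez ?linearP //; apply: Uh_c.
- exact: subalg_ZD.
- have cyU := Uh_c yU; have ceU : Uh (c y * e l) by apply: subalg_M => //; apply: Uh_gen.
  rewrite (copM kvk) (cop_ej R) -scalerAr phiZ // !(hm_e H) // ey.
  by rewrite (Kop_Xop' _ (@tq_diag _ _ _)).
- by apply: subalg_M => //; apply: Uh_gen.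
Qed.

Lemma phi_E' y : Uh y -> phi (E' y) = X' i (phi y) - X i (Kop (b i) (phi y)).
Proof.
move=> yU; have cyU := Uh_c yU.
rewrite /Eop' phiB ?(hm_e H) ?phi_left ?phi_c //; apply: subalg_M => //; exact: Uh_gen.
Qed.

(** In [E'] the two terms bring the letter [i] to the front with the same coefficient, [t i i] times
    the twist [Kop (b i)], and these contributions cancel. *)
Lemma Lop_phi_Bs y : Bs y -> Lop i (phi y) = 0.
Proof.
elim=> {y} [|a y z /Bs_Uh yU y0 /Bs_Uh zU z0|y j ji /Bs_Uh yU y0|y /Bs_Uh yU y0].
- by rewrite (hm_1 H) Lop_vac.
- by rewrite (hm_lin H) // LopD LopZ y0 z0 scaler0 addr0.
- rewrite (hm_e H) // Lop_Xop' y0 linear0 add0r /tq (negPf ji) mul0r oppr0.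
  by rewrite scale0r.
- rewrite phi_E' // LopD LopN Lop_Xop' Lop_Xop Lop_Kop y0.
  by rewrite !linear0 ?scaler0 ?add0r subrr.
Qed.

(** Right multiplication by the root string: the recursion is that of [Eop], with the conjugate of
    the string replaced by its eigenvalue. *)
Fixpoint Gop j m (v : V) : V :=
  if m is m'.+1 then
    Gop j m' (X' i v) - (x ^+ (m' + m') / x ^+ n_ j) *: X' i (Gop j m' v)
  else X' j v.

Lemma phi_estring j m y : j != i -> Uh y -> phi (y * estr j m) = Gop j m (phi y).
Proof.
move=> ji; elim: m y => [|m ih] y yU; first by rewrite estring0 (hm_e H).
have yeU : Uh (y * e i) by apply: subalg_M => //; apply: Uh_gen.
have ysU : Uh (y * estr j m) by apply: subalg_M => //; apply: estring_Uh.
rewrite estringS /Eop (cop_estring R (bq_ii q i) (bq_ij q ji)).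
rewrite mulrBr mulrA -scalerAl -scalerAr mulrA phiB ?phiZ ?(hm_e H) ?ih ?(hm_e H) //.
- by apply: subalg_M => //; apply: Uh_gen.
- by apply: subalg_M => //; apply: estring_Uh.
- by apply/subalgZ/subalg_M => //; apply: Uh_gen.
Qed.

Lemma Gop_lin j m : linear (Gop j m).
Proof.
elim: m => [|m ih] a v w /=; first by rewrite linearP.
by rewrite linearP !ih linearP /=; lmod K.
Qed.

Lemma GopZ j m a v : Gop j m (a *: v) = a *: Gop j m v.
Proof.
have G0 : Gop j m 0 = 0.
  by have := Gop_lin j m (-1) 0 0; rewrite scaler0 addr0 scaleN1r addNr.
by rewrite -[a *: v]addr0 Gop_lin G0 addr0.
Qed.

Lemma Rop_Gop j m v : j != i ->
  Rop i (Gop j m v) = (x ^+ (m + m) / x ^+ n_ j) *: Gop j m (Rop i v).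
Proof.
move=> ji; elim: m v => [|m ih] v /=.
  rewrite Rop_Xop' /tq (negPf ji) mul0r oppr0 scale0r addr0 bqC bq_ij //.
  by rewrite mul1r.
rewrite RopD RopN RopZ ih !Rop_Xop' ih !Xop'Z Gop_lin GopZ bq_ii addSn addnS !exprS.
have v0 := expf_neq0 (n_ j) x0.
by lmod K.
Qed.

Local Notation Y := (Yop q i i).
Local Notation A := (Aop q i).

Let Img_vac : Img vac. Proof. by rewrite -(hm_1 H); apply/(hm_Img H)/subalg_1. Qed.

Lemma act0 y : act y 0 = 0.
Proof.
have := hm_act_linr H (-1) y 0 0.
by rewrite scaler0 addr0 scaleN1r addNr.
Qed.
Lemma actZr y a v : act y (a *: v) = a *: act y v.
Proof. by have := hm_act_linr H a y v 0; rewrite act0 !addr0. Qed.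
Lemma actD y z v : Img v -> act (y + z) v = act y v + act z v.
Proof. by move=> vI; have := hm_act_lin H 1 y z vI; rewrite !scale1r. Qed.
Lemma act0l v : Img v -> act 0 v = 0.
Proof.
by move=> vI; have := hm_act_lin H (-1) 0 0 vI; rewrite scaler0 addr0 scaleN1r addNr.
Qed.
Lemma actZ a y v : Img v -> act (a *: y) v = a *: act y v.
Proof.
by move=> vI; have := hm_act_lin H a y 0 vI; rewrite act0l // !addr0.
Qed.

Lemma act_vac y : Uh y -> act y vac = phi y.
Proof.
by move=> yU; rewrite -(hm_1 H) (hm_act_phi H) ?mul1r //; apply: subalg_1.
Qed.

Lemma act_commutator y : Uh y -> act (f i * y - y * f i) vac = - Y (phi y).
Proof.
move=> yU; rewrite actD // -scaleN1r actZ // !(hm_act_mul H) // (hm_act_f H) //.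
rewrite Yop_vac act0 add0r act_vac // (hm_act_f H) ?scaleN1r //.
exact: hm_Img H _ yU.
Qed.

Let chi_b : chi q i (t_ i) = (b i i)^-1.
Proof. by rewrite /chi alphaZ_t invr_expz. Qed.

(** When no word ends in [i], only the first-letter part of [Yop] survives, and the final [k i] in
    [Fop] cancels its scalar [chi]. *)
Lemma phi_F z : Uh z -> Uh (F z) -> Rop i (phi z) = 0 ->
  phi (F z) = - Kop (wt q (t_ i)) (Lop i (phi z)).
Proof.
move=> zU FzU Rz; rewrite -act_vac // /Fop (hm_act_mul H) // (hm_act_k H); last first.
  exact: (hm_act_Img H).
rewrite act_commutator // /Yop Rz linear0 scaler0 subr0 /Aop linearN linearZ /=.
by rewrite scalerN scalerA mulfV ?scale1r // chi_neq0.
Qed.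

(** Here the first-letter part of [Yop] vanishes, and the final [kv i] in [Dop] cancels both the
    scalar and the weight twist of the other part. *)
Lemma phi_D y : Bs y -> phi (Dp y) = Rop i (phi y).
Proof.
move=> yB; have yU := Bs_Uh yB; have DU := Bs_Uh (Bs_D yB).
rewrite -act_vac // /Dop (hm_act_mul H) // (hm_act_kv H); last exact: (hm_act_Img H).
rewrite act_commutator // /Yop Lop_phi_Bs // scaler0 sub0r opprK /Aop KopZ scalerA.
rewrite chiN mulVf ?chi_neq0 // scale1r Kop_Kop Kop_one // => l.
by rewrite wtN mulVf // wt_neq0.
Qed.

Lemma Rop_phi_T_Bs y : Bs y -> Rop i (phi (T y)) = 0.
Proof.
elim=> {y} [|a y z yB y0 zB z0|y j ji yB y0|y yB y0].
- by rewrite rmorph1 (hm_1 H) Rop_vac.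
- rewrite TP (hm_lin H) ?RopD ?RopZ ?y0 ?z0 ?scaler0 ?addr0 //; exact: T_Bs_Uh.
- have TyU := T_Bs_Uh yB.
  rewrite TM T_ej // -scalerAr phiZ; last by apply: subalg_M => //; apply: estring_Uh.
  by rewrite RopZ phi_estring // Rop_Gop // y0 -(scale0r (0 : V)) GopZ !scale0r !scaler0.
- have FU : Uh (F (T y)) := T_Bs_Fstable yB 1%N.
  rewrite T_E' phiZ // RopZ phi_F //; last exact: T_Bs_Uh.
  by rewrite RopN Rop_Kop -Lop_Rop y0 !linear0.
Qed.

Lemma phi_T_E' y : Bs y ->
  phi (T (E' y)) = - zeta i *: Kop (wt q (t_ i)) (Lop i (phi (T y))).
Proof.
move=> yB; have FU : Uh (F (T y)) := T_Bs_Fstable yB 1%N.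
by rewrite T_E' phiZ // phi_F ?scalerN ?scaleNr //; [apply: T_Bs_Uh | apply: Rop_phi_T_Bs].
Qed.

Let theta m : V := phi (e i ^+ m).
Let eXU m : Uh (e i ^+ m). Proof. exact/subalgX/Uh_gen. Qed.
Let theta_Img m : Img (theta m). Proof. exact: hm_Img H _ (eXU m). Qed.
Let thetaS m : theta m.+1 = X' i (theta m).
Proof. by rewrite /theta exprSr (hm_e H). Qed.
Let theta0 : theta 0 = vac. Proof. exact: hm_1 H. Qed.

Let act1 m : act 1 (theta m) = theta m.
Proof. by rewrite (hm_act_phi H) ?mulr1 //; apply: subalg_1. Qed.

Lemma Aop_theta m : A (t_ i) (theta m) = x ^- (m.+1 + m.+1) *: theta m.
Proof.
elim: m => [|m ih].
  by rewrite theta0 /Aop Kop_vac chi_b bq_ii.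
rewrite thetaS Aop_X' ih Xop'Z scalerA wt_t bq_ii; congr (_ *: _).
by rewrite -invfM -exprD; congr (_ ^- _); lia.
Qed.
Lemma AopN_theta m : A (- t_ i) (theta m) = x ^+ (m.+1 + m.+1) *: theta m.
Proof.
have e0 : x ^+ (m.+1 + m.+1) != 0 by rewrite expf_neq0.
rewrite -[theta m in LHS](scalerKV e0).
have <- := Aop_theta m; rewrite AopZ (Aop_Aop q0) subrr Aop0.
by [].
Qed.

(** Moving the removal past m + 1 insertions adds the weights [2], [4], ..., [2m + 2] with a minus
    sign, and their sum is [m + 1][m + 2]. *)
Lemma Yop_theta m : Y (theta m.+1) = - (qint x m.+1 * qint x m.+2) *: theta m.
Proof.
have yx v : Y (X' i v) = X' i (Y v) + (dq q i)^-1 *: (A (t_ i) v - A (- t_ i) v).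
  by have /eqP := Yop_X' q0 qn1 i i i v; rewrite subr_eq eqxx mul1r addrC => /eqP.
elim: m => [|m ih].
  rewrite thetaS yx theta0 Yop_vac linear0 add0r -theta0 Aop_theta AopN_theta.
  rewrite -scalerBl scalerA; congr (_ *: _); rewrite /qint /dq !exprS expr0.
  have := qint_den_neq0 x0 xn1; move: (x) x0 => z z0 dz.
  have dz' : z * z - 1 != 0.
    by move: dz; apply: contra_neq => E1; rewrite -[z - _](mulfK z0) mulrBl mulVf // E1 mul0r.
  by field; rewrite ?z0 ?dz'.
rewrite thetaS yx ih Xop'Z -thetaS Aop_theta AopN_theta -scalerBl scalerA -scalerDl.
congr (_ *: _); rewrite /qint /dq !(addSn, addnS) !exprS !exprD.
have := expf_neq0 m x0; have := qint_den_neq0 x0 xn1.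
move: (x) (x ^+ m) x0 => z u z0 dz u0.
have dz' : z * z - 1 != 0.
  by move: dz; apply: contra_neq => E1; rewrite -[z - _](mulfK z0) mulrBl mulVf // E1 mul0r.
by field; rewrite ?z0 ?dz' ?u0.
Qed.

Lemma act_T_theta0 : act (T (e i)) (theta 0) = 0.
Proof.
rewrite T_ei -scaleNr actZ // (hm_act_mul H) // (hm_act_f H) // theta0 Yop_vac act0.
by rewrite scaler0.
Qed.
Lemma act_T_thetaS m : exists2 a, a != 0 & act (T (e i)) (theta m.+1) = a *: theta m.
Proof.
exists (- zeta i * (- (qint x m.+1 * qint x m.+2) * x ^- (m.+1 + m.+1))).
  have y0 := mulf_neq0 (qint_neq0 x0 xn1 (ltn0Sn m)) (qint_neq0 x0 xn1 (ltn0Sn m.+1)).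
  apply: mulf_neq0; rewrite ?oppr_eq0 //; apply: mulf_neq0; rewrite ?oppr_eq0 //.
  by rewrite invr_eq0 expf_neq0.
rewrite T_ei -scaleNr actZ // (hm_act_mul H) // (hm_act_f H) // Yop_theta actZr.
by rewrite (hm_act_k H) // Aop_theta !scalerA !mulrA.
Qed.

Lemma act_TX_theta n m : (n <= m)%N ->
  exists2 a, a != 0 & act (T (e i) ^+ n) (theta m) = a *: theta (m - n).
Proof.
elim: n => [|n ih] nm.
  exists 1; first exact: oner_neq0.
  by rewrite expr0 subn0 act1 scale1r.
have [a a0 ea] := ih (ltnW nm); have [a' a0' ea'] := act_T_thetaS (m - n.+1).
exists (a * a'); first exact: mulf_neq0.
rewrite exprSr (hm_act_mul H) // ea actZr -[(m - n)%N](subnSK nm) ea' scalerA.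
by [].
Qed.

Lemma act_TX_theta_lt n m : (m < n)%N -> act (T (e i) ^+ n) (theta m) = 0.
Proof.
move=> mn; have -> : n = (m + (1 + (n - m.+1)))%N by lia.
have [a _ ea] := act_TX_theta (leqnn m).
rewrite !exprD (hm_act_mul H) // ea subnn actZr (hm_act_mul H) // expr1.
by rewrite act_T_theta0 act0 scaler0.
Qed.

Lemma act_sum N (g : nat -> U) v : Img v ->
  act (\sum_(n < N) g n) v = \sum_(n < N) act (g n) v.
Proof.
move=> vI; elim: N => [|N ih]; first by rewrite !big_ord0 act0l.
by rewrite !big_ord_recr actD //= ih.
Qed.

Lemma act_theta m z : Uh z -> act z (theta m) = iter m (X i) (phi z).
Proof.
move=> zU; rewrite (hm_act_phi H) //; elim: m => [|m ih]; first by rewrite mul1r.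
by rewrite exprS -mulrA phi_left ?ih //; apply: subalg_M.
Qed.

Lemma iterX0 m : iter m (X i) 0 = 0.
Proof. by elim: m => [//|m ih]; rewrite iterS ih linear0. Qed.

(** Acting on [theta m], the element T(y) gives X_i^m applied to phi(T y), whereas the summand of
    index n gives 0 if n > m and a nonzero multiple of phi(T(g n)), shuffled m - n times with i,
    otherwise. For m = 0 this is the claim on g 0. For m > 0 the term n = 0 equals the left side,
    those with 0 < n < m vanish by induction, and the term n = m must be 0. *)
Lemma transport_decomposition y : Uh y -> Uh (T y) ->
  exists N (g : nat -> U), [/\ forall n, Bs (g n),
    y = \sum_(n < N.+1) e i ^+ n * g n, phi (T y) = phi (T (g 0%N))
    & forall n, (0 < n <= N)%N -> phi (T (g n)) = 0].
Proof.
move=> yU TyU; have [N [g [gB ey]]] := Uh_sum_Bs yU.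
have Tg n : Uh (T (g n)) by apply: T_Bs_Uh.
have eTy : T y = \sum_(n < N.+1) T (e i) ^+ n * T (g n).
  by rewrite ey rmorph_sum; apply: eq_bigr => n _; rewrite rmorphM rmorphXn.
have act_term n m : act (T (e i) ^+ n * T (g n)) (theta m) =
    act (T (g n)) (act (T (e i) ^+ n) (theta m)) by rewrite (hm_act_mul H).
have e0 : phi (T y) = phi (T (g 0%N)).
  rewrite -[LHS](act_theta 0) // eTy (act_sum _ (fun n => T (e i) ^+ n * T (g n))) //.
  rewrite big_ord_recl big1 => [|n _].
    by rewrite addr0 expr0 mul1r act_theta.
  by rewrite act_term act_TX_theta_lt ?act0.
exists N, g; split=> // m; elim/ltn_ind: m => m ih /andP[m0 mN].
have em : iter m (X i) (phi (T y)) = \sum_(n < N.+1) act (T (g n)) (act (T (e i) ^+ n) (theta m)).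
  rewrite -act_theta // eTy (act_sum _ (fun n => T (e i) ^+ n * T (g n))) //.
  by apply: eq_bigr => n _.
have m1 : (m < N.+1)%N by [].
have [a a0 ea] := act_TX_theta (leqnn m).
(* The terms n = m and n = 0 are isolated; the second cancels the left side by [e0]. *)
move: em; rewrite (bigD1 (Ordinal m1)) //= (bigD1 ord0) /=; last first.
  by rewrite -val_eqE /= eq_sym -lt0n.
rewrite big1 => [|n /andP[nm n0]].
  rewrite addr0 expr0 act1 e0 (act_theta m (Tg 0%N)) ea subnn actZr.
  rewrite (act_theta 0 (Tg m)) => /eqP; rewrite eq_sym -subr_eq0 addrK.
  by rewrite scaler_eq0 (negPf a0) => /eqP.
have nm' : (n : nat) != m by [].
have n0' : (0 < n)%N by rewrite lt0n.
have [mn|nm1] := ltnP m n; first by rewrite act_TX_theta_lt ?act0.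
have nm2 : (n < m)%N by rewrite ltn_neqAle nm'.
have [a' _ ->] := act_TX_theta nm1.
rewrite actZr act_theta // ih // ?n0' ?iterX0 ?scaler0 //.
by rewrite -ltnS ltn_ord.
Qed.

End Form.
End Braid.
End HalfTransport.

(** * Pairing with words *)

Section TensorLemmas.
Variables (K : fieldType) (A B : algType K).

Lemma tens_mul (a c : A) (d b : B) : (a *t b) * (c *t d) = (a * c) *t (b * d).
Proof. by rewrite /tens [LHS]tmulE. Qed.
Lemma tens_muls (a : A) (b : B) (s : seq (A * B)) :
  (a *t b) * (\sum_(p <- s) p.1 *t p.2) =
  \sum_(p <- [seq (a * p.1, b * p.2) | p <- s]) p.1 *t p.2.
Proof. by rewrite mulr_sumr big_map; apply: eq_bigr => p _; rewrite tens_mul. Qed.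

End TensorLemmas.

Section PairingForms.
Variables (K : fieldType) (q : K).
Hypotheses (q0 : q != 0).
Variable D : datum.
Local Notation U := (Uq q D).
Local Notation V := (seq (idx D) -> K^o).
Variable Delta : {rmorphism U -> tensor U U}.
Hypothesis hD : is_coproduct Delta.
Variable tau : U -> U -> K.
Hypothesis ht : is_drinfeld_pairing Delta tau.
Implicit Types (j l : idx D).
Local Notation k j := (k_ q (t_ j)).
Local Notation kv j := (k_ q (- t_ j)).
Local Notation b := (bq q).
Local Notation X := (Xop b (tq q (D:=D))).

Definition single j (z : int) : idx D -> int := fun l => if l == j then z else 0.

Lemma tQ_single j z : tQ (single j z) = t_ j *~ z.
Proof.
rewrite /tQ (bigD1 j) //= /single eqxx big1 ?addr0 // => l /negPf ->.
by rewrite mulr0z.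
Qed.
Lemma alphaQ_single j z : alphaQ (single j z) = alpha j *~ z.
Proof.
rewrite /alphaQ (bigD1 j) //= /single eqxx big1 ?addr0 // => l /negPf ->.
by rewrite mulr0z.
Qed.
Lemma kQ_single j : kQ q (single j 1) = k j.
Proof. by rewrite /kQ tQ_single. Qed.
Lemma kQ_singleN j : kQ q (single j (-1)) = kv j.
Proof. by rewrite /kQ tQ_single mulrN1z. Qed.
Lemma kQ_0 : kQ q (fun=> 0 : int) = 1 :> U.
Proof.
by rewrite /kQ /tQ big1 ?k_0.
Qed.
Lemma kQ_M m n : kQ q m * kQ q n = kQ q (fun j => m j + n j) :> U.
Proof.
rewrite /kQ k_M /tQ -big_split; congr (k_ q _); apply: eq_bigr => j _.
by rewrite /= mulrzDr.
Qed.

Definition tU s := mulspace (@tU0 K q D) (@Uh K q D s).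

Lemma tU_kQ s n x : @Uh K q D s x -> tU s (kQ q n * x).
Proof.
move=> xU; apply: lspan_gen; exists (kQ q n); last by exists x.
by apply: lspan_gen; exists n.
Qed.
Lemma tU_lin s c x y : tU s x -> tU s y -> tU s (c *: x + y).
Proof. exact: lspan_ZD. Qed.
Lemma tU_ind s (P : U -> Prop) : P 0 -> (forall c x y, P x -> P y -> P (c *: x + y)) ->
  (forall n x, @Uh K q D s x -> P (kQ q n * x)) -> forall x, tU s x -> P x.
Proof.
move=> P0 PD PM x; elim=> {x} [x [a aU [y yU <-]]||c x y _ Px _ Py]; [|exact: P0|exact: PD].
elim: aU => {a} [a [n _ <-]||c a a' _ Pa _ Pa']; first exact: PM.
  by rewrite mul0r.
by rewrite mulrDl -scalerAl; apply: PD.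
Qed.
Lemma tU_Uh s x : @Uh K q D s x -> tU s x.
Proof. by move=> xU; rewrite -[x]mul1r -kQ_0; apply: tU_kQ. Qed.
Lemma tU_kQ1 s n : tU s (kQ q n).
Proof. by rewrite -[kQ q n]mulr1; apply/tU_kQ/subalg_1. Qed.
Lemma tU_1 s : tU s 1. Proof. by apply/tU_Uh/subalg_1. Qed.
Lemma tU_mulk s n x : tU s x -> tU s (kQ q n * x).
Proof.
elim/tU_ind=> [|c {}x y xU yU|m {}x xU].
- by rewrite mulr0; apply: lspan_0.
- by rewrite mulrDr -scalerAr; apply: tU_lin.
- by rewrite mulrA kQ_M; apply: tU_kQ.
Qed.
Lemma eU_k s l n : exists c, @eU K q D s l * kQ q n = c *: (kQ q n * @eU K q D s l).
Proof.
rewrite /kQ; case: s => /=.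
  exists (q ^ (- alphaZ l (tQ n))); rewrite k_e scalerA -expfzDr // addNr.
  by rewrite expr0z scale1r.
exists (q ^ alphaZ l (tQ n)); rewrite k_f scalerA -expfzDr // subrr.
by rewrite expr0z scale1r.
Qed.
Lemma tU_mule s l x : tU s x -> tU s (@eU K q D s l * x).
Proof.
elim/tU_ind=> [|c {}x y xU yU|m {}x xU].
- by rewrite mulr0; apply: lspan_0.
- by rewrite mulrDr -scalerAr; apply: tU_lin.
- have [c ec] := eU_k s l m.
  rewrite mulrA ec -scalerAl -mulrA -[_ *: _]addr0; apply: tU_lin; last exact: lspan_0.
  by apply/tU_kQ/subalg_M => //; apply: Uh_e.
Qed.

Definition lin_on (S : set U) (g : U -> K) :=
  forall c x y, S x -> S y -> g (c *: x + y) = c * g x + g y.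
Definition coprod_list s (y : U) (r : seq (U * U)) :=
  (forall p, p \in r -> tU s p.1 /\ tU s p.2) /\ Delta y = \sum_(p <- r) p.1 *t p.2.

Let bform0 (lam : 'Hom(cspace D, rat^o)) :
  lam \in <<[seq alpha i | i : idx D]>>%VS -> bform lam 0 = 0.
Proof. by move=> lS; rewrite Defs.formC ?mem0v // bform0l. Qed.
Let alphaQ_span (n : idx D -> int) : alphaQ n \in <<[seq alpha i | i : idx D]>>%VS.
Proof.
apply: memv_suml => j _; case: (n j) => m; rewrite -?pmulrn ?NegzE ?mulrNz ?memvN -?pmulrn;
  by apply: rpredMn; apply: alpha_span.
Qed.
Let alphaQ0 : alphaQ (fun=> 0 : int) = 0 :> 'Hom(cspace D, rat^o).
Proof. by rewrite /alphaQ big1. Qed.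

Lemma tau_1k n : tau 1 (kQ q n) = 1.
Proof.
rewrite -kQ_0 (tau_kk ht (z := 0)) ?oppr0 ?expr0z //.
by rewrite alphaQ0 bform0l.
Qed.
Lemma tau_k1 n : tau (kQ q n) 1 = 1.
Proof.
rewrite -kQ_0 (tau_kk ht (z := 0)) ?oppr0 ?expr0z //.
by rewrite alphaQ0 bform0.
Qed.
Lemma tau_k_kv j l : tau (k j) (kv l) = b j l.
Proof.
rewrite -kQ_single -kQ_singleN (tau_kk ht (z := - bilZ j l)) ?opprK //.
rewrite !alphaQ_single mulr1z mulrN1z -scaleN1r Defs.formC ?memvZ ?alpha_span //.
rewrite bformZl ?alpha_span // Defs.formC ?alpha_span // bform_alpha mulN1r.
by rewrite intrN.
Qed.
Lemma tau_1_1 : tau 1 1 = 1. Proof. by have := tau_1k (fun=> 0); rewrite kQ_0. Qed.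
Lemma tau_1f l : tau 1 (f_ q l) = 0.
Proof. by rewrite -kQ_0 (tau_kf ht). Qed.
Lemma tau_e1 l : tau (e_ q l) 1 = 0.
Proof. by rewrite -kQ_0 (tau_ek ht). Qed.

Lemma coprod_list1 s : coprod_list s 1 [:: (1, 1)].
Proof.
split; first by move=> p; rewrite inE => /eqP ->; split; apply: tU_1.
by rewrite big_seq1 rmorph1.
Qed.
Lemma coprod_list_e l : coprod_list true (e_ q l) [:: (e_ q l, 1); (k l, e_ q l)].
Proof.
have eU : tU true (e_ q l) by apply/tU_Uh/(Uh_e q true).
split; last by rewrite (coprod_e hD) big_cons big_seq1.
move=> p; rewrite !inE => /orP[] /eqP ->; split; [exact: eU|exact: tU_1| |exact: eU].
by rewrite -kQ_single; apply: tU_kQ1.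
Qed.
Lemma coprod_list_f l : coprod_list false (f_ q l) [:: (f_ q l, kv l); (1, f_ q l)].
Proof.
have fU : tU false (f_ q l) by apply/tU_Uh/(Uh_e q false).
split; last by rewrite (coprod_f hD) big_cons big_seq1.
move=> p; rewrite !inE => /orP[] /eqP ->; split; [exact: fU| |exact: tU_1|exact: fU].
by rewrite -kQ_singleN; apply: tU_kQ1.
Qed.

Lemma tau_coprodr x y1 y2 r : tU true x -> tU false y1 -> tU false y2 ->
  coprod_list true x r -> tau x (y1 * y2) = \sum_(p <- r) tau p.1 y1 * tau p.2 y2.
Proof. by move=> xU y1U y2U [rU Dx]; apply: (tau_mulr ht). Qed.
Lemma tau_coprodl x1 x2 y r : tU true x1 -> tU true x2 -> tU false y ->
  coprod_list false y r -> tau (x1 * x2) y = \sum_(p <- r) tau x2 p.1 * tau x1 p.2.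
Proof. by move=> x1U x2U yU [rU Dy]; apply: (tau_mull ht). Qed.

Let eT l : tU true (e_ q l). Proof. by apply/tU_Uh/(Uh_e q true). Qed.
Let fT l : tU false (f_ q l). Proof. by apply/tU_Uh/(Uh_e q false). Qed.
Let kT s l : tU s (k l). Proof. by rewrite -kQ_single; apply: tU_kQ1. Qed.
Let kvT s l : tU s (kv l). Proof. by rewrite -kQ_singleN; apply: tU_kQ1. Qed.

Let tau_e_kv0 j l : tau (e_ q j) (kv l) = 0.
Proof. by rewrite -kQ_singleN (tau_ek ht). Qed.
Let tau_k_f0 l j : tau (k l) (f_ q j) = 0.
Proof. by rewrite -kQ_single (tau_kf ht). Qed.
Let tau_1_kv0 l : tau 1 (kv l) = 1.
Proof. by rewrite -kQ_singleN tau_1k. Qed.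
Let tau_k_10 l : tau (k l) 1 = 1.
Proof. by rewrite -kQ_single tau_k1. Qed.
Let sum2 (g : U * U -> K) p p' : \sum_(r <- [:: p; p']) g r = g p + g p'.
Proof. by rewrite big_cons big_seq1. Qed.

Lemma tau_e_kv j l y : tU false y -> tau (e_ q j) (kv l * y) = b j l * tau (e_ q j) y.
Proof.
move=> yU; rewrite (tau_coprodr (eT j) (kvT _ l) yU (coprod_list_e j)).
by rewrite sum2 /= [X in X * _ + _](tau_e_kv0 j l) [X in _ + X * _](tau_k_kv j l) mul0r add0r.
Qed.
Lemma tau_e_f j l y : tU false y -> tau (e_ q j) (f_ q l * y) = tq q j l * tau 1 y.
Proof.
move=> yU; rewrite (tau_coprodr (eT j) (fT l) yU (coprod_list_e j)).
by rewrite sum2 /= [X in X * _ + _](tau_ef ht j l) [X in _ + X * _](tau_k_f0 j l) mul0r addr0.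
Qed.
Lemma tau_1_kv l y : tU false y -> tau 1 (kv l * y) = tau 1 y.
Proof.
move=> yU; rewrite (tau_coprodr (tU_1 _) (kvT _ l) yU (coprod_list1 _)).
by rewrite big_seq1 /= tau_1_kv0 mul1r.
Qed.
Lemma tau_1_f l y : tU false y -> tau 1 (f_ q l * y) = 0.
Proof.
move=> yU; rewrite (tau_coprodr (tU_1 _) (fT l) yU (coprod_list1 _)).
by rewrite big_seq1 tau_1f mul0r.
Qed.
Lemma tau_k_f l j x : tU true x -> tau (k l * x) (f_ q j) = b l j * tau x (f_ q j).
Proof.
move=> xU; rewrite (tau_coprodl (kT _ l) xU (fT j) (coprod_list_f j)).
by rewrite sum2 /= [X in _ * X + _](tau_k_kv l j) [X in _ + _ * X](tau_k_f0 l j) mulr0 addr0 mulrC.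
Qed.
Lemma tau_ef_f l j x : tU true x -> tau (e_ q l * x) (f_ q j) = tq q l j * tau x 1.
Proof.
move=> xU; rewrite (tau_coprodl (eT l) xU (fT j) (coprod_list_f j)).
by rewrite sum2 /= [X in _ * X + _](tau_e_kv0 l j) [X in _ + _ * X](tau_ef ht l j) mulr0 add0r mulrC.
Qed.
Lemma tau_k_1 l x : tU true x -> tau (k l * x) 1 = tau x 1.
Proof.
move=> xU; rewrite (tau_coprodl (kT _ l) xU (tU_1 _) (coprod_list1 _)).
by rewrite big_seq1 /= tau_k_10 mulr1.
Qed.
Lemma tau_e_1 l x : tU true x -> tau (e_ q l * x) 1 = 0.
Proof.
move=> xU; rewrite (tau_coprodl (eT l) xU (tU_1 _) (coprod_list1 _)).
by rewrite big_seq1 tau_e1 mulr0.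
Qed.

Definition word s w : U := \prod_(l <- w) @eU K q D s l.
Lemma word_Uh s w : @Uh K q D s (word s w).
Proof.
rewrite /word; elim: w => [|l w ih]; first by rewrite big_nil; apply: subalg_1.
by rewrite big_cons; apply: subalg_M => //; apply: Uh_e.
Qed.
Let wordS s l w : word s (l :: w) = @eU K q D s l * word s w.
Proof. by rewrite /word big_cons. Qed.
Let word0 s : word s [::] = 1. Proof. by rewrite /word big_nil. Qed.

(** An expression of the coproduct whose second factors are paired with e_j. The pairing with 1 is
    carried along: once a letter has been paired with e_j, the letters after it are paired with 1,
    while those before it contribute k_l^-1 and so the factors [b j l]. The other factor is tested
    against an arbitrary linear [g], since the induction replaces [g] by [g] after a left
    multiplication. *)
Lemma coprod_word_f w : exists2 r, coprod_list false (word false w) r &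
  forall g, lin_on (tU false) g ->
    (forall j, \sum_(p <- r) g p.1 * tau (e_ q j) p.2 =
       X j (fun v => g (word false v)) w) /\
    \sum_(p <- r) g p.1 * tau 1 p.2 = g (word false w).
Proof.
elim: w => [|l w [r [rU Dr] rg]].
  exists [:: (1, 1)]; first by rewrite word0; apply: coprod_list1.
  move=> g gl; split=> [j|]; rewrite big_seq1.
    by rewrite tau_e1 mulr0.
  by rewrite word0 tau_1_1 mulr1.
exists ([seq (f_ q l * p.1, kv l * p.2) | p <- r] ++ [seq (1 * p.1, f_ q l * p.2) | p <- r]).
  split; last first.
    rewrite wordS rmorphM Dr (coprod_f hD) mulrDl !tens_muls.
    by rewrite big_cat.
  move=> p; rewrite mem_cat => /orP[] /mapP[p' /rU[p1 p2] ->] /=; split.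
  - exact: (@tU_mule false).
  - by rewrite -kQ_singleN; apply: tU_mulk.
  - by rewrite mul1r.
  - exact: (@tU_mule false).
move=> g gl.
have gl' : lin_on (tU false) (fun y => g (f_ q l * y)).
  move=> c y z yU zU; rewrite mulrDr -scalerAr gl //; exact: (@tU_mule false).
have [g1 g2] := rg g gl; have [g1' g2'] := rg _ gl'.
split=> [j|]; rewrite big_cat !big_map /=.
  rewrite -[RHS]/(b j l * X j (fun v => g (word false (l :: v))) w + tq q j l * g (word false w)).
  congr (_ + _).
    have -> : (fun v => g (word false (l :: v))) = (fun v => g (f_ q l * word false v)).
      by apply/funext => v; rewrite wordS.
    rewrite -g1' mulr_sumr; apply: eq_big_seq => p /rU[p1 p2].
    by rewrite tau_e_kv // mulrCA.
  rewrite -g2 mulr_sumr; apply: eq_big_seq => p /rU[p1 p2].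
  by rewrite mul1r tau_e_f // mulrCA.
rewrite [X in _ + X]big1_seq ?addr0 => [|p /andP[_ /rU[p1 p2]]]; last first.
  by rewrite tau_1_f // mulr0.
rewrite wordS -g2'; apply: eq_big_seq => p /rU[p1 p2].
by rewrite tau_1_kv.
Qed.

Lemma coprod_word_e w : exists2 r, coprod_list true (word true w) r &
  forall g, lin_on (tU true) g ->
    (forall j, \sum_(p <- r) tau p.1 (f_ q j) * g p.2 =
       X j (fun v => g (word true v)) w) /\
    \sum_(p <- r) tau p.1 1 * g p.2 = g (word true w).
Proof.
elim: w => [|l w [r [rU Dr] rg]].
  exists [:: (1, 1)]; first by rewrite word0; apply: coprod_list1.
  move=> g gl; split=> [j|]; rewrite big_seq1.
    by rewrite tau_1f mul0r.
  by rewrite word0 tau_1_1 mul1r.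
exists ([seq (e_ q l * p.1, 1 * p.2) | p <- r] ++ [seq (k l * p.1, e_ q l * p.2) | p <- r]).
  split; last first.
    rewrite wordS rmorphM Dr (coprod_e hD) mulrDl !tens_muls.
    by rewrite big_cat.
  move=> p; rewrite mem_cat => /orP[] /mapP[p' /rU[p1 p2] ->] /=; split.
  - exact: (@tU_mule true).
  - by rewrite mul1r.
  - by rewrite -kQ_single; apply: tU_mulk.
  - exact: (@tU_mule true).
move=> g gl.
have gl' : lin_on (tU true) (fun y => g (e_ q l * y)).
  move=> c y z yU zU; rewrite mulrDr -scalerAr gl //; exact: (@tU_mule true).
have [g1 g2] := rg g gl; have [g1' g2'] := rg _ gl'.
split=> [j|]; rewrite big_cat !big_map /=.
  rewrite addrC -[RHS]/(b j l * X j (fun v => g (word true (l :: v))) w + tq q j l * g (word true w)).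
  congr (_ + _).
    have -> : (fun v => g (word true (l :: v))) = (fun v => g (e_ q l * word true v)).
      by apply/funext => v; rewrite wordS.
    rewrite -g1' mulr_sumr; apply: eq_big_seq => p /rU[p1 p2].
    by rewrite tau_k_f // bqC mulrA.
  rewrite -g2 mulr_sumr; apply: eq_big_seq => p /rU[p1 p2].
  by rewrite mul1r tau_ef_f // tqC mulrA.
rewrite big1_seq ?add0r => [|p /andP[_ /rU[p1 p2]]]; last first.
  by rewrite tau_e_1 // mul0r.
rewrite wordS -g2'; apply: eq_big_seq => p /rU[p1 p2].
by rewrite tau_k_1.
Qed.

Definition phi_e (x : U) : V := fun w => tau x (word false w).
Definition phi_f (y : U) : V := fun w => tau (word true w) y.

End PairingForms.

Section HalfForms.
Variables (K : fieldType) (q : K).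
Hypotheses (q0 : q != 0) (qn1 : forall m, (0 < m)%N -> q ^+ m != 1).
Variable D : datum.
Local Notation U := (Uq q D).
Local Notation V := (seq (idx D) -> K^o).
Local Notation X := (Xop (bq q) (tq q (D:=D))).
Local Notation X' := (Xop' (bq q) (tq q (D:=D))).

(* Left multiplications commute with right ones, so it suffices to know the former. *)
Lemma half_form_of_left s (phi : U -> V) :
  (forall c x y, @Uh K q D s x -> @Uh K q D s y ->
     phi (c *: x + y) = c *: phi x + phi y) ->
  phi 1 = vac K (I := idx D) ->
  (forall j x, @Uh K q D s x -> phi (@eU K q D s j * x) = X j (phi x)) ->
  half_form s phi.
Proof.
move=> pl p1 pe; split=> // x j xU.
have ejU j' : @Uh K q D s (@eU K q D s j') by apply: Uh_e.
suff [] : @Uh K q D s x /\ phi (x * @eU K q D s j) = X' j (phi x) by [].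
apply: (@subalg_ind_l K U (range (@eU K q D s)) (fun x =>
  @Uh K q D s x /\ phi (x * @eU K q D s j) = X' j (phi x)) _ _ _ x xU) =>
  {x xU} [|c x y [xU ex] [yU ey]|x _ _ [xU ex] [l _ <-]]; split.
- exact: subalg_1.
- rewrite mul1r -[@eU K q D s j]mulr1 pe ?p1 ?Xop_vac //; exact: subalg_1.
- exact: subalg_ZD.
- have xeU := subalg_M xU (ejU j); have yeU := subalg_M yU (ejU j).
  by rewrite mulrDl -scalerAl !pl // ex ey linearP.
- exact: subalg_M (ejU l) xU.
- have xeU := subalg_M xU (ejU j).
  rewrite -mulrA !pe // ex.
  by rewrite (Xop_Xop' (bqC q (D := D)) (@tq_diag _ _ _)).
Qed.

Section FromPairing.
Variable Delta : {rmorphism U -> tensor U U}.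
Hypothesis hD : is_coproduct Delta.
Variable tau : U -> U -> K.
Hypothesis ht : is_drinfeld_pairing Delta tau.

Lemma half_form_e : half_form true (phi_e tau).
Proof.
apply: half_form_of_left => [c x y xU yU||j x xU].
- apply/funext => w; rewrite linE.
  apply: (tauPl ht); [exact: (@tU_Uh _ _ _ true)|exact: (@tU_Uh _ _ _ true)|].
  exact/(@tU_Uh _ _ _ false)/word_Uh.
- apply/funext => -[|l w]; rewrite /phi_e /word ?big_nil ?big_cons /vac /=.
    exact: tau_1_1 ht.
  by apply: (tau_1_f ht); apply/(@tU_Uh _ _ _ false)/(word_Uh q false w).
- apply/funext => w; have [r cr rg] := coprod_word_f q0 hD ht w.
  have xT := @tU_Uh _ _ _ true _ xU.
  have gl : lin_on (tU false) (tau x).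
    by move=> c y z yT zT; apply: (tauPr ht).
  have [<- _] := rg _ gl.
  rewrite /phi_e (tau_coprodl ht _ xT _ cr) //.
    exact/(@tU_Uh _ _ _ true)/(Uh_e q true).
  exact/(@tU_Uh _ _ _ false)/(word_Uh q false w).
Qed.

Lemma half_form_f : half_form false (phi_f tau).
Proof.
apply: half_form_of_left => [c x y xU yU||j x xU].
- apply/funext => w; rewrite linE.
  apply: (tauPr ht); [|exact: (@tU_Uh _ _ _ false)|exact: (@tU_Uh _ _ _ false)].
  exact/(@tU_Uh _ _ _ true)/(word_Uh q true w).
- apply/funext => -[|l w]; rewrite /phi_f /word ?big_nil ?big_cons /vac /=.
    exact: tau_1_1 ht.
  by apply: (tau_e_1 ht); apply/(@tU_Uh _ _ _ true)/(word_Uh q true w).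
- apply/funext => w; have [r cr rg] := coprod_word_e q0 hD ht w.
  have xT := @tU_Uh _ _ _ false _ xU.
  have gl : lin_on (tU true) (fun y => tau y x).
    by move=> c y z yT zT; apply: (tauPl ht).
  have [<- _] := rg _ gl.
  rewrite /phi_f (tau_coprodr ht _ _ xT cr) //.
    exact/(@tU_Uh _ _ _ true)/(word_Uh q true w).
  exact/(@tU_Uh _ _ _ false)/(Uh_e q false).
Qed.

End FromPairing.

Lemma half_module_of_form s (phi : U -> V) i : half_form s phi ->
  half_module q i (@eU K q D s) (fU q s) (fun j => kU q s (t_ j))
    (fun j => kU q s (- t_ j)) (Img s phi) phi (act i s).
Proof.
move=> H; split.
- exact: hf_lin H.
- exact: hf_1 H.
- exact: hf_e H.
- exact: Img_phi.
- by move=> y v vI; apply: (act_Img q0 qn1 i H).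
- by move=> a y z v vI; apply: (act_lin q0 qn1 i H).
- by move=> a y v w; apply: act_linr.
- by move=> y z v vI; apply: (act_mul q0 qn1 i H).
- by move=> j v vI; apply: (act_f q0 qn1 i H).
- by move=> j v vI; apply: (act_k q0 qn1 i H).
- by move=> j v vI; apply: (act_k q0 qn1 i H).
- move=> y z yU zU; have vI := Img_vac H.
  have yzU : @Uh K q D s (y * z) by apply: subalg_M.
  rewrite -(act_phi q0 qn1 i H yU) -(act_mul q0 qn1 i H y z vI).
  exact: (act_phi q0 qn1 i H).
Qed.

End HalfForms.

(** * Derivations dual to the images of the generators *)

Section RightSkewDerivations.
Variables (K : fieldType) (q : K).
Hypotheses (q0 : q != 0) (qn1 : forall m, (0 < m)%N -> q ^+ m != 1).
Variables (D : datum) (i : idx D).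
Local Notation V := (seq (idx D) -> K^o).
Local Notation b := (bq q).
Local Notation t := (tq q (D := D)).
Local Notation X' := (Xop' b t).
Local Notation x := (q_ q i).
Local Notation n_ j := (mcartan i j).

Let x0 := q_neq0 q0 i.
Let xn1 m : (0 < m)%N -> x ^+ m != 1. Proof. exact: q_exp_neq1. Qed.

Lemma Gop_nil j m (v : V) : Gop q i j m v [::] = 0.
Proof.
elim: m v => [|m ih] v //=.
by rewrite -[LHS]/(_ + _) ih add0r -[LHS]/(- (_ * 0)) mulr0 oppr0.
Qed.

Lemma Rop_Gop_neq j l m (v : V) : j != i -> l != i -> j != l ->
  Rop j (Gop q i l m v) = (b j l * b i j ^+ m) *: Gop q i l m (Rop j v).
Proof.
move=> ji li jl; elim: m v => [|m ih] v /=.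
  by rewrite Rop_Xop' /tq eq_sym (negPf jl) mul0r oppr0 scale0r addr0 mulr1 bqC.
have tij : t i j = 0 by rewrite /tq eq_sym (negPf ji) mul0r oppr0.
rewrite RopD RopN RopZ ih !Rop_Xop' ih tij !scale0r !addr0 !GopZ !Xop'Z exprS.
by lmod K.
Qed.

(** In the second term the removed letter is the [j] of the string, and the m letters [i] of the
    string remain. The product of constants is the one of [commutator_estring]. *)
Lemma Rop_Gop_eq j m (v : V) : j != i ->
  Rop j (Gop q i j m v) = (b j j * b i j ^+ m) *: Gop q i j m (Rop j v) +
    (t j j * \prod_(p < m) (1 - x ^+ (p + p) / x ^+ (n_ j + n_ j))) *:
      iter m (X' i) v.
Proof.
move=> ji; elim: m v => [|m ih] v /=.
  by rewrite Rop_Xop' big_ord0 !mulr1.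
have tij : t i j = 0 by rewrite /tq eq_sym (negPf ji) mul0r oppr0.
rewrite RopD RopN RopZ ih !Rop_Xop' ih tij !scale0r !addr0 !(GopZ _ _ _ _ _).
rewrite big_ord_recr /= -iterSr iterS !Xop'D !Xop'Z (bq_ij q ji) exprS.
rewrite ![x ^+ (n_ j + n_ j)]exprD.
have v0 := expf_neq0 (n_ j) x0.
set P := \prod_(_ < _) _; move: P => P.
lmod K; move: (x ^- n_ j ^+ m) (t j j) (b j j) (x ^+ (m + m)) (x ^+ n_ j) v0 => w1 w2 w3 w4 w5 w50; by field.
Qed.

Lemma iter_RopZ m a (v : V) : iter m (Rop i) (a *: v) = a *: iter m (Rop i) v.
Proof. by elim: m => [//|m ih]; rewrite !iterS ih RopZ. Qed.
Lemma iter_RopD m (v w : V) :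
  iter m (Rop i) (v + w) = iter m (Rop i) v + iter m (Rop i) w.
Proof. by elim: m => [//|m ih]; rewrite !iterS ih RopD. Qed.

Lemma iter_Rop_Gop l m p (v : V) : l != i ->
  iter p (Rop i) (Gop q i l m v) =
  (x ^+ (m + m) / x ^+ n_ l) ^+ p *: Gop q i l m (iter p (Rop i) v).
Proof.
move=> li; elim: p => [|p ih]; first by rewrite scale1r.
by rewrite !iterS ih RopZ Rop_Gop // scalerA -exprSr.
Qed.

Lemma Rop_iter_X' m (v : V) : Rop i v = 0 ->
  Rop i (iter m.+1 (X' i) v) = (t i i * (x ^+ m * qint x m.+1)) *: iter m (X' i) v.
Proof.
move=> v0; elim: m => [|m ih].
  rewrite /= Rop_Xop' v0 linear0 scaler0 add0r; congr (_ *: _).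
  by rewrite expr0 mul1r /qint !expr1 divff ?mulr1 // qint_den_neq0.
rewrite iterS Rop_Xop' ih Xop'Z -iterS scalerA -scalerDl bq_ii; congr (_ *: _).
have -> : qint x m.+2 = x ^- m.+1 * qint x 1 + x ^+ 1 * qint x m.+1 by rewrite qintD // addn1.
have -> : qint x 1 = 1 by rewrite /qint !expr1 divff // qint_den_neq0.
have u := expf_neq0 m x0; rewrite !exprS expr0.
by field; rewrite x0 u.
Qed.

Lemma iter_Rop_iter_X' m (v : V) : Rop i v = 0 ->
  iter m (Rop i) (iter m (X' i) v) = (\prod_(p < m) (t i i * (x ^+ p * qint x p.+1))) *: v.
Proof.
move=> v0; elim: m => [|m ih]; first by rewrite big_ord0 scale1r.
rewrite iterSr Rop_iter_X' // iter_RopZ ih scalerA big_ord_recr /= mulrC.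
by [].
Qed.

(** One product comes from removing e_j from the string, the other from removing the remaining
    e_i^n. After reversal of the first, each pair of factors, with one of the n factors -x, gives
    [p + 1]^2. *)
Lemma normalization j : j != i -> 
  (-1) ^+ n_ j * x ^+ n_ j *
  \prod_(p < n_ j) (1 - x ^+ (p + p) / x ^+ (n_ j + n_ j)) *
  \prod_(p < n_ j) (t i i * (x ^+ p * qint x p.+1)) = qfact x (n_ j) ^+ 2.
Proof.
move=> ji; move: (n_ j) => n; rewrite (reindex_inj rev_ord_inj) /=.
have xd := qint_den_neq0 x0 xn1.
have e (p : 'I_n) : (-1) * x * (1 - x ^+ (n - p.+1 + (n - p.+1)) / x ^+ (n + n)) *
    (t i i * (x ^+ p * qint x p.+1)) = qint x p.+1 ^+ 2.
  have pn : n = (n - p.+1 + p.+1)%N by rewrite subnK.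
  have -> : x ^+ (n + n) = x ^+ (n - p.+1 + (n - p.+1)) * x ^+ (p.+1 + p.+1).
    by rewrite -exprD; congr (_ ^+ _); lia.
  have u := expf_neq0 (n - p.+1) x0; have w := expf_neq0 p x0.
  have -> : t i i = - (x - x^-1)^-1 by rewrite /tq eqxx mul1r.
  rewrite /qint !exprD !exprS.
  move: (x ^+ (n - p.+1)) u => y u; move: (x ^+ p) w => z w.
  have dz : x * x - 1 != 0.
    by move: xd; apply: contra_neq => E1; rewrite -[x - _](mulfK x0) mulrBl mulVf // E1 mul0r.
  by rewrite expr0; field; rewrite ?x0 ?u ?w ?dz.
have -> : (-1) ^+ n * x ^+ n = \prod_(p < n) (-1 * x).
  by rewrite prodr_const card_ord exprMn.
by rewrite -!big_split /qfact -prodrXl; apply: eq_bigr => p _; rewrite -e.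
Qed.

(* The right derivation dual to T(e_j), on elements killed by the one dual to e_i. *)
Lemma transported_derivation j l (v : V) (zeta : idx D -> K) : j != i -> l != i ->
  zeta j = (-1) ^+ n_ j * x ^+ n_ j -> Rop i v = 0 ->
  let kappa l := zeta l / qfact x (n_ l) in
  iter (n_ j) (Rop i) (Rop j (kappa l *: Gop q i l (n_ l) v)) =
  (b j l * kappa l) *: Gop q i l (n_ l) (iter (n_ j) (Rop i) (Rop j v)) +
  (t j l * qfact x (n_ j)) *: v.
Proof.
move=> ji li zj v0 kappa.
(* Removing [j] and then n_j letters [i] past a string ending at [l] produces two scalars in [b i j]
   and [x], which are inverse to each other. *)
have sc : b i j ^+ n_ l * (x ^+ (n_ l + n_ l) / x ^+ n_ l) ^+ n_ j = 1.
  have u := expf_neq0 (n_ l) x0.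
  rewrite (bq_ij q ji) exprD mulfK // exprVn -!exprM [(n_ l * _)%N]mulnC.
  by rewrite mulVf // expf_neq0.
have [jl|jl] := eqVneq j l; last first.
  rewrite RopZ Rop_Gop_neq // scalerA iter_RopZ iter_Rop_Gop // scalerA.
  have -> : t j l = 0 by rewrite /tq (negPf jl) mul0r oppr0.
  rewrite mul0r scale0r addr0; congr (_ *: _).
  by rewrite -[RHS]mulr1 -sc; ring.
subst l; rewrite RopZ Rop_Gop_eq // scalerDr !scalerA iter_RopD !iter_RopZ.
rewrite iter_Rop_Gop // iter_Rop_iter_X' // !scalerA; congr (_ *: _ + _ *: _).
  by rewrite -[RHS]mulr1 -sc; ring.
have fn0 := qfact_neq0 x0 xn1 (n_ j).
have N := normalization ji; rewrite /kappa zj.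
apply: (mulIf fn0); rewrite -[RHS]mulrA -expr2 -N.
set P1 := \prod_(p < _) (1 - _); set P2 := \prod_(p < _) (t i i * _).
move: (qfact x (n_ j)) P1 P2 (t j j) (x ^+ n_ j) fn0 => y p1 p2 z w y0.
by field; rewrite y0.
Qed.

End RightSkewDerivations.

(** * Invariance of the pairing *)

Section WordForm.
Variables (K : fieldType) (q : K) (q0 : q != 0) (D : datum) (i : idx D).
Variables (U : algType K) (e k kv : idx D -> U).
Local Notation V := (seq (idx D) -> K^o).
Local Notation Ue := (subalg (range e)).
Local Notation cv := (cop (kv i) (k i)).
Hypotheses (kkv : k i * kv i = 1) (kvk : kv i * k i = 1).
Hypothesis cv_e : forall l, cv (e l) = (bq q i l)^-1 *: e l.
Variables (W : U -> Prop) (beta : U -> U -> K).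
Hypothesis beta_lin : forall c x x' y, Ue x -> Ue x' -> W y ->
  beta (c *: x + x') y = c * beta x y + beta x' y.

Definition gword w : U := \prod_(l <- w) e l.
Definition gpsi (y : U) : V := fun w => beta (gword w) y.

Lemma gword_cons l w : gword (l :: w) = e l * gword w.
Proof. by rewrite /gword big_cons. Qed.
Lemma gword_rcons l w : gword (rcons w l) = gword w * e l.
Proof. by rewrite /gword -cats1 big_cat big_seq1. Qed.
Lemma gen_Ue l : Ue (e l).
Proof. by apply: subalg_gen; exists l. Qed.
Lemma gword_Ue w : Ue (gword w).
Proof.
elim: w => [|l w ih]; first by rewrite /gword big_nil; apply: subalg_1.
by rewrite gword_cons; apply: subalg_M => //; apply: gen_Ue.
Qed.

Definition ulin (g : U -> K) := forall c x y, Ue x -> Ue y -> g (c *: x + y) = c * g x + g y.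

(** Words span [Ue]; the statement is strengthened to all [gword w * x] so that a generator put in
    front of [x] is absorbed into [w]. *)
Lemma word_span_ext (g h : U -> K) : ulin g -> ulin h ->
  (forall w, g (gword w) = h (gword w)) -> forall x, Ue x -> g x = h x.
Proof.
move=> gl hl gh x xU; suff: Ue x /\ forall w, g (gword w * x) = h (gword w * x).
  by case=> _ /(_ [::]); rewrite /gword big_nil mul1r.
apply: (@subalg_ind_l K U (range e)
  (fun x => Ue x /\ forall w, g (gword w * x) = h (gword w * x)) _ _ _ x xU) =>
  {x xU} [|c x y [xU ex] [yU ey]|x _ _ [xU ex] [l _ <-]]; split.
- exact: subalg_1.
- by move=> w; rewrite mulr1.
- exact: subalg_ZD.
- move=> w; have wU := gword_Ue w.
  by rewrite mulrDr -scalerAr gl ?hl ?ex ?ey //; apply: subalg_M.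
- by apply: subalg_M => //; apply: gen_Ue.
- by move=> w; rewrite mulrA -gword_rcons.
Qed.

Lemma beta_0 y : W y -> beta 0 y = 0.
Proof.
move=> yW; have := beta_lin (-1) (subalg_1 _) (subalg_1 _) yW.
by rewrite scaleN1r addNr mulN1r addNr.
Qed.
Lemma betaZ c x y : Ue x -> W y -> beta (c *: x) y = c * beta x y.
Proof.
by move=> xU yW; have := beta_lin c xU (subalg0 _) yW; rewrite beta_0 // !addr0.
Qed.
Lemma beta_sum N (g : nat -> U) y : (forall n, Ue (g n)) -> W y ->
  beta (\sum_(n < N) g n) y = \sum_(n < N) beta (g n) y.
Proof.
move=> gU yW; elim: N => [|N ih]; first by rewrite !big_ord0 beta_0.
have sU : Ue (\sum_(n < N) g n) by apply: subalg_sum.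
have := beta_lin 1 (gU N) sU yW.
by rewrite !big_ord_recr /= scale1r mul1r addrC => ->; rewrite ih addrC.
Qed.
Let ulin_beta y : W y -> ulin (beta^~ y).
Proof. by move=> yW c x x' xU xU'; apply: beta_lin. Qed.

Lemma beta_ext x y y' : Ue x -> W y -> W y' -> gpsi y = gpsi y' -> beta x y = beta x y'.
Proof.
move=> xU yW yW' yy'; move: x xU.
apply: word_span_ext; [exact: ulin_beta|exact: ulin_beta|move=> w].
exact: (congr1 (fun v : V => v w) yy').
Qed.
Lemma beta_ext0 x y : Ue x -> W y -> gpsi y = 0 -> beta x y = 0.
Proof.
move=> xU yW y0; move: x xU; apply: (word_span_ext (h := fun=> 0)) => [|c x x' _ _|w].
- exact: ulin_beta.
- by rewrite mulr0 addr0.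
- exact: (congr1 (fun v : V => v w) y0).
Qed.
Lemma beta_R j x y d : Ue x -> W y -> W d -> Rop j (gpsi y) = gpsi d ->
  beta (x * e j) y = beta x d.
Proof.
move=> xU yW dW yd; move: x xU.
apply: (word_span_ext (g := fun x => beta (x * e j) y)) => [c x x' xU xU'||w].
- by rewrite mulrDl -scalerAl beta_lin //; apply: subalg_M => //; apply: gen_Ue.
- exact: ulin_beta.
- by rewrite -gword_rcons; apply: (congr1 (fun v : V => v w) yd).
Qed.
Lemma beta_R0 j x y : Ue x -> W y -> Rop j (gpsi y) = 0 -> beta (x * e j) y = 0.
Proof.
move=> xU yW y0; move: x xU.
apply: (word_span_ext (g := fun x => beta (x * e j) y) (h := fun=> 0)) => [c x x' xU xU'|c x x' _ _|w].
- by rewrite mulrDl -scalerAl beta_lin //; apply: subalg_M => //; apply: gen_Ue.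
- by rewrite mulr0 addr0.
- by rewrite -gword_rcons; apply: (congr1 (fun v : V => v w) y0).
Qed.
Lemma beta_L0 j x y : Ue x -> W y -> Lop j (gpsi y) = 0 -> beta (e j * x) y = 0.
Proof.
move=> xU yW y0; move: x xU.
apply: (word_span_ext (g := fun x => beta (e j * x) y) (h := fun=> 0)) => [c x x' xU xU'|c x x' _ _|w].
- by rewrite mulrDr -scalerAr beta_lin //; apply: subalg_M => //; apply: gen_Ue.
- by rewrite mulr0 addr0.
- by rewrite -gword_cons; apply: (congr1 (fun v : V => v w) y0).
Qed.

Lemma cv_gword w : cv (gword w) = (\prod_(l <- w) wt q (t_ i) l) *: gword w.
Proof.
elim: w => [|l w ih].
  by rewrite /gword !big_nil scale1r (cop1 kvk).
by rewrite gword_cons (copM kkv) cv_e ih -scalerAl -scalerAr scalerA big_cons wt_t.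
Qed.
Hypothesis Ue_cv : forall x, Ue x -> Ue (cv x).

(** Removal of a first letter [i] followed by the weight twist is adjoint to x -> e_i cv(x). *)
Lemma beta_KL a x y z : Ue x -> W y -> W z ->
  gpsi z = a *: Kop (wt q (t_ i)) (Lop i (gpsi y)) ->
  beta x z = a * beta (e i * cv x) y.
Proof.
move=> xU yW zW ez; move: x xU.
apply: (word_span_ext (h := fun x => a * beta (e i * cv x) y)) => [|c x x' xU xU'|w].
- exact: ulin_beta.
- rewrite linearP mulrDr -scalerAr beta_lin ?mulrDr 1?mulrCA //;
    apply: subalg_M; do ?[exact: gen_Ue | exact: Ue_cv].
- rewrite [LHS](congr1 (fun v : V => v w) ez) wZE cv_gword -scalerAr -gword_cons.
  by rewrite betaZ //; apply: gword_Ue.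
Qed.

Lemma gpsi_iter_Rop m j w y :
  beta (gword w * (e i ^+ m * e j)) y = iter m (Rop i) (Rop j (gpsi y)) w.
Proof.
elim: m w => [|m ih] w; first by rewrite expr0 mul1r -gword_rcons.
by rewrite exprS -mulrA mulrA -gword_rcons ih iterS.
Qed.

End WordForm.

Section InvariantPairing.
Variables (K : fieldType) (q : K).
Hypotheses (q0 : q != 0) (qn1 : forall m, (0 < m)%N -> q ^+ m != 1).
Variables (D : datum) (i : idx D).
Variables (U : algType K) (e f k kv : idx D -> U).
Hypothesis R : qrels (bq q) (dq q) e f k kv.
Local Notation V := (seq (idx D) -> K^o).
Local Notation Ue := (subalg (range e)).
Local Notation Uf := (subalg (range f)).
Local Notation x := (q_ q i).
Local Notation b := (bq q).
Local Notation t := (tq q (D := D)).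
Local Notation n_ j := (mcartan i j).

Variable tau : U -> U -> K.
Hypothesis tau_l : forall c y y' z, Ue y -> Ue y' -> Uf z ->
  tau (c *: y + y') z = c * tau y z + tau y' z.
Hypothesis tau_r : forall c z z' y, Uf z -> Uf z' -> Ue y ->
  tau y (c *: z + z') = c * tau y z + tau y z'.
(** With the arguments exchanged, the lemmas on a form linear in its first variable apply to the
    second variable of tau. *)
Let tau_flip y z := tau z y.
Local Notation phi := (gpsi f tau_flip).
Local Notation psi := (gpsi e tau).

Variables (Ip Im : V -> Prop) (actp actm : U -> V -> V).
Hypothesis Hp : half_module q i e f k kv Ip phi actp.
Hypothesis Hm : half_module q i f e kv k Im psi actm.

Variables (T : {lrmorphism U -> U}) (zm : idx D -> K).
Hypotheses (T_k : T (k i) = kv i) (T_kv : T (kv i) = k i).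
Hypothesis T_ei : T (e i) = - (f i * k i).
Hypothesis T_fi : T (f i) = - (zm i *: (e i * kv i)).
Hypothesis T_ej : forall j, j != i ->
  T (e j) = (qfact x (n_ j))^-1 *: estring e k kv i j (n_ j).
Hypothesis T_fj : forall j, j != i ->
  T (f j) = (zm j / qfact x (n_ j)) *: estring f kv k i j (n_ j).
Hypothesis zm_i : zm i != 0.
Hypothesis zm_j : forall j, j != i -> zm j = (-1) ^+ n_ j * x ^+ n_ j.

Let b0 := bq_neq0 q0 (D := D).
Let bC := bqC q (D := D).
Let kkv := qr_kkv R i.
Let kvk := qr_kvk R i.
Let Rm : qrels (bq q) (dq q) f e kv k := qrels_swap b0 R.
Let x0 := q_neq0 q0 i.
Let xn1 m : (0 < m)%N -> x ^+ m != 1. Proof. exact: q_exp_neq1. Qed.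

Let cv_e l : cop (kv i) (k i) (e l) = (b i l)^-1 *: e l.
Proof. exact: (copV_ej b0 R). Qed.
Let cv_f l : cop (k i) (kv i) (f l) = (b i l)^-1 *: f l.
Proof. exact: (cop_fj R). Qed.
Let Ue_cv y : Ue y -> Ue (cop (kv i) (k i) y).
Proof. exact: (Uh_cv q0 i R). Qed.
Let Uf_cv y : Uf y -> Uf (cop (k i) (kv i) y).
Proof. exact: (Uh_cv q0 i Rm). Qed.

Let T_ei1 : T (e i) = - ((fun=> 1 : K) i *: (f i * k i)).
Proof. by rewrite scale1r. Qed.
Let T_ej1 j : j != i ->
  T (e j) = ((fun=> 1 : K) j / qfact x (n_ j)) *: estring e k kv i j (n_ j).
Proof. by move/T_ej => ->; rewrite mul1r. Qed.

Let Bp := Bs i e k kv.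
Let Bm := Bs i f kv k.
Let Bp_U y : Bp y -> Ue y. Proof. exact: (Bs_Uh R). Qed.
Let Bm_U y : Bm y -> Uf y. Proof. exact: (Bs_Uh Rm). Qed.
Let TBp_U y : Bp y -> Ue (T y).
Proof. exact: (T_Bs_Uh q0 R T_k T_kv T_ei1 T_ej1). Qed.
Let TBm_U y : Bm y -> Uf (T y).
Proof. exact: (T_Bs_Uh q0 Rm T_kv T_k T_fi T_fj). Qed.
Let Lop_phi y : Bp y -> Lop i (phi y) = 0.
Proof. exact: (Lop_phi_Bs R Hp). Qed.
Let Lop_psi y : Bm y -> Lop i (psi y) = 0.
Proof. exact: (Lop_phi_Bs Rm Hm). Qed.
Let Rop_phi y : Bp y -> Rop i (phi (T y)) = 0.
Proof. exact: (Rop_phi_T_Bs q0 R T_k T_kv T_ei1 T_ej1 Hp). Qed.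
Let Rop_psi y : Bm y -> Rop i (psi (T y)) = 0.
Proof. exact: (Rop_phi_T_Bs q0 Rm T_kv T_k T_fi T_fj Hm). Qed.
Let Ue_gen j : Ue (e j). Proof. exact: gen_Ue. Qed.
Let Uf_gen j : Uf (f j). Proof. exact: gen_Ue. Qed.
Let Ue_Te j : j != i -> Ue (T (e j)).
Proof. by move=> ji; rewrite T_ej //; apply/subalgZ/(estring_Uh i R). Qed.

Let word_e := gword_Ue e.

Let TM y z : T (y * z) = T y * T z := rmorphM T y z.
Let tau0r y : Ue y -> tau y 0 = 0.
Proof. exact: (beta_0 (beta := tau_flip) tau_r). Qed.
Let tauZr c y z : Ue y -> Uf z -> tau y (c *: z) = c * tau y z.
Proof. by move=> yU zU; apply: (betaZ (beta := tau_flip) tau_r). Qed.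

Lemma tau_word_iter m j w y : Uf y -> Rop i (psi y) = 0 -> j != i ->
  tau (gword e w * estring e k kv i j m) y =
  iter m (Rop i) (Rop j (psi y)) w.
Proof.
move=> yU y0 ji; rewrite -gpsi_iter_Rop.
elim: m (gword e w) (word_e w) => [|m ih] z zU; first by rewrite expr0 mul1r.
have sU := estring_Uh i R j m.
rewrite estringS /Eop (cop_estring R (bq_ii q i) (bq_ij q ji)) -scalerAl.
rewrite -scaleNr mulrDr -scalerAr mulrA [z * (estring _ _ _ _ _ _ * _)]mulrA addrC.
rewrite tau_l //; last first.
- by apply: subalg_M => //; apply: subalg_M.
- by apply: subalg_M => //; apply: subalg_M.
rewrite (beta_R0 tau_l _ yU y0); last by apply: subalg_M.
by rewrite mulr0 add0r ih; [rewrite exprS !mulrA | apply: subalg_M].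
Qed.

(* On elements killed by the right derivation dual to e_i, only the term
   e_i^n e_j of T(e_j) pairs nontrivially. *)
Lemma psi_TeP j y d : Uf y -> Uf d -> Rop i (psi y) = 0 -> j != i ->
  (forall z, Ue z -> tau (z * T (e j)) y = tau z d) <->
  psi d = (qfact x (n_ j))^-1 *: iter (n_ j) (Rop i) (Rop j (psi y)).
Proof.
move=> yU dU y0 ji.
have wE w : tau (gword e w * T (e j)) y =
    (qfact x (n_ j))^-1 * iter (n_ j) (Rop i) (Rop j (psi y)) w.
  rewrite T_ej // -scalerAr (betaZ tau_l) //; first by rewrite tau_word_iter.
  by apply: subalg_M => //; apply: (estring_Uh i R).
split=> [E|E z].
  by apply/funext => w; rewrite /gpsi -E // wE.
move: z; apply: word_span_ext => [c z z' zU zU'|c z z' zU zU'|w].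
- by rewrite mulrDl -scalerAl tau_l //; apply: subalg_M => //; apply: Ue_Te.
- exact: tau_l.
- by rewrite wE [RHS](congr1 (fun v : V => v w) E).
Qed.

Lemma tau_Te j c : j != i -> Bm c -> exists d, [/\ Bm d,
  psi d = Rop j (psi c) &
  forall z, Ue z -> tau (z * T (e j)) (T c) = tau z (T d)].
Proof.
move=> ji; elim=> {c} [|a c c' cB [d [dB d1 d2]] c'B [d' [d'B d1' d2']]
  |z l li zB [d [dB d1 d2]]|z zB [d [dB d1 d2]]].
(* For c = 1 the pairing is a value at the empty word, and the function of a product with a root
   string vanishes there. *)
- exists 0; split; first exact: Bs0.
    by rewrite (phi0 Hm) (hm_1 Hm) Rop_vac.
  move=> z zU; rewrite rmorph1 rmorph0 tau0r //.
  have zsU := subalg_M zU (estring_Uh i R j (n_ j)).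
  rewrite T_ej // -scalerAr (betaZ tau_l _ zsU (subalg_1 _)).
  suff -> : tau (z * estring e k kv i j (n_ j)) 1 = 0 by rewrite mulr0.
  have := congr1 (fun v : V => v [::]) (phi_estring R Hp (n_ j) ji zU).
  by rewrite Gop_nil /gpsi /gword big_nil.
- have dU := Bm_U dB; have dU' := Bm_U d'B.
  have cU := Bm_U cB; have cU' := Bm_U c'B.
  have TdU := TBm_U dB; have TdU' := TBm_U d'B.
  have TcU := TBm_U cB; have TcU' := TBm_U c'B.
  exists (a *: d + d'); split; first exact: Bs_lin.
    by rewrite !(hm_lin Hm) // d1 d1' RopD RopZ.
  move=> z zU; have TeU := Ue_Te ji; have zTU := subalg_M zU TeU.
  by rewrite !linearP /= !tau_r // d2 // d2'.
- have dU := Bm_U dB; have zU := Bm_U zB.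
  have TdU := TBm_U dB; have TzU := TBm_U zB.
  have zlB : Bm (z * f l) by apply: Bs_e.
  have dfB : Bm (d * f l) by apply: Bs_e.
  (* The witness is dictated by [Rop_Xop'], and [transported_derivation] gives the same rule after
     T. *)
  have d'B : Bm (b j l *: (d * f l) + t j l *: z) by apply: BsD; apply: BsZ.
  exists (b j l *: (d * f l) + t j l *: z); split=> //.
    rewrite (hm_lin Hm) ?(phiZ Hm) ?(hm_e Hm) // ?Rop_Xop' ?d1 ?(bC l j) ?(tqC _ l j) //.
    - by apply: Bm_U.
    - by apply: subalgZ.
  have psiT y : Uf (T y) -> psi (T (y * f l)) =
      (zm l / qfact x (n_ l)) *: Gop q i l (n_ l) (psi (T y)).
    move=> yU; have sU := estring_Uh i Rm l (n_ l).
    have ysU := subalg_M yU sU.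
    by rewrite TM T_fj // -scalerAr (phiZ Hm) // (phi_estring Rm Hm).
  have [_ E] := psi_TeP (TBm_U zlB) (TBm_U d'B) (Rop_psi zlB) ji; apply: E.
  have /(psi_TeP TzU TdU (Rop_psi zB) ji) E := d2.
  have f0 := qfact_neq0 x0 xn1 (n_ j).
  rewrite psiT // (transported_derivation q0 qn1 ji li (zm_j ji) (Rop_psi zB)).
  rewrite linearP linearZ /=.
  have TdfU := TBm_U dfB.
  rewrite (hm_lin Hm) // ?(phiZ Hm) //; last exact: subalgZ.
  rewrite psiT // E GopZ scalerDr !scalerA; congr (_ *: _ + _ *: _).
    by ring.
  by rewrite mulrCA mulVf ?mulr1.
- have dU := Bm_U dB; have zU := Bm_U zB.
  have TdU := TBm_U dB; have TzU := TBm_U zB.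
  have EzB : Bm (Eop' (f i) (kv i) (k i) z) by apply: Bs_E.
  have EdB : Bm (Eop' (f i) (kv i) (k i) d) by apply: Bs_E.
  have tij : t i j = 0 by rewrite /tq eq_sym (negPf ji) mul0r oppr0.
  (* As [j] differs from [i], removing a last [j] commutes with both terms of [E'] up to the factor
     [b i j]. *)
  exists (b i j *: Eop' (f i) (kv i) (k i) d); split; first exact: BsZ.
    rewrite (phiZ Hm); last exact: Bm_U.
    rewrite !(phi_E' Rm Hm) // RopD RopN Rop_Xop' Rop_Xop Rop_Kop tij d1 XopZ.
    by rewrite !scale0r !addr0 scalerBr.
  move=> y yU; have TeU := Ue_Te ji; have yTU := subalg_M yU TeU.
  have TEzU := TBm_U EzB; have TEdU := TBm_U EdB.
  have ez := phi_T_E' q0 Rm T_kv T_k T_fi T_fj Hm zB.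
  have ed := phi_T_E' q0 Rm T_kv T_k T_fi T_fj Hm dB.
  rewrite linearZ /= tauZr //.
  rewrite (beta_KL kkv kvk cv_e tau_l Ue_cv yTU TzU TEzU ez).
  rewrite (beta_KL kkv kvk cv_e tau_l Ue_cv yU TdU TEdU ed).
  (* T(e_j) has weight s_i(alpha_j), so conjugation by k_i^-1 multiplies it by the scalar [b i j]
     already present in the witness. *)
  have cvT : cop (kv i) (k i) (T (e j)) = b i j *: T (e j).
    rewrite T_ej // linearZ /= (copV_estring R x0 (bq_ii q i) (bq_ij q ji)).
    rewrite (bq_ij q ji) exprD invfM mulrA mulfV ?expf_neq0 // mul1r.
    by rewrite !scalerA mulrC.
  have cyU : Ue (e i * cop (kv i) (k i) y) by apply: subalg_M => //; apply: Ue_cv.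
  rewrite (copM kkv) cvT mulrA -scalerAr (betaZ tau_l) //; last exact: subalg_M.
  by rewrite d2 // mulrCA.
Qed.

Let tau_1_T c : Bm c -> tau 1 c = tau 1 (T c).
Proof.
have nilE y : tau 1 y = psi y [::] by rewrite /gpsi /gword big_nil.
have X'0 l (v : V) : Xop' b t l v [::] = 0 by [].
elim=> {c} [|a c c' cB ih c'B ih'|z l li zB _|z zB _].
- by rewrite rmorph1.
- have cU := Bm_U cB; have cU' := Bm_U c'B.
  have TcU := TBm_U cB; have TcU' := TBm_U c'B.
  have u1 : Ue 1 by exact: subalg_1.
  by rewrite linearP !tau_r // ih ih'.
- have zU := Bm_U zB; have TzU := TBm_U zB.
  have sU := subalg_M TzU (estring_Uh i Rm l (n_ l)).
  rewrite !nilE TM T_fj // -scalerAr (hm_e Hm) // (phiZ Hm) // (phi_estring Rm Hm) //.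
  by rewrite wZE Gop_nil mulr0 X'0.
- have zU := Bm_U zB.
  rewrite !nilE (phi_E' Rm Hm) // (phi_T_E' q0 Rm T_kv T_k T_fi T_fj Hm zB).
  rewrite wDE X'0 wZE -[X in _ = _ * X]/(_ * psi (T z) [:: i]).
  have -> : psi (T z) [:: i] = Rop i (psi (T z)) [::] by [].
  by rewrite Rop_psi // -[X in _ + X]/(- 0) -[X in _ = _ * (_ * X)]/0 oppr0 !mulr0 addr0.
Qed.

(** Generators are taken off [g] one at a time and turned into derivations of [c], so [c] has to
    vary in the induction. *)
Lemma tau_T_Bs g c : Bp g -> Bm c -> tau g c = tau (T g) (T c).
Proof.
move=> gB; elim: gB c => {g} [|a g g' gB ih g'B ih'|g j ji gB ih|g gB ih] c cB.
- by rewrite rmorph1; apply: tau_1_T.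
- have gU := Bp_U gB; have gU' := Bp_U g'B; have cU := Bm_U cB.
  have TgU := TBp_U gB; have TgU' := TBp_U g'B; have TcU := TBm_U cB.
  by rewrite linearP !tau_l // ih // ih'.
- have [d [dB d1 d2]] := tau_Te ji cB.
  rewrite TM d2; last exact: TBp_U.
  rewrite -ih // (beta_R tau_l _ _ _ (esym d1)) //; [exact: Bp_U | exact: Bm_U | exact: Bm_U].
- have gU := Bp_U gB; have cU := Bm_U cB.
  have TgU := TBp_U gB; have TcU := TBm_U cB.
  pose d := Dop (e i) (k i) c.
  have dB : Bm d by apply: (Bs_D q0 Rm).
  have dU := Bm_U dB; have cgU : Ue (cop (k i) (kv i) g) := Uh_c i R gU.
  have EgB : Bp (Eop' (e i) (k i) (kv i) g) by apply: Bs_E.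
  have TEgU := TBp_U EgB.
  (* The term e_i c(g) of [E'] pairs to 0 with an element of [Bm], whose function has no first
     letter [i]; the term g e_i is dual to removing a last [i], which [Dop] realizes. *)
  have -> : tau (Eop' (e i) (k i) (kv i) g) c = tau g d.
    have egU : Ue (e i * cop (k i) (kv i) g) by apply: subalg_M.
    have geU : Ue (g * e i) by apply: subalg_M.
    rewrite /Eop' addrC -scaleN1r tau_l // (beta_L0 tau_l cgU cU (Lop_psi cB)).
    rewrite mulr0 add0r (beta_R tau_l gU cU dU) //.
    exact/esym/(phi_D q0 Rm Hm).
  (* Of the two terms of T(d), the one ending in [f i] pairs to 0 with T(g), whose function has no
     last letter [i]. The other is adjoint to the effect of T on [E']. *)
  rewrite ih //; have eTd : T d = T c * f i - f i * cop (k i) (kv i) (T c).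
    rewrite /d /Dop TM T_k raddfB /= !TM T_ei mulNr mulrN opprK mulrDl mulNr.
    by rewrite addrC -[T c * _ * _]mulrA -(mulrA (f i) (k i)) kkv mulr1 /cop !mulrA.
  have ccU : Uf (f i * cop (k i) (kv i) (T c)) by apply: subalg_M => //; apply: Uf_cv.
  have cfU : Uf (T c * f i) by apply: subalg_M.
  rewrite eTd addrC -scaleN1r tau_r //.
  rewrite -[tau (T g) (T c * f i)]/(tau_flip _ _).
  rewrite (beta_R0 (beta := tau_flip) tau_r TcU TgU (Rop_phi gB)) addr0.
  have eg := phi_T_E' q0 R T_k T_kv T_ei1 T_ej1 Hp gB.
  have E := beta_KL (beta := tau_flip) kvk kkv cv_f tau_r Uf_cv TcU TgU TEgU eg.
  by rewrite -[RHS]/(tau_flip _ _) E.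
Qed.

(** Words beginning with f_i pair to 0 with [g], whose function has no first letter [i]; only the
    term of index 0 is left. *)
Lemma tau_Bs_sum g N (h : nat -> U) : Bp g -> (forall m, Bm (h m)) ->
  tau g (\sum_(m < N.+1) f i ^+ m * h m) = tau g (h 0%N).
Proof.
move=> gB hB; have gU := Bp_U gB; have hU m := Bm_U (hB m).
have fU m : Uf (f i ^+ m) by apply/subalgX.
have fhU m : Uf (f i ^+ m * h m) by apply: subalg_M.
rewrite -[LHS]/(tau_flip (\sum_(m < N.+1) (fun p => f i ^+ p * h p) m) g).
rewrite (beta_sum (beta := tau_flip) tau_r) // big_ord_recl big1 => [|m _].
  by rewrite addr0 mul1r.
have fhU' := subalg_M (fU m) (hU m.+1).
rewrite /tau_flip lift0 exprS -mulrA -[LHS]/(tau_flip _ _).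
exact: (beta_L0 (beta := tau_flip) tau_r fhU' gU (Lop_phi gB)).
Qed.

Lemma pairing_T_invariant y z : Ue y -> Ue (T y) -> Uf z -> Uf (T z) ->
  tau (T y) (T z) = tau y z.
Proof.
move=> yU TyU zU TzU.
have [N [g [gB ey eTy g0]]] :=
  transport_decomposition q0 qn1 R (oner_neq0 _) T_k T_kv T_ei1 T_ej1 Hp yU TyU.
have [M [h [hB ez eTz _]]] :=
  transport_decomposition q0 qn1 Rm zm_i T_kv T_k T_fi T_fj Hm zU TzU.
have gU n := Bp_U (gB n); have hU n := Bm_U (hB n).
have TgU n := TBp_U (gB n); have ThU n := TBm_U (hB n).
rewrite (beta_ext tau_l TyU TzU (ThU 0%N) eTz) -[LHS]/(tau_flip _ _).
rewrite (beta_ext (beta := tau_flip) tau_r (ThU 0%N) TyU (TgU 0%N) eTy).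
rewrite -[LHS]/(tau _ _) -tau_T_Bs // -(tau_Bs_sum M (gB 0%N) hB) -ez.
(* The vanishing of T(g n) is transferred back to g n: against any word, g n sees only the component
   of the word in [Bm], on which T preserves the pairing. *)
have phi_gn n : (0 < n <= N)%N -> phi (g n) = 0.
  move=> nN; apply/funext => w; rewrite -[LHS]/(tau (g n) (gword f w)).
  have [M' [h' [h'B ->]]] := Uh_sum_Bs i Rm (gword_Ue f w).
  rewrite tau_Bs_sum // tau_T_Bs // -[LHS]/(tau_flip _ _).
  have ThU' := TBm_U (h'B 0%N).
  by rewrite (beta_ext0 (beta := tau_flip) tau_r ThU' (TgU n)) // g0.
have eU n : Ue (e i ^+ n) by apply/subalgX.
have egU n : Ue (e i ^+ n * g n) by apply: subalg_M.
rewrite ey -[RHS]/(tau (\sum_(n < N.+1) (fun p => e i ^+ p * g p) n) z) (beta_sum tau_l) // big_ord_recl big1 => [|n _].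
  by rewrite addr0 mul1r.
rewrite -[LHS]/(tau_flip z (e i ^+ n.+1 * g n.+1)).
apply: (beta_ext0 (beta := tau_flip) tau_r zU (egU n.+1)).
(* Left multiplication by [e i] acts on functions through the linear [X i], so it keeps elements
   with zero function among such elements. *)
elim: {1}(n.+1) => [|m ih]; first by rewrite mul1r phi_gn //= ltn_ord.
by rewrite exprS -mulrA (phi_left Hp) ?ih ?linear0 //; apply: subalg_M.
Qed.

End InvariantPairing.

(** * The quantized enveloping algebra *)

Section BraidOnGenerators.
Variables (K : fieldType) (q : K).
Hypotheses (q0 : q != 0) (qn1 : forall m, (0 < m)%N -> q ^+ m != 1).
Variables (D : datum) (i j : idx D) (ji : j != i).
Local Notation x := (q_ q i).
Local Notation n := (mcartan i j).

Let x0 := q_neq0 q0 i.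
Let xn1 m : (0 < m)%N -> x ^+ m != 1. Proof. exact: q_exp_neq1. Qed.

Section Generic.
#[local] Opaque qint qfact divpow.
Variables (U : algType K) (e f k kv : idx D -> U).
Hypothesis R : qrels (bq q) (dq q) e f k kv.

Lemma braid_sum_estring :
  \sum_(r < n.+1) ((-1) ^+ r * x ^- r) *:
    (divpow x (n - r) (e i) * e j * divpow x r (e i)) =
  (qfact x n)^-1 *: estring e k kv i j n.
Proof.
rewrite (estringE R x0 xn1 (bq_ii q i) (bq_ij q ji) (leqnSn n)) scalerA.
rewrite mulVf ?(qfact_neq0 x0 xn1) // scale1r /estring_sum; apply: eq_bigr => r _.
by rewrite subSnn muln1.
Qed.

(** The reversed sum has the coefficients of [braid_sum_estring] multiplied by (-1)^n x^n; this is
    the origin of the scalars [zeta] on U^-. *)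
Lemma braid_sum_rev_estring :
  \sum_(r < n.+1) ((-1) ^+ r * x ^+ r) *:
    (divpow x r (e i) * e j * divpow x (n - r) (e i)) =
  ((-1) ^+ n * x ^+ n / qfact x n) *: estring e k kv i j n.
Proof.
rewrite -scalerA -braid_sum_estring scaler_sumr (reindex_inj rev_ord_inj) /=.
apply: eq_bigr => r _; have rn : (r <= n)%N by rewrite -ltnS.
rewrite subSS subKn // scalerA; congr (_ *: _).
have s1 : (-1) ^+ r * (-1) ^+ r = 1 :> K by rewrite -exprMn mulrNN mulr1 expr1n.
have u := expf_neq0 r x0.
have en (y : K) : y ^+ n = y ^+ (n - r) * y ^+ r by rewrite -exprD subnK.
rewrite !en.
move: (x ^+ (n - r)) ((-1) ^+ (n - r)) ((-1) ^+ r) s1 (x ^+ r) u => y z s s1 w w0.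
have -> : z * s * (y * w) * (s / w) = z * y * (s * s) by field.
by rewrite s1 mulr1.
Qed.
End Generic.

End BraidOnGenerators.

Section BraidInvariance.
Variables (K : fieldType) (q : K).
Hypotheses (q0 : q != 0) (qn1 : forall m, (0 < m)%N -> q ^+ m != 1).
Variable D : datum.
Local Notation U := (Uq q D).
Local Notation V := (seq (idx D) -> K^o).

Lemma srefl_t (i : idx D) :
  val (- t_ i) = srefl (@alphav D) (@alpha D) i (val (t_ i)).
Proof.
rewrite sreflE -alphaZE alphaZ_t cartan_ii.
rewrite -[val (- t_ i)]/(- (alphav i *+ hlen i)) -[val (t_ i)]/(alphav i *+ hlen i).
rewrite intrM -scalerA scaler_int -pmulrn scaler_nat. 
by rewrite mulr2n mulrnDl opprD addrA subrr sub0r.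
Qed.

Lemma braid_invariant (Delta : {rmorphism U -> tensor U U})
    (hD : is_coproduct Delta) (tau : U -> U -> K)
    (ht : is_drinfeld_pairing Delta tau) (i : idx D) (T : {lrmorphism U -> U})
    (hT : is_braid_op i T) (y z : U) :
  Uplus q D y -> Uplus q D (T y) -> Uminus q D z -> Uminus q D (T z) ->
  tau (T y) (T z) = tau y z.
Proof.
have R := qrels_U q0 D true; rewrite /eU /fU /kU in R.
have Hp := half_module_of_form q0 qn1 i (half_form_e q0 hD ht).
have Hm := half_module_of_form q0 qn1 i (half_form_f q0 hD ht).
rewrite /eU /fU /kU in Hp Hm.
have kE : (fun j : idx D => k_ q (- - t_ j)) = (fun j => k_ q (t_ j)).
  by apply/funext => j; rewrite opprK.
rewrite kE in Hm.
have Tk : T (k_ q (t_ i)) = k_ q (- t_ i) by apply: (braid_k hT); apply: srefl_t.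
have Tkv : T (k_ q (- t_ i)) = k_ q (t_ i).
  apply: (braid_k hT); have := srefl_t i.
  by move/(congr1 (srefl (@alphav D) (@alpha D) i)); rewrite sreflK => ->.
have bii := bq_neq0 q0 i i.
(* At [i] the scalar comes from rewriting k_i^-1 e_i as a multiple of e_i k_i^-1 in T(f_i); at the
   other indices it is the one of [braid_sum_rev_estring]. *)
pose zm (j : idx D) := if j == i then (bq q i i)^-1
  else (-1) ^+ mcartan i j * q_ q i ^+ mcartan i j.
have Rm := qrels_swap (bq_neq0 q0 (D := D)) R.
have Tf : T (f_ q i) = - (zm i *: (e_ q i * k_ q (- t_ i))).
  rewrite /zm eqxx (braid_fi hT); congr (- _).
  exact: (qr_kve (bq_neq0 q0 (D := D)) R).
have Tej j : j != i -> T (e_ q j) = (qfact (q_ q i) (mcartan i j))^-1 *: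
    estring (e_ q (D := D)) (fun j => k_ q (t_ j)) (fun j => k_ q (- t_ j)) i j (mcartan i j).
  move=> ji; rewrite (braid_ej hT ji); exact: (braid_sum_estring q0 qn1 ji R).
have Tfj j : j != i -> T (f_ q j) = (zm j / qfact (q_ q i) (mcartan i j)) *:
    estring (f_ q (D := D)) (fun j => k_ q (- t_ j)) (fun j => k_ q (t_ j)) i j (mcartan i j).
  move=> ji; rewrite (braid_fj hT ji) /zm (negPf ji).
  exact: (braid_sum_rev_estring q0 qn1 ji Rm).
have zm0 : zm i != 0 by rewrite /zm eqxx invr_eq0.
have zmj j : j != i -> zm j = (-1) ^+ mcartan i j * q_ q i ^+ mcartan i j.
  by rewrite /zm => /negPf ->.
have tl c a a' d : Uplus q D a -> Uplus q D a' -> Uminus q D d ->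
    tau (c *: a + a') d = c * tau a d + tau a' d.
  move=> aU aU' dU; apply: (tauPl ht).
  - exact: (@tU_Uh _ _ _ true).
  - exact: (@tU_Uh _ _ _ true).
  - exact: (@tU_Uh _ _ _ false).
have tr c d d' a : Uminus q D d -> Uminus q D d' -> Uplus q D a ->
    tau a (c *: d + d') = c * tau a d + tau a d'.
  move=> dU dU' aU; apply: (tauPr ht).
  - exact: (@tU_Uh _ _ _ true).
  - exact: (@tU_Uh _ _ _ false).
  - exact: (@tU_Uh _ _ _ false).
exact: (pairing_T_invariant q0 qn1 R tl tr Hp Hm Tk Tkv (braid_ei hT) Tf Tej Tfj zm0 zmj).
Qed.

End BraidInvariance.

Lemma qq_neq0 : Defs.q != 0.
Proof. by rewrite /Defs.q -tofrac0 tofrac_eq polyX_eq0. Qed.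

Lemma qq_exp_neq1 m : (0 < m)%N -> Defs.q ^+ m != 1.
Proof.
move=> m0; rewrite /Defs.q -tofracXn -tofrac1 tofrac_eq.
apply/eqP => /(congr1 (size : {poly rat} -> nat)).
by rewrite size_polyXn size_poly1 => -[]; case: m m0.
Qed.

Local Open Scope classical_set_scope.

Theorem theorem5p1 (D : datum)
    (Delta : {rmorphism Uq q D -> tensor (Uq q D) (Uq q D)})
    (hDelta : is_coproduct Delta)
    (tau : Uq q D -> Uq q D -> Qq) (htau : is_drinfeld_pairing Delta tau)
    (i : idx D) (T : {lrmorphism Uq q D -> Uq q D}) (Tinv : Uq q D -> Uq q D)
    (hT : is_braid_op i T) (TK : cancel T Tinv) (TinvK : cancel Tinv T)
    (x y : Uq q D)
    (hx : x \in Uplus q D `&` T @` Uplus q D)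
    (hy : y \in Uminus q D `&` T @` Uminus q D) :
  tau (Tinv x) (Tinv y) = tau x y.
Proof.
move: hx hy; rewrite !in_setE => -[TxU [x' xU ex]] -[TyU [y' yU ey]].
rewrite -ex -ey !TK; rewrite -{}ex in TxU; rewrite -{}ey in TyU.
by rewrite (braid_invariant qq_neq0 qq_exp_neq1 hDelta htau hT).
Qed.
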